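(* Let $A_n$ be the $n$th Weyl algebra, $1\le n\le\infty$, over a field $\mathbb{K}$, and let $\mathcal{O}$ be an orbit of $\mathcal{G}$ on $\mathfrak{max}\,D$ (assumed to contain a maximal break if $\mathcal{O}$ is degenerate and $n=\infty$), with fixed ideal $\mathfrak{m}\in\mathcal{O}$. (i) If $\operatorname{char}\mathbb{K}=0$, then the modules $S(\mathcal{O})$ (for $\mathcal{O}$ nondegenerate) and $S(\mathcal{O},\mathfrak{p})$, where $\mathfrak{p}\in\mathfrak{B}_{\mathcal{O}}$ (for $\mathcal{O}$ degenerate), constitute an exhaustive list of pairwise non-isomorphic simple weight $A_n$-modules with support in $\mathcal{O}$. (ii) If $\operatorname{char}\mathbb{K}=p>0$, then the modules $S(\mathcal{O},\Gamma,\xi,\mathfrak{N})$, where $\Gamma\subseteq\underline{I}(\mathfrak{m})$, $\xi:\Gamma\to\{0,1\}$ and $\mathfrak{N}$ is a maximal ideal in the ring $\mathfrak{R}_{\Gamma,\xi}(\mathfrak{m})$, constitute an exhaustive list of pairwise non-isomorphic simple weight $A_n$-modules with support $\mathcal{O}$.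
   Context: **Weyl algebra and orbits.** $\mathbb{K}$ is a field and $n\in\{1,2,\dots\}\cup\{\infty\}$; for $n=\infty$ the index set $\{1,\dots,n\}$ means all positive integers. $A_n$ is the unital associative $\mathbb{K}$-algebra with generators $x_i,\partial_i$ ($1\le i\le n$) and relations $[x_i,x_j]=0=[\partial_i,\partial_j]$, $[\partial_i,x_j]=\delta_{i,j}1$. Put $t_i=\partial_i x_i$ and $D=\mathbb{K}[t_1,\dots,t_n]\subset A_n$ (a polynomial algebra). $\sigma_i$ is the $\mathbb{K}$-algebra automorphism of $D$ with $\sigma_i(t_j)=t_j-\delta_{i,j}1$; $\mathcal{G}$ is the group generated by the $\sigma_i$, acting on the set $\mathfrak{max}\,D$ of maximal ideals of $D$. An orbit $\mathcal{O}$ of $\mathcal{G}$ on $\mathfrak{max}\,D$ is degenerate if some $\mathfrak{n}\in\mathcal{O}$ contains some $t_i$, and nondegenerate otherwise. An ideal $\mathfrak{m}\in\mathcal{O}$ is a maximal break with respect to $\underline{I}(\mathfrak{m})\subset\{1,\dots,n\}$ if $t_i\in\mathfrak{m}$ for all $i\in\underline{I}(\mathfrak{m})$ and $t_j\notin\tau(\mathfrak{m})$ for all $j\notin\underline{I}(\mathfrak{m})$, $\tau\in\mathcal{G}$. (For $n<\infty$ every degenerate orbit contains a maximal break.) If $\mathcal{O}$ is degenerate, $\mathfrak{m}\in\mathcal{O}$ denotes a fixed maximal break; if $\mathcal{O}$ is nondegenerate, $\mathfrak{m}$ is any fixed element of $\mathcal{O}$ and $\underline{I}(\mathfrak{m})=\emptyset$.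 Write $\underline{I}=\underline{I}(\mathfrak{m})$ and $\underline{I}^c=\{1,\dots,n\}\setminus\underline{I}$. **The maps $\sigma_{\mathfrak{n}}$.** For $\mathfrak{n}\in\mathcal{O}$, $\sigma_{\mathfrak{n}}$ denotes the element of $\mathcal{G}/\mathfrak{stab}(\mathfrak{m})$ ($\mathfrak{stab}(\mathfrak{m})$ being the stabilizer of $\mathfrak{m}$ in $\mathcal{G}$) such that $\sigma_{\mathfrak{n}}(\mathfrak{m})=\mathfrak{n}$; it induces an isomorphism $D/\mathfrak{m}\to D/\mathfrak{n}$, again denoted $\sigma_{\mathfrak{n}}$. Under the action of $\mathcal{G}$ on $\mathcal{G}/\mathfrak{stab}(\mathfrak{m})$ one has $\sigma_i\sigma_{\mathfrak{n}}=\sigma_{\sigma_i(\mathfrak{n})}$. **Weight modules.** An $A_n$-module $V$ is a weight module if $V=\bigoplus_{\mathfrak{n}\in\mathfrak{max}\,D}V_{\mathfrak{n}}$ with $V_{\mathfrak{n}}=\{v\in V\mid\mathfrak{n}v=0\}$; its support is $\{\mathfrak{n}\mid V_{\mathfrak{n}}\ne0\}$. **Modules in characteristic 0.** If $\mathcal{O}$ is nondegenerate, $S(\mathcal{O})=\bigoplus_{\mathfrak{n}\in\mathcal{O}}D/\mathfrak{n}$ with $$x_i(d+\mathfrak{n})=\sigma_i(d)+\sigma_i(\mathfrak{n}),\qquad \partial_i(d+\mathfrak{n})=t_i\sigma_i^{-1}(d)+\sigma_i^{-1}(\mathfrak{n}).$$ If $\mathcal{O}$ is degenerate, $\mathfrak{B}_{\mathcal{O}}=\{\prod_{i\in\underline{I}}\sigma_i^{\delta_i}(\mathfrak{m})\mid\delta_i\in\{0,1\}\}$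 (only finitely many $\delta_i\neq0$). For $\mathfrak{p}=\prod_{i\in\underline{I}}\sigma_i^{\delta_i}(\mathfrak{m})\in\mathfrak{B}_{\mathcal{O}}$ let $\mathcal{O}_{\mathfrak{p}}$ be the set of all $\prod_i\sigma_i^{\gamma_i}(\mathfrak{p})$ with only finitely many $\gamma_i\neq 0$, where $\gamma_i=(-1)^{\delta_i+1}k$ with $k\in\{0,1,2,\dots\}$ if $i\in\underline{I}$, and $\gamma_i\in\mathbb{Z}$ if $i\in\underline{I}^c$. Then $S(\mathcal{O},\mathfrak{p})=\bigoplus_{\mathfrak{n}\in\mathcal{O}_{\mathfrak{p}}}D/\mathfrak{n}$ with action given by the same formulas, except that when the image is not in $S(\mathcal{O},\mathfrak{p})$ the result is $0$. **Modules in characteristic $p$.** For $\mathfrak{n}\in\mathcal{O}$ let $\underline{\tau}(\mathfrak{n})=(\tau_1,\dots,\tau_n)$, where $\tau_i=\sigma_i$ if $\sigma_i(\mathfrak{n})=\mathfrak{n}$ and $\tau_i=1$ otherwise; each $\tau_i$ induces an automorphism of $D/\mathfrak{n}$. For $\Gamma\subseteq\underline{I}$, $\xi:\Gamma\to\{0,1\}$ and $\mathfrak{n}\in\mathcal{O}$, let $$\mathfrak{R}_{\Gamma,\xi}(\mathfrak{n})=(D/\mathfrak{n})[d_i,c_j^{\pm1},\underline{\tau}(\mathfrak{n})\mid i\in\Gamma,\ j\in\underline{I}^c],$$ where $d_i:=a_i$ if $\xi(i)=0$ and $d_i:=b_i$ if $\xi(i)=1$: the skew (Laurent) polynomial algebra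 in which the variables commute with each other and, for $\lambda\in D/\mathfrak{n}$, $a_i\lambda=\tau_i(\lambda)a_i$, $\lambda b_i=b_i\tau_i(\lambda)$, $c_j\lambda=\tau_j(\lambda)c_j$. (If $\Gamma=\emptyset$ there is only one possible $\xi$ and there are no variables $d_i$.) For a maximal ideal $\mathfrak{N}$ of $\mathfrak{R}_{\Gamma,\xi}(\mathfrak{m})$ set $$S(\mathcal{O},\Gamma,\xi,\mathfrak{N})=\bigoplus_{\mathfrak{n}\in\mathcal{O}}\mathfrak{R}_{\Gamma,\xi}(\mathfrak{n})/\sigma_{\mathfrak{n}}(\mathfrak{N}),$$ where $\sigma_{\mathfrak{n}}(\mathfrak{N})$ means that $\sigma_{\mathfrak{n}}$ is applied to the coefficients of the elements of $\mathfrak{N}$ (likewise $\sigma_i^{\pm1}(f)$ means that $\sigma_i^{\pm1}$ is applied to the coefficients of $f$). Let $\widehat{\mathcal{G}}_i$ be the subgroup of $\mathcal{G}$ generated by all $\sigma_j$, $j\ne i$. The $A_n$-module structure is defined, for $f\in\mathfrak{R}_{\Gamma,\xi}(\mathfrak{n})$ and each $i$, by $$x_i(f+\sigma_{\mathfrak{n}}(\mathfrak{N}))=\begin{cases}\sigma_i(f)+\sigma_i\sigma_{\mathfrak{n}}(\mathfrak{N})&\text{if }\mathfrak{n}\ne\sigma\mathfrak{m}\text{ for any }\sigma\in\widehat{\mathcal{G}}_i;\\ b_i\sigma_i(f)+\sigma_i\sigma_{\mathfrak{n}}(\mathfrak{N})&\text{if }\mathfrak{n}=\sigma\mathfrak{m}\text{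 for some }\sigma\in\widehat{\mathcal{G}}_i,\ i\in\Gamma,\text{ and }\xi(i)=1;\\ c_i\sigma_i(f)+\sigma_i\sigma_{\mathfrak{n}}(\mathfrak{N})&\text{if }\mathfrak{n}=\sigma\mathfrak{m}\text{ for some }\sigma\in\widehat{\mathcal{G}}_i\text{ and }i\in\underline{I}^c;\\ 0&\text{in all other cases;}\end{cases}$$ $$\partial_i(f+\sigma_{\mathfrak{n}}(\mathfrak{N}))=\begin{cases}t_i\sigma_i^{-1}(f)+\sigma_i^{-1}\sigma_{\mathfrak{n}}(\mathfrak{N})&\text{if }\mathfrak{n}\ne\sigma_i\sigma\mathfrak{m}\text{ for any }\sigma\in\widehat{\mathcal{G}}_i;\\ a_it_i\sigma_i^{-1}(f)+\sigma_i^{-1}\sigma_{\mathfrak{n}}(\mathfrak{N})&\text{if }\mathfrak{n}=\sigma_i\sigma\mathfrak{m}\text{ for some }\sigma\in\widehat{\mathcal{G}}_i,\ i\in\Gamma,\text{ and }\xi(i)=0;\\ c_i^{-1}t_i\sigma_i^{-1}(f)+\sigma_i^{-1}\sigma_{\mathfrak{n}}(\mathfrak{N})&\text{if }\mathfrak{n}=\sigma_i\sigma\mathfrak{m}\text{ for some }\sigma\in\widehat{\mathcal{G}}_i\text{ and }i\in\underline{I}^c;\\ 0&\text{in all other cases.}\end{cases}$$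
   Formalization: In (ii), ∂_i acts by a_i σ_i^{-1}(f), not a_i t_i σ_i^{-1}(f) (which is 0); stab(m) is assumed to act trivially on D/m, so that σ_n is well defined; the list without repetition, still exhaustive, consists of the N containing no variable d_i, i in Γ. *)

(* Defs.v *)
From HB Require Import structures.
From mathcomp Require Import all_boot all_order all_algebra.
From mathcomp Require Import boolp classical_sets functions cardinality fsbigop.
From mathcomp Require Import finmap.
From mathcomp Require Import monalg.

Set Implicit Arguments.
Unset Strict Implicit.
Unset Printing Implicit Defensive.

Import GRing.Theory Num.Theory.

Local Open Scope classical_set_scope.
Local Open Scope ring_scope.
Local Open Scope quotient_scope.

Record is_ideal (R : pzRingType) (J : set R) : Prop := IsIdeal {
  ideal0 : J 0;
  idealB : forall x y, J x -> J y -> J (x - y);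
  idealMl : forall a x, J x -> J (a * x);
  idealMr : forall a x, J x -> J (x * a) }.

Definition maximal_ideal (R : pzRingType) (J : set R) : Prop :=
  [/\ is_ideal J, ~ J 1 &
      forall J' : set R, is_ideal J' -> ~ J' 1 -> J `<=` J' -> J' = J].

Lemma is_idealD (R : pzRingType) (J : set R) (x y : R) :
  is_ideal J -> J x -> J y -> J (x + y).
Proof.
move=> hJ hx hy; rewrite -[y]opprK; apply: (idealB hJ hx).
by rewrite -sub0r; apply: (idealB hJ) => //; apply: ideal0 hJ.
Qed.

Section Preimages.
Variables (R : nzRingType) (h k : {rmorphism R -> R}).
Hypotheses (hK : cancel h k) (kK : cancel k h).

Lemma preim_ideal (f : {rmorphism R -> R}) (J : set R) :
  is_ideal J -> is_ideal [set x | J (f x)].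
Proof.
move=> hJ; split=> /=.
- by rewrite rmorph0; apply: ideal0 hJ.
- by move=> x y hx hy; rewrite rmorphB; apply: (idealB hJ).
- by move=> a x hx; rewrite rmorphM; apply: (idealMl hJ).
- by move=> a x hx; rewrite rmorphM; apply: (idealMr hJ).
Qed.

Lemma preim_maximal (J : set R) :
  maximal_ideal J -> maximal_ideal [set x | J (h x)].
Proof.
move=> [hJ h1 hm]; split; first exact: preim_ideal.
  by rewrite /= rmorph1.
move=> J' hJ' h1' sub; have := hm [set x | J' (k x)] (preim_ideal k hJ').
rewrite /= rmorph1 => /(_ h1') e.
have {}e : [set x | J' (k x)] = J.
  by apply: e => x Jx; apply: sub; rewrite /= kK.
by apply/seteqP; split=> x /= => [J'x|]; [rewrite -e /= hK|apply: sub].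
Qed.
End Preimages.

(* The Weyl algebra: the free algebra on x_i = inl i and d_i = inr i modulo   *)
(* the two-sided ideal generated by the defining relations.                   *)

Section WeylAlgebra.
Variables (K : fieldType) (I : choiceType).

Definition free_algebra := {malg K[{fmonom (I + I)%type}]}.
HB.instance Definition _ := GRing.Lalgebra.on free_algebra.

Definition gen_x (i : I) : free_algebra := << fmu (inl i) >>.
Definition gen_d (i : I) : free_algebra := << fmu (inr i) >>.

Definition lie_bracket (R : pzRingType) (a b : R) : R := a * b - b * a.

Definition weyl_relators : set free_algebra :=
  [set r | (exists i j, r = lie_bracket (gen_x i) (gen_x j)) \/
           (exists i j, r = lie_bracket (gen_d i) (gen_d j)) \/
           (exists i j, r = lie_bracket (gen_d i) (gen_x j) - (i == j)%:R)].

Definition weyl_ideal : set free_algebra :=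
  [set f | forall J, is_ideal J -> weyl_relators `<=` J -> J f].

Lemma weyl_ideal_is_ideal : is_ideal weyl_ideal.
Proof.
split=> [J hJ _|x y hx hy J hJ rJ|a x hx J hJ rJ|a x hx J hJ rJ].
- exact: ideal0 hJ.
- by apply: (idealB hJ); [apply: hx|apply: hy].
- by apply: (idealMl hJ); apply: hx.
- by apply: (idealMr hJ); apply: hx.
Qed.

Definition weyl_pred : {pred free_algebra} := fun f => `[< weyl_ideal f >].

Lemma weyl_zmod_closed : zmod_closed weyl_pred.
Proof.
have h := weyl_ideal_is_ideal.
split; first by apply/asboolP; apply: ideal0 h.
by move=> x y /asboolP hx /asboolP hy; apply/asboolP; apply: (idealB h).
Qed.
HB.instance Definition _ :=
  GRing.isZmodClosed.Build free_algebra weyl_pred weyl_zmod_closed.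

Definition weyl_algebra := Quotient.quot weyl_pred.
HB.instance Definition _ := GRing.Zmodule.on weyl_algebra.

Definition weyl_pi (f : free_algebra) : weyl_algebra := \pi f.

Lemma weyl_piP (f g : free_algebra) :
  weyl_pi f = weyl_pi g <-> weyl_ideal (f - g).
Proof.
split; first by move=> /eqP; rewrite /weyl_pi -Quotient.idealrBE => /asboolP.
by move=> h; apply/eqP; rewrite /weyl_pi -Quotient.idealrBE; apply/asboolP.
Qed.

Lemma weyl_piD f g : weyl_pi (f + g) = weyl_pi f + weyl_pi g.
Proof. by rewrite /weyl_pi raddfD. Qed.

Definition weyl_one : weyl_algebra := weyl_pi 1.
Definition weyl_mul (a b : weyl_algebra) : weyl_algebra :=
  weyl_pi (repr a * repr b).
Definition weyl_scale (c : K) (a : weyl_algebra) : weyl_algebra :=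
  weyl_pi (c *: repr a).

Lemma weyl_repr (f : free_algebra) : weyl_ideal (repr (weyl_pi f) - f).
Proof. by apply/weyl_piP; rewrite /weyl_pi reprK. Qed.

Lemma weyl_pi_mul f g : weyl_mul (weyl_pi f) (weyl_pi g) = weyl_pi (f * g).
Proof.
have h := weyl_ideal_is_ideal; apply/weyl_piP.
set f' := repr _; set g' := repr _.
have -> : f' * g' - f * g = (f' - f) * g' + f * (g' - g).
  by rewrite mulrBl mulrBr addrA subrK.
apply: (is_idealD h); [apply: (idealMr h)|apply: (idealMl h)];
  exact: weyl_repr.
Qed.

Lemma weyl_pi_scale c f : weyl_scale c (weyl_pi f) = weyl_pi (c *: f).
Proof.
apply/weyl_piP; rewrite -scalerBr -mul_malgC.
by apply: (idealMl weyl_ideal_is_ideal); apply: weyl_repr.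
Qed.

Lemma weyl_ind (P : weyl_algebra -> Prop) :
  (forall f, P (weyl_pi f)) -> forall a, P a.
Proof. by move=> h a; rewrite -[a]reprK; apply: h. Qed.

Lemma weyl_mulA : associative weyl_mul.
Proof.
elim/weyl_ind=> f; elim/weyl_ind=> g; elim/weyl_ind=> h.
by rewrite !weyl_pi_mul mulrA.
Qed.
Lemma weyl_mul1 : left_id weyl_one weyl_mul.
Proof. by elim/weyl_ind=> f; rewrite weyl_pi_mul mul1r. Qed.
Lemma weyl_1mul : right_id weyl_one weyl_mul.
Proof. by elim/weyl_ind=> f; rewrite weyl_pi_mul mulr1. Qed.
Lemma weyl_mulDl : left_distributive weyl_mul +%R.
Proof.
elim/weyl_ind=> f; elim/weyl_ind=> g; elim/weyl_ind=> h.
by rewrite -weyl_piD !weyl_pi_mul mulrDl weyl_piD.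
Qed.
Lemma weyl_mulDr : right_distributive weyl_mul +%R.
Proof.
elim/weyl_ind=> f; elim/weyl_ind=> g; elim/weyl_ind=> h.
by rewrite -weyl_piD !weyl_pi_mul mulrDr weyl_piD.
Qed.
HB.instance Definition _ := GRing.Zmodule_isPzRing.Build weyl_algebra
  weyl_mulA weyl_mul1 weyl_1mul weyl_mulDl weyl_mulDr.

Lemma weyl_scaleA a b v : weyl_scale a (weyl_scale b v) = weyl_scale (a * b) v.
Proof. by elim/weyl_ind: v => f; rewrite !weyl_pi_scale scalerA. Qed.
Lemma weyl_scale1 : left_id 1 weyl_scale.
Proof. by elim/weyl_ind=> f; rewrite weyl_pi_scale scale1r. Qed.
Lemma weyl_scaleDr : right_distributive weyl_scale +%R.
Proof.
move=> c; elim/weyl_ind=> f; elim/weyl_ind=> g.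
by rewrite -weyl_piD !weyl_pi_scale scalerDr weyl_piD.
Qed.
Lemma weyl_scaleDl v : {morph weyl_scale^~ v : a b / a + b}.
Proof.
by move=> a b; elim/weyl_ind: v => f; rewrite !weyl_pi_scale scalerDl weyl_piD.
Qed.
HB.instance Definition _ := GRing.Zmodule_isLmodule.Build K weyl_algebra
  weyl_scaleA weyl_scale1 weyl_scaleDr weyl_scaleDl.

Lemma weyl_scaleAl (c : K) (a b : weyl_algebra) : c *: (a * b) = c *: a * b.
Proof.
elim/weyl_ind: a => f; elim/weyl_ind: b => g.
by rewrite -[_ * _]/(weyl_mul _ _) -[RHS]/(weyl_mul (weyl_scale _ _) _)
  -[LHS]/(weyl_scale _ _) !(weyl_pi_scale, weyl_pi_mul) scalerAl.
Qed.
Lemma free_scaleAr (c : K) (f g : free_algebra) : c *: (f * g) = f * (c *: g).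
Proof.
suff mulC (h : free_algebra) : h * c%:MP = c *: h.
  by rewrite -(mul_malgC c g) mulrA mulC scalerAl.
rewrite malgM_def fgmulgU [in RHS](monalgE h) scaler_sumr.
apply: eq_bigr => k _; rewrite mulm1 mulrC.
by apply/malgP => k'; rewrite mcoeffZ !mcoeffU mulrnAr.
Qed.
Lemma weyl_scaleAr (c : K) (a b : weyl_algebra) : c *: (a * b) = a * (c *: b).
Proof.
elim/weyl_ind: a => f; elim/weyl_ind: b => g.
by rewrite -[_ * _]/(weyl_mul _ _) -[RHS]/(weyl_mul _ (weyl_scale _ _))
  -[LHS]/(weyl_scale _ _) !(weyl_pi_scale, weyl_pi_mul) free_scaleAr.
Qed.

Definition weyl_x (i : I) : weyl_algebra := weyl_pi (gen_x i).
Definition weyl_d (i : I) : weyl_algebra := weyl_pi (gen_d i).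
Definition weyl_const (c : K) : weyl_algebra := c *: (1 : weyl_algebra).
Definition weyl_t (i : I) : weyl_algebra := weyl_d i * weyl_x i.
End WeylAlgebra.

Notation polyD K I := {malg K[{cmonom I}]}.

Section PolyD.
Variables (K : fieldType) (I : choiceType).
Local Notation D := (polyD K I).
Implicit Types (g : {malg int[I]}) (f : D).

Definition tvar (i : I) : D := << ucm i >>.

(* D inside A_n: t_i |-> d_i x_i.                                             *)
Definition D_in_weyl (f : D) : weyl_algebra K I :=
  \sum_(u <- msupp f) f@_u *: \prod_(i <- finsupp u) weyl_t K i ^+ u i.

(* The group generated by the sigma_i is abelian: its elements are the        *)
(* finite products sigma^g := \prod_i sigma_i^(g i), which send t_j to        *)
(* t_j - g j.  Finitely supported exponents g are elements of {malg int[I]}.  *)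
Definition shift_mon g (u : {cmonom I}) : D :=
  \prod_(i <- finsupp u) (tvar i - (g@_i)%:~R) ^+ u i.

Lemma shift_mon_morph g : mmorphism (shift_mon g).
Proof.
have wide (u : {cmonom I}) (d : {fset I}) : (finsupp u `<=` d)%fset ->
    shift_mon g u = \prod_(i <- d) (tvar i - (g@_i)%:~R) ^+ u i.
  move=> le; apply: big_fset_incl => // i _ /fsfun_dflt /= ui.
  by rewrite ui expr0.
split=> [u v|]; last by rewrite /shift_mon mdom1 big_seq_fset0.
rewrite (wide u _ (fsubsetUl _ (finsupp v))) (wide v _ (fsubsetUr (finsupp u) _)).
rewrite -big_split (wide _ (finsupp u `|` finsupp v)%fset) ?mdomD //=.
by apply: eq_bigr => i _; rewrite cmM exprD.
Qed.
HB.instance Definition _ g :=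
  monalg.isMultiplicative.Build {cmonom I} D (shift_mon g) (shift_mon_morph g).

Definition shift g : D -> D := mmap (@malgC _ K) (shift_mon g).
HB.instance Definition _ g := GRing.RMorphism.on (shift g).

Lemma shiftC g c : shift g c%:MP = c%:MP.
Proof. exact: mmapC. Qed.

Lemma shift_tvar g i : shift g (tvar i) = tvar i - (g@_i)%:~R.
Proof.
by rewrite /shift mmapU -[X in X * _]/(1 : D) mul1r /shift_mon mdomU big_seq_fset1 cmUU expr1.
Qed.

Lemma malg_monoE (u : {cmonom I}) (c : K) : << c *g u >> = c%:MP * << u >> :> D.
Proof. by rewrite malgM_def fgmulUU mulr1 mul1m. Qed.

Lemma polyD_rmorph_ext (R : nzRingType) (h k : {rmorphism D -> R}) :
  (forall c, h c%:MP = k c%:MP) -> (forall i, h (tvar i) = k (tvar i)) ->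
  h =1 k.
Proof.
move=> hC ht f; rewrite (monalgE f) !rmorph_sum /=; apply: eq_bigr => u _.
suff main n (v : {cmonom I}) : mdeg v = n -> h << v >> = k << v >>.
  rewrite (malg_monoE u (f@_u)) (rmorphM h) (rmorphM k).
  exact: (congr2 *%R (hC (f@_u)) (main _ u (erefl _))).
elim: n v {f u} => [u /mdeg_eq0I -> |n IHn u hu]; first by rewrite !rmorph1.
have [i ui] : exists i, i \in finsupp u.
  have [u0|[i ui]] := fset_0Vmem (finsupp u); last by exists i.
  by move: hu; rewrite mdegE u0 big_seq_fset0.
have uE : u = mmul (ucm i) (divcm u (ucm i)).
  apply/eqP/cmP => j; rewrite cmM divcmE ucmE; case: eqP => [<-|_] /=.
    by rewrite subnKC // lt0n cmE_neq0.
  by rewrite add0n subn0.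
have -> : << u >> = tvar i * << divcm u (ucm i) >> :> D.
  by rewrite malgM_def fgmulUU mulr1 -uE.
rewrite (rmorphM h) (rmorphM k); apply: congr2 (ht i) (IHn _ _).
by move: hu; rewrite [in mdeg u]uE mdegM mdegU; case.
Qed.

Lemma shift0 : shift 0 =1 id.
Proof.
apply: (@polyD_rmorph_ext _ (shift 0) idfun) => [c|i] /=; first exact: shiftC.
by rewrite shift_tvar mcoeff0 subr0.
Qed.

Lemma shiftD g h : shift (g + h) =1 shift g \o shift h.
Proof.
apply: (@polyD_rmorph_ext _ (shift (g + h)) (shift g \o shift h)) => [c|i] /=.
  by rewrite !shiftC.
rewrite !shift_tvar rmorphB /= shift_tvar rmorph_int mcoeffD.
by rewrite rmorphD opprD addrA.
Qed.
End PolyD.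

Section MaxD.
Variables (K : fieldType) (I : choiceType).
Local Notation D := (polyD K I).
Implicit Types (g h : {malg int[I]}) (f : D).

Record maxD := MaxD {
  max_set :> set D;
  max_setP : maximal_ideal max_set }.
HB.instance Definition _ := gen_eqMixin maxD.
HB.instance Definition _ := gen_choiceMixin maxD.

Lemma maxD_inj (n n' : maxD) : max_set n = max_set n' -> n = n'.
Proof.
by case: n n' => [J hJ] [J' hJ'] /= e; subst J'; congr MaxD; apply: Prop_irrelevance.
Qed.

Definition max_pred (n : maxD) : {pred D} := fun f => `[< max_set n f >].

Lemma max_pred_idealr (n : maxD) : idealr_closed (max_pred n).
Proof.
have [hJ h1 _] := max_setP n; split.
- by apply/asboolP; apply: ideal0 hJ.
- by apply/asboolPn.
- move=> a u v /asboolP hu /asboolP hv; apply/asboolP.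
  by apply: (is_idealD hJ) => //; apply: (idealMl hJ).
Qed.
HB.instance Definition _ (n : maxD) :=
  isIdealr.Build D (max_pred n) (max_pred_idealr n).

Definition residue (n : maxD) := {ideal_quot max_pred n}.
HB.instance Definition _ (n : maxD) := GRing.ComNzRing.on (residue n).

Definition res (n : maxD) (f : D) : residue n := \pi_{ideal_quot max_pred n} f.

Lemma resP n f f' : res n f = res n f' <-> max_set n (f - f').
Proof.
split; first by move=> /eqP; rewrite /res -Quotient.idealrBE => /asboolP.
by move=> h; apply/eqP; rewrite /res -Quotient.idealrBE; apply/asboolP.
Qed.

Lemma res_morph n : zmod_morphism (res n) * monoid_morphism (res n).
Proof.
by split; [move=> f f'; rewrite /res rmorphB|split=> [|f f'];
  rewrite /res ?rmorph1 ?rmorphM].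
Qed.
HB.instance Definition _ n :=
  GRing.isZmodMorphism.Build D (residue n) (res n) (res_morph n).1.
HB.instance Definition _ n :=
  GRing.isMonoidMorphism.Build D (residue n) (res n) (res_morph n).2.

Lemma residue_ind n (P : residue n -> Prop) :
  (forall f, P (res n f)) -> forall q, P q.
Proof. by move=> h q; rewrite -[q]reprK; apply: h. Qed.

Lemma shiftK g : cancel (shift g) (shift (- g) : D -> D).
Proof.
by move=> f; rewrite -[LHS](shiftD (- g) g) addNr; apply: shift0.
Qed.
Lemma shiftNK g : cancel (shift (- g)) (shift g : D -> D).
Proof.
by move=> f; rewrite -[LHS](shiftD g (- g)) addrN; apply: shift0.
Qed.

Lemma shift_imageE g (J : set D) :
  [set shift g f | f in J] = [set f | J (shift (- g) f)].
Proof.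
apply/seteqP; split=> [_ [f Jf <-]|f Jf] /=; first by rewrite shiftK.
by exists (shift (- g) f) => //; rewrite shiftNK.
Qed.

Lemma shift_maximal g (n : maxD) : maximal_ideal [set shift g f | f in n].
Proof.
rewrite shift_imageE.
exact: (preim_maximal (h := shift (- g)) (k := shift g)
  (shiftNK g) (shiftK g) (max_setP n)).
Qed.

Definition act g (n : maxD) : maxD := MaxD (shift_maximal g n).

Lemma actE g n f : max_set (act g n) f <-> max_set n (shift (- g) f).
Proof.
by rewrite -[max_set (act g n)]/([set shift g f0 | f0 in max_set n]) shift_imageE.
Qed.

Lemma act0 n : act 0 n = n.
Proof.
apply: maxD_inj; apply/seteqP; split=> f.
  by move/actE; rewrite oppr0 shift0.
by move=> nf; apply/actE; rewrite oppr0 shift0.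
Qed.

Lemma actD g h n : act (g + h) n = act g (act h n).
Proof.
apply: maxD_inj; apply/seteqP; split=> f.
  by move/actE => nf; apply/actE/actE; rewrite -[shift _ _]shiftD -opprD addrC.
move/actE/actE => nf; apply/actE.
by rewrite addrC opprD -[shift _ _]/(shift (- h - g) f) shiftD.
Qed.

Definition G_orbit (m : maxD) : set maxD := [set act g m | g in setT].

Lemma G_orbit_act g m n : G_orbit m n -> G_orbit m (act g n).
Proof. by case=> h _ <-; exists (g + h) => //; rewrite actD. Qed.

(* The exponent of sigma_i^k.                                                 *)
Definition sg (k : int) (i : I) : {malg int[I]} := << k *g i >>.

(* The orbit of m under the subgroup generated by the sigma_j with j != i.    *)
Definition hatG_orbit (i : I) (m : maxD) : set maxD :=
  [set act g m | g in [set g | g@_i = 0]].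

(* The map D/n -> D/n' induced by sigma^g, when sigma^g(n) = n'.              *)
Definition res_shift g (n n' : maxD) (q : residue n) : residue n' :=
  res n' (shift g (repr q)).

Lemma res_shiftE g n n' f : act g n = n' ->
  res_shift g n' (res n f) = res n' (shift g f).
Proof.
move=> <-; apply/resP; rewrite -rmorphB; apply/actE; rewrite shiftK.
by apply/resP; rewrite /res reprK.
Qed.

Lemma res_shift_morph g n n' : act g n = n' ->
  zmod_morphism (@res_shift g n n') * monoid_morphism (@res_shift g n n').
Proof.
move=> e; split; last split.
- elim/residue_ind=> f; elim/residue_ind=> f'.
  by rewrite -rmorphB !(res_shiftE _ e) !rmorphB.
- by rewrite -[1](rmorph1 (res n)) (res_shiftE _ e) !rmorph1.
- elim/residue_ind=> f; elim/residue_ind=> f'.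
  by rewrite -rmorphM !(res_shiftE _ e) !rmorphM.
Qed.
End MaxD.

(* Skew monoid rings: finitely supported functions E -> L with                *)
(* (a X^u) (b X^v) = a theta_u(b) X^(u + v).                                  *)

Record twist (L : comNzRingType) (E : nmodType) := Twist {
  twist_fun :> E -> L -> L;
  twistB : forall u, zmod_morphism (twist_fun u);
  twistM : forall u, monoid_morphism (twist_fun u);
  twist0 : twist_fun 0 =1 id;
  twistD : forall u v, twist_fun (u + v) =1 twist_fun u \o twist_fun v }.

Section SkewRing.
Variables (L : comNzRingType) (E : nmodType) (theta : twist L E).
HB.instance Definition _ u := GRing.isZmodMorphism.Build L L (theta u) (twistB theta u).
HB.instance Definition _ u := GRing.isMonoidMorphism.Build L L (theta u) (twistM theta u).

Definition skew_ring : Type := let _ := theta in {malg L[E]}.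
HB.instance Definition _ := GRing.Zmodule.copy skew_ring {malg L[E]}.
Implicit Types f g h : skew_ring.

Definition skew_one : skew_ring := << 1 *g (0 : E) >>.
Definition skew_mul f g : skew_ring :=
  \sum_(u <- msupp f) \sum_(v <- msupp g) << f@_u * theta u g@_v *g (u + v) >>.

Lemma skew_mulEw (d1 d2 : {fset E}) f g :
  (msupp f `<=` d1)%fset -> (msupp g `<=` d2)%fset ->
  skew_mul f g = \sum_(u <- d1) \sum_(v <- d2) << f@_u * theta u g@_v *g (u + v) >>.
Proof.
move=> le1 le2; rewrite /skew_mul (big_fset_incl _ le1) /=.
  apply: eq_bigr => u _; apply: big_fset_incl => // v _ /mcoeff_outdom ->.
  by rewrite rmorph0 mulr0 monalgU0.
move=> u _ /mcoeff_outdom fu; rewrite big1 // => v _.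
by rewrite fu mul0r monalgU0.
Qed.

Lemma skew_mulDl : left_distributive skew_mul +%R.
Proof.
move=> f g h; pose d := (msupp f `|` msupp g)%fset.
rewrite (@skew_mulEw d (msupp h) (f + g)) ?msuppD_le //.
rewrite (@skew_mulEw d (msupp h) f) ?fsubsetUl //.
rewrite (@skew_mulEw d (msupp h) g) ?fsubsetUr //.
rewrite -big_split /=; apply: eq_bigr => u _.
rewrite -big_split /=; apply: eq_bigr => v _.
by rewrite mcoeffD mulrDl monalgUD.
Qed.

Lemma skew_mulDr : right_distributive skew_mul +%R.
Proof.
move=> f g h; pose d := (msupp g `|` msupp h)%fset.
rewrite (@skew_mulEw (msupp f) d f (g + h)) ?msuppD_le //.
rewrite (@skew_mulEw (msupp f) d f g) ?fsubsetUl //.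
rewrite (@skew_mulEw (msupp f) d f h) ?fsubsetUr //.
rewrite -big_split /=; apply: eq_bigr => u _.
rewrite -big_split /=; apply: eq_bigr => v _.
by rewrite mcoeffD rmorphD mulrDr monalgUD.
Qed.

Lemma skew_mulUU (a b : L) (u v : E) :
  skew_mul << a *g u >> << b *g v >> = << a * theta u b *g (u + v) >>.
Proof.
rewrite (skew_mulEw msuppU_le msuppU_le) !big_seq_fset1.
by rewrite !mcoeffUU.
Qed.

Lemma skew_mul0l : left_zero 0 skew_mul.
Proof. by move=> f; rewrite /skew_mul msupp0 big_seq_fset0. Qed.
Lemma skew_mul0r : right_zero 0 skew_mul.
Proof.
by move=> f; rewrite /skew_mul big1 // => u _; rewrite msupp0 big_seq_fset0.
Qed.

Lemma skew_ind (P : skew_ring -> Prop) :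
  P 0 -> (forall f g, P f -> P g -> P (f + g)) ->
  (forall (a : L) (u : E), P << a *g u >>) -> forall f, P f.
Proof.
move=> P0 PD PU f; rewrite (monalgE f).
by elim/big_ind: _ => // u _; apply: PU.
Qed.

Lemma skew_mulA : associative skew_mul.
Proof.
move=> f g h; elim/skew_ind: f => [|f f' IH IH'|a u].
- by rewrite !skew_mul0l.
- by rewrite !skew_mulDl IH IH'.
elim/skew_ind: g => [|g g' IH IH'|b v].
- by rewrite skew_mul0l !skew_mul0r skew_mul0l.
- by rewrite skew_mulDl !skew_mulDr skew_mulDl IH IH'.
elim/skew_ind: h => [|h h' IH IH'|c w]; first by rewrite !skew_mul0r.
  by rewrite !skew_mulDr IH IH'.
by rewrite !skew_mulUU rmorphM twistD mulrA addrA.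
Qed.

Lemma skew_mul1l : left_id skew_one skew_mul.
Proof.
elim/skew_ind=> [|f f' IH IH'|a u]; first by rewrite skew_mul0r.
  by rewrite skew_mulDr IH IH'.
by rewrite skew_mulUU mul1r twist0 add0r.
Qed.

Lemma skew_mul1r : right_id skew_one skew_mul.
Proof.
elim/skew_ind=> [|f f' IH IH'|a u]; first by rewrite skew_mul0l.
  by rewrite skew_mulDl IH IH'.
by rewrite skew_mulUU rmorph1 mulr1 addr0.
Qed.

Lemma skew_one_neq0 : skew_one != 0.
Proof. by rewrite monalgU_eq0 oner_eq0. Qed.

HB.instance Definition _ := GRing.Zmodule_isNzRing.Build skew_ring
  skew_mulA skew_mul1l skew_mul1r skew_mulDl skew_mulDr skew_one_neq0.

Definition skewU (a : L) (u : E) : skew_ring := << a *g u >>.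
End SkewRing.

Definition coeff_map (E : choiceType) (L L' : zmodType) (phi : L -> L')
    (f : {malg L[E]}) : {malg L'[E]} :=
  \sum_(u <- msupp f) << phi f@_u *g u >>.

Lemma coeff_map_zmod (E : choiceType) (L L' : zmodType) (phi : L -> L') :
  zmod_morphism phi -> zmod_morphism (@coeff_map E L L' phi).
Proof.
move=> hphi; pose hH := GRing.isZmodMorphism.Build L L' phi hphi.
pose Phi : {additive L -> L'} := HB.pack phi hH.
have coefE (f : {malg L[E]}) u : (coeff_map phi f)@_u = phi f@_u.
  rewrite /coeff_map raddf_sum /= [in RHS](monalgE f) raddf_sum /=.
  rewrite -[RHS]/(Phi _) (raddf_sum Phi); apply: eq_bigr => v _.
  by rewrite !mcoeffU (raddfMn Phi).
move=> f g; apply/malgP => u.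
by rewrite mcoeffB !coefE mcoeffB; apply: hphi.
Qed.

Section Modules.
Variables (K : fieldType) (I : choiceType).
Local Notation A := (weyl_algebra K I).
Local Notation D := (polyD K I).
Implicit Types (V W : lmodType A).

Definition weight_space V (n : maxD K I) : set V :=
  [set v | forall f : D, max_set n f -> D_in_weyl f *: v = 0].

Definition weight_module V : Prop :=
  forall v : V, exists! w : maxD K I -> V,
    [/\ forall n, @weight_space V n (w n),
        finite_set [set n | w n != 0] &
        v = \sum_(n \in setT) w n].

Definition weight_support V : set (maxD K I) :=
  [set n | exists2 v, @weight_space V n v & v != 0].

Definition simple_module V : Prop :=
  (exists v : V, v != 0) /\
  forall S : {pred V}, submod_closed S -> S =i pred1 0 \/ S =i predT.

Definition isomorphic V W : Prop := exists phi : {linear V -> W}, bijective phi.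
End Modules.

(* V is the direct sum of the groups Q n, with canonical injections e n.      *)
Definition is_direct_sum (T : choiceType) (Q : T -> zmodType) (V : zmodType)
    (e : forall n, {additive Q n -> V}) : Prop :=
  forall v : V, exists! q : forall n, Q n,
    finite_set [set n | q n != 0] /\ v = \sum_(n \in setT) e n (q n).

Section Breaks.
Variables (K : fieldType) (I : choiceType).
Implicit Types (m n p : maxD K I) (Ib : set I).

Definition degenerate m : Prop :=
  exists2 n, G_orbit m n & exists i, max_set n (tvar K i).

Definition maximal_break m Ib : Prop :=
  (forall i, Ib i -> max_set m (tvar K i)) /\
  (forall j, ~ Ib j -> forall g, ~ max_set (act g m) (tvar K j)).

(* m is the fixed ideal of its orbit, and Ib is \underline{I}(m).             *)
Definition fixed_ideal m Ib : Prop :=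
  (degenerate m -> maximal_break m Ib) /\ (~ degenerate m -> Ib = set0).

(* The family (delta_i), delta_i in {0,1}, is given as the finite set         *)
(* {i | delta_i = 1}.                                                         *)
Definition delta_exp (delta : {fset I}) : {malg int[I]} := \sum_(i <- delta) sg 1 i.

Definition B_O m Ib : set (maxD K I) :=
  [set p | exists2 delta : {fset I}, (forall i, i \in delta -> Ib i) &
           p = act (delta_exp delta) m].

Definition O_p m Ib p : set (maxD K I) :=
  [set n | exists delta : {fset I},
     [/\ forall i, i \in delta -> Ib i, p = act (delta_exp delta) m &
      exists2 g : {malg int[I]},
        forall i, Ib i -> exists k : nat, g@_i = (-1) ^+ (i \in delta).+1 * k%:Z &
        n = act g p]].
End Breaks.

(* V is the A_n-module \bigoplus_(n in T) D/n, with                           *)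
(*   x_i (d + n) = sigma_i(d) + sigma_i(n),                                   *)
(*   d_i (d + n) = t_i sigma_i^-1(d) + sigma_i^-1(n),                         *)
(* the result being 0 when the target summand does not occur: this is S(O)    *)
(* for T = O and S(O,p) for T = O_p.                                          *)
Definition is_S0 (K : fieldType) (I : choiceType) (T : set (maxD K I))
    (V : lmodType (weyl_algebra K I)) : Prop :=
  exists e : forall n : T, {additive residue (val n) -> V},
    is_direct_sum e /\
    forall (n : T) (f : polyD K I),
      let v : V := e n (res _ f) in
      (forall c : K, weyl_const I c *: v = e n (res _ (c *: f))) /\
      forall i : I,
        [/\ forall n' : T, val n' = act (sg 1 i) (val n) ->
              weyl_x K i *: v = e n' (res _ (shift (sg 1 i) f)),
            ~ T (act (sg 1 i) (val n)) -> weyl_x K i *: v = 0,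
            forall n' : T, val n' = act (sg (-1) i) (val n) ->
              weyl_d K i *: v = e n' (res _ (tvar K i * shift (sg (-1) i) f)) &
            ~ T (act (sg (-1) i) (val n)) -> weyl_d K i *: v = 0].

(* The rings R_{Gamma,xi}(n).  A monomial \prod_i d_i^(u i) \prod_j c_j^(u j) *)
(* is its exponent u, with u i >= 0 for i in Gamma, u j arbitrary for j not   *)
(* in Ib, and u i = 0 for i in Ib \ Gamma.                                    *)

Section Exponents.
Variables (I : choiceType) (Ib Gamma : set I).

Definition admissible : {pred {malg int[I]}} := fun u =>
  `[< forall i, (Gamma i -> 0 <= u@_i) /\ (Ib i -> ~ Gamma i -> u@_i = 0) >].

Record expo := Expo { expo_val :> {malg int[I]}; _ : admissible expo_val }.
HB.instance Definition _ := [isSub for expo_val].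
HB.instance Definition _ := [Choice of expo by <:].

Lemma admissible_addr_closed : addr_closed admissible.
Proof.
split; first by apply/asboolP => i; rewrite mcoeff0.
move=> u v /asboolP hu /asboolP hv; apply/asboolP => i; rewrite mcoeffD.
split=> [Gi|Ii Gi]; first by apply: addr_ge0; [apply: (hu i).1|apply: (hv i).1].
by rewrite (hu i).2 // (hv i).2.
Qed.
HB.instance Definition _ :=
  GRing.SubChoice_isSubNmodule.Build {malg int[I]} admissible expo
    admissible_addr_closed.

(* The exponent of the k-th power of the i-th variable; junk value 0 when     *)
(* there is no such monomial.                                                 *)
Definition expo_var (k : int) (i : I) : expo := insubd 0 (sg k i).
End Exponents.

Section RRing.
Variables (K : fieldType) (I : choiceType) (Ib Gamma : set I) (xi : Gamma -> bool).
Local Notation E := (expo Ib Gamma).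
Implicit Types (n m : maxD K I).

Definition xi_is (b : bool) (i : I) : Prop :=
  exists2 j : Gamma, val j = i & xi j = b.

(* From a_i l = tau_i(l) a_i, l b_i = b_i tau_i(l), c_j l = tau_j(l) c_j:     *)
(* moving a monomial of exponent u over l applies \prod_i tau_i^(+- u i) to   *)
(* l, with sign - for the variables b_i, and tau_i = 1 unless                 *)
(* sigma_i(n) = n.                                                            *)
Definition tau_sign (i : I) : int := if `[< xi_is true i >] then -1 else 1.

Definition tau_exp n (u : {malg int[I]}) : {malg int[I]} :=
  \sum_(i <- msupp u | `[< act (sg 1 i) n = n >]) sg (tau_sign i * u@_i) i.

Lemma tau_expE n u i :
  (tau_exp n u)@_i = if `[< act (sg 1 i) n = n >] then tau_sign i * u@_i else 0.
Proof.
rewrite /tau_exp raddf_sum /=.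
have [iu|iu] := boolP (i \in msupp u); last first.
  rewrite (mcoeff_outdom iu) mulr0 if_same big1_seq // => j /andP[_ ju].
  by rewrite mcoeffU; case: eqP iu => // <-; rewrite ju.
rewrite big_mkcond (big_fsetD1 i) //= mcoeffUU big1_seq ?addr0 // => j /=.
by rewrite in_fsetD1 mcoeffU => /andP[/negPf -> _]; rewrite mulr0n if_same.
Qed.

Lemma tau_expD n u v : tau_exp n (u + v) = tau_exp n u + tau_exp n v.
Proof.
apply/malgP => i; rewrite mcoeffD !tau_expE mcoeffD mulrDr.
by case: ifP => // _; rewrite addr0.
Qed.

Lemma act_sg1 n i (k : int) : act (sg 1 i) n = n -> act (sg k i) n = n.
Proof.
move=> h1; have hN : act (sg (-1) i) n = n.
  rewrite -[in LHS]h1 -actD /sg -monalgUD addNr monalgU0; exact: act0.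
have hn j (m : nat) : act (sg j i) n = n -> act (sg (j *+ m) i) n = n.
  move=> hj; elim: m => [|m IHm]; first by rewrite /sg mulr0n monalgU0 act0.
  by rewrite mulrS /sg monalgUD actD -!/(sg _ _) IHm.
case: k => m; first by rewrite -[Posz m]natz; apply: hn.
by rewrite NegzE -[Posz m.+1]natz -mulNrn; apply: hn.
Qed.

Lemma act_tau_exp n u : act (tau_exp n u) n = n.
Proof.
rewrite /tau_exp; elim/big_ind: _ => [|g h hg hh|i /asboolP hi].
- exact: act0.
- by rewrite actD hh.
- exact: act_sg1.
Qed.

Definition tau_fun n (u : E) : residue n -> residue n :=
  @res_shift K I (tau_exp n u) n n.

Lemma tau_funE n (u : E) f : tau_fun u (res n f) = res n (shift (tau_exp n u) f).
Proof. exact: res_shiftE (act_tau_exp n u). Qed.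

Lemma tau_fun0 n : @tau_fun n 0 =1 id.
Proof.
elim/residue_ind=> f; rewrite tau_funE.
suff -> : tau_exp n (0 : E) = 0 by rewrite shift0.
by apply/malgP => i; rewrite tau_expE mcoeff0 mulr0 if_same.
Qed.

Lemma tau_funD n (u v : E) : @tau_fun n (u + v) =1 @tau_fun n u \o @tau_fun n v.
Proof.
by elim/residue_ind=> f; rewrite /= !tau_funE tau_expD shiftD.
Qed.

Definition tau_twist n : twist (residue n) E := @Twist _ E (@tau_fun n)
  (fun u => (res_shift_morph (act_tau_exp n u)).1)
  (fun u => (res_shift_morph (act_tau_exp n u)).2)
  (@tau_fun0 n) (@tau_funD n).

Definition R_ring n : nzRingType := skew_ring (tau_twist n).

(* R_var n k i is the k-th power of a_i or b_i (i in Gamma, 0 <= k) or of c_i *)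
(* (i not in Ib).                                                             *)
Definition R_const n (l : residue n) : R_ring n := skewU (tau_twist n) l 0.
Definition R_var n (k : int) (i : I) : R_ring n :=
  skewU (tau_twist n) 1 (expo_var Ib Gamma k i).

(* sigma^g on coefficients, for sigma^g(n) = n'.                              *)
Definition R_shift g n n' : R_ring n -> R_ring n' :=
  @coeff_map _ (residue n) (residue n') (@res_shift K I g n n').
End RRing.

Record S_param (K : fieldType) (I : choiceType) (m : maxD K I) (Ib : set I) := SParam {
  pGamma : set I;
  pGamma_sub : pGamma `<=` Ib;
  pxi : pGamma -> bool;
  pN : set (R_ring Ib pxi m);
  pN_max : maximal_ideal pN }.

Section CharP.
Variables (K : fieldType) (I : choiceType) (m : maxD K I) (Ib : set I).
Variable P : S_param m Ib.
Local Notation R n := (R_ring Ib (@pxi _ _ _ _ P) n).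

(* A representative of the class sigma_n.                                     *)
Definition sigma_rep (n : G_orbit m) : {malg int[I]} := s2val (cid2 (set_mem (valP n))).

Lemma sigma_repP (n : G_orbit m) : act (sigma_rep n) m = val n.
Proof. exact: s2valP' (cid2 (set_mem (valP n))). Qed.

Definition sigma_N (n : G_orbit m) : {pred R (val n)} :=
  fun f => `[< exists2 f0, pN f0 & f = R_shift (sigma_rep n) (val n) f0 >].

Lemma sigma_N_zmod_closed (n : G_orbit m) : zmod_closed (@sigma_N n).
Proof.
have [hN _ _] := pN_max P.
have hB := coeff_map_zmod (E := expo Ib (pGamma P)) (res_shift_morph (sigma_repP n)).1.
split=> [|f g /asboolP[f0 Nf ->] /asboolP[g0 Ng ->]]; apply/asboolP.
  exists 0; first exact: ideal0 hN.
  by have := hB 0 0; rewrite !subrr.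
exists (f0 - g0); first exact: (idealB hN).
by rewrite -[RHS]/(coeff_map _ _) hB.
Qed.
HB.instance Definition _ (n : G_orbit m) :=
  GRing.isZmodClosed.Build (R (val n)) (@sigma_N n) (sigma_N_zmod_closed n).

Definition S_summand (n : G_orbit m) : zmodType := Quotient.quot (@sigma_N n).
Definition S_class (n : G_orbit m) (f : R (val n)) : S_summand n :=
  \pi_(Quotient.quot (@sigma_N n)) f.

(* x_i (f + sigma_n(N)) is the class of x_coef n n' i * sigma_i(f), with      *)
(* n' = sigma_i(n).                                                           *)
Definition x_coef (n n' : maxD K I) (i : I) : R n' :=
  if `[< ~ hatG_orbit i m n >] then 1
  else if `[< xi_is (@pxi _ _ _ _ P) true i >] then R_var _ _ n' 1 i
  else if `[< ~ Ib i >] then R_var _ _ n' 1 i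
  else 0.

(* d_i (f + sigma_n(N)) is the class of d_coef n n' i * sigma_i^-1(f), with   *)
(* n' = sigma_i^-1(n).  In the second case the factor is a_i and not a_i t_i: *)
(* there t_i lies in n', so that the latter is zero in R(n').                 *)
Definition d_coef (n n' : maxD K I) (i : I) : R n' :=
  let t := R_const Ib (@pxi _ _ _ _ P) (res n' (tvar K i)) in
  if `[< ~ [set act (sg 1 i) n0 | n0 in hatG_orbit i m] n >] then t
  else if `[< xi_is (@pxi _ _ _ _ P) false i >] then R_var _ _ n' 1 i
  else if `[< ~ Ib i >] then R_var _ _ n' (-1) i * t
  else 0.

(* V is the A_n-module S(O,Gamma,xi,N).                                       *)
Definition is_S (V : lmodType (weyl_algebra K I)) : Prop :=
  exists e : forall n : G_orbit m, {additive S_summand n -> V},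
    is_direct_sum e /\
    forall (n : G_orbit m) (f : R (val n)),
      let v : V := e n (S_class f) in
      (forall c : K,
         weyl_const I c *: v = e n (S_class (R_const Ib _ (res (val n) c%:MP) * f))) /\
      forall (n' : G_orbit m) (i : I),
        (val n' = act (sg 1 i) (val n) ->
           weyl_x K i *: v =
           e n' (S_class (x_coef (val n) (val n') i *
                          R_shift (sg 1 i) (val n') f))) /\
        (val n' = act (sg (-1) i) (val n) ->
           weyl_d K i *: v =
           e n' (S_class (d_coef (val n) (val n') i *
                          R_shift (sg (-1) i) (val n') f))).

(* If d_i lies in N, then S(O,Gamma,xi,N) also arises from Gamma \ {i}.       *)
Definition proper_param : Prop :=
  forall i, pGamma P i -> ~ pN (R_var Ib (@pxi _ _ _ _ P) m 1 i).
End CharP.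

(* The elements of G in the class sigma_n of G / stab(m) all induce the same  *)
(* map D/m -> D/n, so that sigma_n : D/m -> D/n makes sense.                  *)
Definition sigma_well_defined (K : fieldType) (I : choiceType) (m : maxD K I) : Prop :=
  forall g h : {malg int[I]}, act g m = act h m ->
    @res_shift K I g m (act g m) = @res_shift K I h m (act g m).

(* The modules S x, for x in X, are an exhaustive list of pairwise            *)
(* non-isomorphic modules in the class C.                                     *)
Definition exhaustive_list (K : fieldType) (I : choiceType) (X : Type)
    (S : X -> lmodType (weyl_algebra K I))
    (C : lmodType (weyl_algebra K I) -> Prop) : Prop :=
  [/\ forall x, C (S x),
      forall x y, isomorphic (S x) (S y) -> x = y &
      forall V, C V -> exists x, isomorphic V (S x)].

(* The index set {1,...,n}, where None stands for n = infinity.               *)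
Definition weyl_index (n : option nat) : choiceType :=
  if n is Some k then 'I_k else nat.

(* Main.v *)
(* Let v have weight m, and let x^(g) be the product of the x_i^(g_i) for g_i *)
(* >= 0 and of the d_i^(-g_i) for g_i < 0. Dividing x^(g) v by the factors    *)
(* t_i - j, j > 0, that are units of D/m and occur on the way from m to       *)
(* sigma^g(m) gives a vector w_g of weight sigma^g(m). Then x_i w_g =         *)
(* w_(g+e_i) and d_i w_g = t_i w_(g-e_i), except at the walls, where t_i lies *)
(* in the maximal ideal: there x_i d_i or d_i x_i is zero.                    *)
(*                                                                            *)
(* In characteristic 0 the stabilizer of m is trivial. Local nilpotency of    *)
(* x_i or d_i is inherited by all of a simple module, so that a simple module *)
(* lives on one side of every wall; its support is a region O_p, on which the *)
(* w_g are a basis over the residue fields.                                   *)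
(*                                                                            *)
(* In characteristic q, that sigma_n : D/m -> D/n is well defined forces the  *)
(* stabilizer of m to be q Z^(I) and to act trivially on D/m. So R(m) is      *)
(* commutative, and its variables record the translations by q that survive:  *)
(* x_i^q gives b_i if x_i v <> 0, and d_i^q gives a_i if d_i^q v <> 0. Both   *)
(* cannot happen in a simple module, as d_i^q commutes with A_n and kills x_i *)
(* v. The w_g define a map from R(m) onto the weight space of m; submodules   *)
(* correspond to ideals of R(m) containing its kernel N, so the module is     *)
(* simple iff N is maximal.                                                   *)

Require Import Defs.
From HB Require Import structures.
From mathcomp Require Import all_boot all_order all_algebra.
From mathcomp Require Import boolp classical_sets functions cardinality fsbigop.
From mathcomp Require Import finmap.
From mathcomp Require Import monalg.
From mathcomp Require Import zify ring.

Set Implicit Arguments.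
Unset Strict Implicit.
Unset Printing Implicit Defensive.

Import GRing.Theory Num.Theory Order.TTheory.

Local Open Scope classical_set_scope.
Local Open Scope ring_scope.
Local Open Scope quotient_scope.

Local Opaque weyl_x weyl_d.

(** Everything is read off the lattice of weights. At the weight [act g m] the generators [x_i] and
    [d_i] move one step up or down in coordinate [i], and the composites [d_i x_i = t_i],
    [x_i d_i = t_i - 1] act through the residue field. A step is invertible unless [t_i] lies in the
    maximal ideal at its lower end; such edges are the walls. For a maximal break the walls occur
    only in the directions of [Ib]: one in each of them in characteristic 0, one at every multiple
    of q in characteristic q. Submodules are graded because [D] contains elements that separate
    finitely many weights ([maxD_projector], [wspace_indep]).

    Existence is uniform. Operators satisfying the Weyl relations define a module
    ([representation]), and [model] builds such operators on a direct sum of copies of one group: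
    the residue field of p over a region in characteristic 0, a quotient R/N over the whole orbit in
    characteristic q. In the other direction [lattice_family] attaches to one weight vector its
    normalized translates, indexed by the lattice of exponents.

    In characteristic 0 the group acts freely on the orbit ([char0_stab0]). Vectors killed by a
    power of [d_i] form a submodule, and from this [x_i] vanishes at every wall of a simple module
    ([dead_x]; dually [dead_d]). A simple module is therefore confined to one region between the
    walls, is spanned by translates of one vector ([simple_region_family]), and is determined by the
    region ([rf_iso]). Conversely, weight spaces of dimension one over the residue field joined by
    invertible steps give simplicity ([rf_simple]). Different regions have different supports.

    In characteristic q, [charp_axiomsP] identifies the stabilizer with the exponents divisible by
    q. Then all [tau_i] are trivial and every R(n) is identified with the commutative ring R(m). An
    [s_family] presents a module as an image of copies of R, one at each weight; its submodules cut
    out ideals of R ([sf_ideal]), whence simplicity for a maximal kernel ([sf_simple]) and the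
    converse ([sf_maximal]). In a simple module [x_i] and [d_i^q] cannot both be nonzero on a vector
    of weight m when [i] is in [Ib] ([x_or_d]); which of them survives defines Gamma and xi, and
    [simple_family] then presents the module over R. Gamma and xi are recovered from the vanishing
    of [x_i] at m and of [d_i] at sigma_i(m), and N from [sf_ker_eq]; this is [realizes_inj]. *)

Lemma zmod_morphism0 (U V : zmodType) (F : U -> V) : zmod_morphism F -> F 0 = 0.
Proof. by move=> FB; have := FB 0 0; rewrite !subrr. Qed.

Lemma zmod_morphismD (U V : zmodType) (F : U -> V) :
  zmod_morphism F -> {morph F : a b / a + b}.
Proof.
move=> FB a b; rewrite -[b]opprK FB opprK.
by have := FB 0 (- b); rewrite (zmod_morphism0 FB) !sub0r opprK => ->.
Qed.

(** * Finitely supported sums, induction on the lattice, commuting products *)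

Section MalgExtension.
Variables (T : choiceType) (G : zmodType).

Lemma malg_ind (P : {malg G[T]} -> Prop) :
  P 0 -> (forall f g, P f -> P g -> P (f + g)) ->
  (forall a u, P << a *g u >>) -> forall f, P f.
Proof.
move=> P0 PD PU f; rewrite (monalgE f).
by elim/big_ind: _ => // u _; apply: PU.
Qed.

Variables (V : zmodType) (F : T -> G -> V).

(** The map out of a direct sum of copies of [G] given by its restrictions [F u] to the summands. In
    the applications these are additive maps such as multiplication into a noncommutative ring. *)
Definition malg_ext (f : {malg G[T]}) : V := \sum_(u <- msupp f) F u f@_u.

Hypothesis hF : forall u, zmod_morphism (F u).

Let F0 u : F u 0 = 0.
Proof. exact: zmod_morphism0. Qed.

Let malg_extEw (d : {fset T}) f : (msupp f `<=` d)%fset ->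
  malg_ext f = \sum_(u <- d) F u f@_u.
Proof.
move=> le; rewrite /malg_ext (big_fset_incl _ le) //= => u _ /mcoeff_outdom ->.
exact: F0.
Qed.

Lemma malg_extU u a : malg_ext << a *g u >> = F u a.
Proof. by rewrite (malg_extEw msuppU_le) big_seq_fset1 mcoeffUU. Qed.

Lemma malg_extB : zmod_morphism malg_ext.
Proof.
move=> f g; pose d := (msupp f `|` msupp g)%fset.
rewrite (@malg_extEw d (f - g)) ?(fsubset_trans (msuppB_le _ _)) //.
rewrite (@malg_extEw d f) ?fsubsetUl // (@malg_extEw d g) ?fsubsetUr //.
rewrite -sumrB; apply: eq_bigr => u _.
by rewrite mcoeffB hF.
Qed.

Lemma malg_ext0 : malg_ext 0 = 0.
Proof. exact: zmod_morphism0 malg_extB. Qed.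

Lemma malg_extD f g : malg_ext (f + g) = malg_ext f + malg_ext g.
Proof. exact: zmod_morphismD malg_extB _ _. Qed.
End MalgExtension.

Section Lattice.
Variable I : choiceType.
Implicit Types g : {malg int[I]}.

Lemma mcoeff_sg (k : int) (i j : I) : (sg k i)@_j = if i == j then k else 0.
Proof. by rewrite /sg mcoeffU; case: eqP; rewrite ?mulr1n ?mulr0n. Qed.

Lemma sgD (k l : int) (i : I) : sg (k + l) i = sg k i + sg l i.
Proof. by rewrite /sg monalgUD. Qed.

Lemma sg0 (i : I) : sg 0 i = 0.
Proof. exact: monalgU0. Qed.

(** Every point is reached from 0 by unit steps that never return towards a coordinate hyperplane,
    first over the support and then along one coordinate. The sign conditions ensure that a monomial
    is extended by [x_i] only where it contains no [d_i], and conversely. *)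
Lemma lattice_ind (P : {malg int[I]} -> Prop) : P 0 ->
  (forall g i, 0 <= g@_i -> P g -> P (g + sg 1 i)) ->
  (forall g i, g@_i <= 0 -> P g -> P (g + sg (-1) i)) -> forall g, P g.
Proof.
move=> P0 Pp Pm g.
move: {2}(size _) (leqnn (size (msupp g))) => n; elim: n g => [|n IHn] g hn.
  have g0 : msupp g = fset0 by apply/eqP; rewrite -cardfs_eq0 -leqn0.
  by rewrite (monalgE g) g0 big_seq_fset0.
have [g0|[i gi]] := fset_0Vmem (msupp g).
  by rewrite (monalgE g) g0 big_seq_fset0.
pose g' := g - sg g@_i i.
have g'i : g'@_i = 0 by rewrite mcoeffB mcoeff_sg eqxx subrr.
have Pg' : P g'.
  apply: IHn; rewrite -ltnS; apply: leq_trans hn; apply: fproper_ltn_card.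
  rewrite fproperE; apply/andP; split; last first.
    by apply/fsubsetPn; exists i => //; rewrite -mcoeff_neq0 g'i eqxx.
  apply/fsubsetP => j.
  rewrite -!mcoeff_neq0 mcoeffB mcoeff_sg; have [<- _|_] := eqVneq i j.
    by rewrite mcoeff_neq0.
  by rewrite subr0.
have -> : g = g' + sg g@_i i by rewrite subrK.
case: (g@_i) => k.
  elim: k => [|k IHk]; first by rewrite sg0 addr0.
  rewrite -addn1 PoszD sgD addrA; apply: Pp IHk.
  by rewrite mcoeffD g'i mcoeff_sg eqxx add0r.
rewrite NegzE; elim: k => [|k IHk].
  by apply: Pm Pg'; rewrite g'i.
rewrite -[k.+2]addn1 PoszD opprD sgD addrA; apply: Pm IHk.
by rewrite mcoeffD g'i mcoeff_sg eqxx add0r.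
Qed.
End Lattice.

Section CommutingProducts.
Variables (S : pzRingType) (I : choiceType).
Implicit Types (F G : I -> S) (s t : seq I).

Lemma comm_perm_prod F s t : (forall i j, GRing.comm (F i) (F j)) ->
  perm_eq s t -> \prod_(i <- s) F i = \prod_(i <- t) F i.
Proof.
move=> hF; move: s t.
suff h s t : perm_eq s t -> \prod_(i <- s) F i = \prod_(i <- s) F i ->
   \prod_(i <- t) F i = \prod_(i <- s) F i by move=> s t st; apply/esym/h.
move: t s; move=> t s st _.
apply: (@catCA_perm_ind _ (fun u => \prod_(i <- u) F i = \prod_(i <- s) F i)
   _ s t st) => // s1 s2 s3 <-.
rewrite !big_cat /= !mulrA; congr (_ * _).
by apply: commr_prod => i _; apply/commr_sym/commr_prod => j _.
Qed.

Lemma comm_prod_support F s t : (forall i j, GRing.comm (F i) (F j)) ->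
  uniq s -> uniq t -> (forall i, i \in s -> i \notin t -> F i = 1) ->
  (forall i, i \in t -> i \notin s -> F i = 1) ->
  \prod_(i <- s) F i = \prod_(i <- t) F i.
Proof.
move=> hF us ut hs ht.
have filterE u : \prod_(i <- u) F i = \prod_(i <- [seq i <- u | F i != 1]) F i.
  rewrite big_filter [RHS]big_mkcond; apply: eq_bigr => i _.
  by case: eqP.
rewrite filterE [RHS]filterE; apply: (comm_perm_prod hF).
apply: uniq_perm; rewrite ?filter_uniq // => i; rewrite !mem_filter.
case: eqP => //= Fi; apply/idP/idP => h; apply/negPn/negP => h'; apply: Fi.
  exact: hs.
exact: ht.
Qed.

Lemma comm_prodM F G s : (forall i j, GRing.comm (F i) (G j)) ->
  \prod_(i <- s) (F i * G i) = \prod_(i <- s) F i * \prod_(i <- s) G i.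
Proof.
move=> h; elim: s => [|i s IH]; first by rewrite !big_nil mulr1.
rewrite !big_cons IH -!mulrA; congr (_ * _); rewrite !mulrA; congr (_ * _).
by apply: commr_prod => j _; apply/commr_sym.
Qed.
End CommutingProducts.

Section LatticeProducts.
Variables (S : pzRingType) (I : choiceType) (z : I -> int -> S).
Hypotheses (z0 : forall i, z i 0 = 1)
  (zC : forall i j k l, i != j -> GRing.comm (z i k) (z j l)).
Implicit Types (g : {malg int[I]}) (i j : I).

(** Factors with different indices commute, those with the same index need not ([x_i] and [d_i] do
    not). Splitting off one index with [lrest] confines a change of one coordinate to a single
    factor. *)
Definition lprod g : S := \prod_(i <- msupp g) z i g@_i.
Definition lrest g i : S := \prod_(j <- (msupp g `\ i)%fset) z j g@_j.

Lemma lprodE g i : lprod g = z i g@_i * lrest g i.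
Proof.
have -> : z i g@_i * lrest g i =
    \prod_(j <- i :: (msupp g `\ i)%fset) z j g@_j by rewrite big_cons.
apply: comm_prod_support => //.
- by move=> j k; have [->|/zC] := eqVneq j k.
- by rewrite cons_uniq !inE /= eqxx /= fset_uniq.
- move=> j jg; rewrite in_cons in_fsetD1 jg andbT.
  by case: eqVneq.
- move=> j; rewrite in_cons in_fsetD1 => /orP[/eqP ->|/andP[_ ->] //].
  by move=> /mcoeff_outdom ->.
Qed.

Lemma lrestD g i k : lrest (g + sg k i) i = lrest g i.
Proof.
have coE j : j != i -> (g + sg k i)@_j = g@_j.
  by move=> ji; rewrite mcoeffD mcoeff_sg eq_sym (negPf ji) addr0.
have -> : lrest (g + sg k i) i = \prod_(j <- (msupp (g + sg k i) `\ i)%fset) z j g@_j.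
  rewrite /lrest !big_seq; apply: eq_bigr => j; rewrite in_fsetD1 => /andP[ji _].
  by rewrite coE.
congr (\prod_(j <- _) _); congr enum_fset; apply/fsetP => j.
rewrite !in_fsetD1; case: eqVneq => //= ji.
by rewrite -!mcoeff_neq0 coE.
Qed.

Lemma lrest_comm g i k : GRing.comm (z i k) (lrest g i).
Proof.
rewrite /lrest big_seq; apply: commr_prod => j; rewrite in_fsetD1 => /andP[ji _].
by apply: zC; rewrite eq_sym.
Qed.

Lemma lprod0 : lprod 0 = 1.
Proof. by rewrite /lprod msupp0 big_seq_fset0. Qed.
End LatticeProducts.

(** * The Weyl algebra *)

Section WeylBasics.
Variables (K : fieldType) (I : choiceType).
Local Notation A := (weyl_algebra K I).
Local Notation D := (polyD K I).
Local Notation x := (weyl_x K).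
Local Notation d := (weyl_d K).
Implicit Types (f g : D) (a b : A) (i j : I).

Lemma weyl_piM (f g : free_algebra K I) : weyl_pi (f * g) = weyl_pi f * weyl_pi g.
Proof. exact/esym/weyl_pi_mul. Qed.

Lemma weyl_piZ c (f : free_algebra K I) : weyl_pi (c *: f) = c *: weyl_pi f.
Proof. exact/esym/weyl_pi_scale. Qed.

Lemma weyl_pi0 : weyl_pi (0 : free_algebra K I) = 0.
Proof. by rewrite /weyl_pi raddf0. Qed.

Lemma weyl_piB (f g : free_algebra K I) : weyl_pi (f - g) = weyl_pi f - weyl_pi g.
Proof. by rewrite /weyl_pi raddfB. Qed.

Lemma weyl_relator (r : free_algebra K I) : weyl_relators r -> weyl_pi r = 0.
Proof.
move=> hr; rewrite -weyl_pi0; apply/weyl_piP; rewrite subr0.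
by move=> J _; apply.
Qed.

Lemma weyl_xx i j : x i * x j = x j * x i.
Proof.
apply/eqP; rewrite -subr_eq0 -!weyl_piM -weyl_piB weyl_relator //.
by left; exists i, j.
Qed.

Lemma weyl_dd i j : d i * d j = d j * d i.
Proof.
apply/eqP; rewrite -subr_eq0 -!weyl_piM -weyl_piB weyl_relator //.
by right; left; exists i, j.
Qed.

Lemma weyl_dx i j : d i * x j = x j * d i + (i == j)%:R.
Proof.
apply/eqP; rewrite -subr_eq0 opprD addrA -!weyl_piM -weyl_piB.
have -> : (i == j)%:R = weyl_pi ((i == j)%:R) :> A.
  by case: (i == j); rewrite ?weyl_pi0.
by rewrite -weyl_piB weyl_relator //; right; right; exists i, j.
Qed.

Lemma weyl_gen_ind (P : A -> Prop) :
  (forall a b, P a -> P b -> P (a + b)) -> (forall c a, P a -> P (c *: a)) ->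
  P 1 -> (forall i a, P a -> P (x i * a)) -> (forall i a, P a -> P (d i * a)) ->
  forall a, P a.
Proof.
move=> PD PZ P1 Px Pd; elim/weyl_ind; elim/malg_ind => [|f g|c [u]].
- by rewrite weyl_pi0 -(scale0r (1 : A)); apply: PZ.
- by rewrite weyl_piD; apply: PD.
have -> : << c *g FMonom u >> = c *: << FMonom u >> :> free_algebra K I.
  apply/malgP => v; have := mcoeffZ c (<< FMonom u >> : {malg K[{fmonom (I + I)%type}]}) v.
  by move=> /= ->; rewrite !mcoeffU mulrnAr mulr1.
rewrite weyl_piZ; apply: PZ; elim: u => [|s u IHu].
  by rewrite -(fmoneE (I + I)%type).
have -> : << FMonom (s :: u) >> = << fmu s >> * << FMonom u >> :> free_algebra K I.
  rewrite malgM_def fgmulUU mulr1; congr << _ *g _ >>.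
  by rewrite -[mmul _ _]/(fmmul _ _) fmmulE fmuE.
by rewrite weyl_piM; case: s => i; [apply: Px|apply: Pd]; exact: IHu.
Qed.

Lemma weyl_constE c a : weyl_const I c * a = c *: a.
Proof. by rewrite -weyl_scaleAl mul1r. Qed.

Lemma weyl_const_comm c a : GRing.comm (weyl_const I c) a.
Proof.
by rewrite /GRing.comm weyl_constE /weyl_const -weyl_scaleAr mulr1.
Qed.

End WeylBasics.
Section PolyDInduction.
Variables (K : fieldType) (I : choiceType).
Local Notation D := (polyD K I).

Lemma polyD_ind (P : D -> Prop) :
  (forall c, P c%:MP) -> (forall i, P (tvar K i)) ->
  (forall f g, P f -> P g -> P (f + g)) ->
  (forall f g, P f -> P g -> P (f * g)) -> forall f, P f.
Proof.
move=> PC Pt PD PM; elim/malg_ind => [|f g|c u].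
  by have := PC 0; rewrite malgC0E.
  exact: PD.
rewrite malg_monoE; apply: (PM); first exact: PC.
move: {2}(mdeg u) (erefl (mdeg u)) => n; elim: n u => [|n IHn] u hu.
  by rewrite (mdeg_eq0I hu); apply: (PC 1).
have [u0|[i ui]] := fset_0Vmem (finsupp u).
  by move: hu; rewrite mdegE u0 big_seq_fset0.
have uE : u = mmul (ucm i) (divcm u (ucm i)).
  apply/eqP/cmP => j; rewrite cmM divcmE ucmE; case: eqP => [<-|_] /=.
    by rewrite subnKC // lt0n cmE_neq0.
  by rewrite add0n subn0.
have -> : << u >> = tvar K i * << divcm u (ucm i) >> :> D.
  by rewrite malgM_def fgmulUU mulr1 -uE.
apply: (PM) => //; apply: IHn.
by move: hu; rewrite [in mdeg u]uE mdegM mdegU; case.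
Qed.

End PolyDInduction.

Definition PD (K : fieldType) (I : choiceType) : comNzRingType := polyD K I.

Section Sealed.
Variables (K : fieldType) (I : choiceType).
Local Notation D := (PD K I).

(* Comparing two distinct monomials << _ *g _ >> of a monoid algebra by        *)
(* conversion does not terminate in practice; tv, sh and the record weyl_sys   *)
(* below are opaque copies of the objects of Defs.                             *)
Fact tv_subproof : {tv : I -> D | tv =1 @tvar K I}.
Proof. by exists (@tvar K I). Qed.
Definition tv : I -> D := sval tv_subproof.
Lemma tvE i : tv i = tvar K i. Proof. exact: (svalP tv_subproof). Qed.

Fact sh_subproof :
  {sh : {malg int[I]} -> {rmorphism D -> D} | forall g, sh g =1 shift g}.
Proof. by exists (fun g => shift g). Qed.
Definition sh (g : {malg int[I]}) : {rmorphism D -> D} := sval sh_subproof g.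
Lemma shE g f : sh g f = shift g f. Proof. exact: (svalP sh_subproof). Qed.

Definition cD (c : K) : D := c%:MP.

Lemma shC g c : sh g (cD c) = cD c. Proof. by rewrite shE shiftC. Qed.
Lemma sh_tv g i : sh g (tv i) = tv i - (g@_i)%:~R.
Proof. by rewrite shE !tvE shift_tvar. Qed.
Lemma sh0 f : sh 0 f = f. Proof. by rewrite shE shift0. Qed.
Lemma shD g h f : sh (g + h) f = sh g (sh h f).
Proof. by rewrite !shE; apply: shiftD. Qed.

Lemma polyD_tv_ind (P : D -> Prop) :
  (forall c, P (cD c)) -> (forall i, P (tv i)) ->
  (forall f g, P f -> P g -> P (f + g)) ->
  (forall f g, P f -> P g -> P (f * g)) -> forall f, P f.
Proof.
by move=> PC Pt; apply: polyD_ind => // i; rewrite -tvE.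
Qed.
End Sealed.
Arguments tv K {I} i.
Arguments cD {K} I c.
Arguments sh {K I} g.

(** * Commutation of the generators with the subalgebra [D] *)

Section WeylRelations.
Variables (K : fieldType) (I : choiceType) (A : pzRingType).
Local Notation D := (polyD K I).
Variables (x d : I -> A) (kc : K -> A).
Hypotheses (hxx : forall i j, x i * x j = x j * x i)
  (hdd : forall i j, d i * d j = d j * d i)
  (hdx : forall i j, d i * x j = x j * d i + (i == j)%:R)
  (kcB : zmod_morphism kc) (kcM : monoid_morphism kc)
  (kcC : forall c a, GRing.comm (kc c) a).
Implicit Types (f g : D) (i j : I).
Local Notation t i := (d i * x i).

Lemma rel_xd i : x i * d i = t i - 1.
Proof. by rewrite hdx eqxx addrK. Qed.

Lemma rel_xt i j : x j * t i = (t i - (j == i)%:R) * x j.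
Proof.
have -> : x j * (d i * x i) = (x j * d i) * x i by rewrite mulrA.
have -> : x j * d i = d i * x j - (i == j)%:R by rewrite hdx addrK.
rewrite !mulrBl -!mulrA (hxx j i) eq_sym; congr (_ - _).
by case: eqP => [->|_]; rewrite ?mul0r.
Qed.

Lemma rel_dt i j : d j * t i = (t i + (j == i)%:R) * d j.
Proof.
rewrite mulrDl mulrA hdd -!mulrA hdx mulrDr eq_sym; congr (_ + _).
by case: eqP => [->|_]; rewrite ?mulr0 ?mul0r ?mulr1 ?mul1r.
Qed.

Lemma rel_tt i j : GRing.comm (t i) (t j).
Proof.
rewrite /GRing.comm -(mulrA (d i)) rel_xt mulrA mulrBr rel_dt.
have -> : (t j + (i == j)%:R) * d i - d i * (i == j)%:R = t j * d i.
  by case: (i == j); rewrite ?mulr0 ?mulr1 ?subr0 ?addr0 // mulrDl mul1r addrK.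
by rewrite -!mulrA.
Qed.

Definition t_mon (u : {cmonom I}) : A := \prod_(i <- finsupp u) t i ^+ u i.

Lemma t_mon_comm (u v : {cmonom I}) i j :
  GRing.comm (t i ^+ u i) (t j ^+ v j).
Proof. by apply/commrX/commr_sym/commrX; apply: rel_tt. Qed.

Lemma t_monEw (s : {fset I}) (u : {cmonom I}) : (finsupp u `<=` s)%fset ->
  t_mon u = \prod_(i <- s) t i ^+ u i.
Proof.
move=> /fsubsetP us; apply: comm_prod_support => //.
- exact: t_mon_comm.
- by move=> i iu /negP[]; apply: us.
by move=> i _ /fsfun_dflt /= ->.
Qed.

Lemma t_monM (u v : {cmonom I}) : t_mon (mmul u v) = t_mon u * t_mon v.
Proof.
rewrite (@t_monEw _ u (fsubsetUl _ (finsupp v))) (@t_monEw _ v (fsubsetUr (finsupp u) _)).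
rewrite (@t_monEw (finsupp u `|` finsupp v)%fset) ?mdomD //.
rewrite -(@comm_prodM _ _ (fun i => t i ^+ u i) (fun i => t i ^+ v i)).
  by apply: eq_bigr => i _; rewrite cmM exprD.
exact: t_mon_comm.
Qed.

Definition D_map (f : D) : A := malg_ext (fun u c => kc c * t_mon u) f.

Let kcuB (u : {cmonom I}) : zmod_morphism (fun c : K => kc c * t_mon u).
Proof. by move=> c e; rewrite kcB mulrBl. Qed.

Lemma D_mapB : zmod_morphism D_map.
Proof. exact: (malg_extB kcuB). Qed.

Lemma D_mapU c u : D_map << c *g u >> = kc c * t_mon u.
Proof. exact: (malg_extU kcuB). Qed.

Lemma D_mapC c : D_map c%:MP = kc c.
Proof. by rewrite D_mapU /t_mon mdom1 big_seq_fset0 mulr1. Qed.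

Lemma D_mapM : monoid_morphism D_map.
Proof.
split; first by rewrite -[1]/(1%:MP) D_mapC kcM.1.
have add f g : D_map (f + g) = D_map f + D_map g by exact: (malg_extD kcuB).
move=> f g; elim/malg_ind: f => [|f f' IH IH'|c u].
- by rewrite mul0r [D_map 0](malg_ext0 kcuB) mul0r.
- by rewrite mulrDl (add f f') mulrDl (add (f * g)); apply: (congr2 +%R IH IH').
elim/malg_ind: g => [|g g' IH IH'|e v].
- by rewrite mulr0 [D_map 0](malg_ext0 kcuB) mulr0.
- by rewrite mulrDr (add g g') mulrDr (add (_ * g)); apply: (congr2 +%R IH IH').
rewrite malgM_def fgmulUU; apply: (etrans (D_mapU _ _)); apply/esym.
apply: (etrans (congr2 *%R (D_mapU _ _) (D_mapU _ _))); rewrite t_monM kcM.2.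
by rewrite -!mulrA; congr (_ * _); rewrite !mulrA; congr (_ * _); apply/esym/kcC.
Qed.

HB.instance Definition _ := GRing.isZmodMorphism.Build D A D_map D_mapB.
HB.instance Definition _ := GRing.isMonoidMorphism.Build D A D_map D_mapM.

Definition D_rmap : {rmorphism D -> A} := D_map.

Lemma D_map_tvar i : D_map (tvar K i) = t i.
Proof.
by rewrite /tvar D_mapU kcM.1 mul1r /t_mon mdomU big_seq_fset1 cmUU expr1.
Qed.

Lemma rel_xD i f : x i * D_map f = D_map (shift (sg 1 i) f) * x i.
Proof.
elim/polyD_ind: f => [c|j|f g IHf IHg|f g IHf IHg].
- by rewrite shiftC !D_mapC; apply/commr_sym/kcC.
- rewrite shift_tvar rmorphB rmorph_int /= D_map_tvar rel_xt mcoeff_sg.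
  by case: (i == j); rewrite ?mulr0z ?mulr1z ?mulr0n ?mulr1n ?subr0.
- by rewrite !rmorphD mulrDr mulrDl IHf IHg.
- by rewrite !rmorphM mulrA IHf -mulrA IHg mulrA.
Qed.

Lemma rel_dD i f : d i * D_map f = D_map (shift (sg (-1) i) f) * d i.
Proof.
elim/polyD_ind: f => [c|j|f g IHf IHg|f g IHf IHg].
- by rewrite shiftC !D_mapC; apply/commr_sym/kcC.
- rewrite shift_tvar rmorphB rmorph_int /= D_map_tvar rel_dt mcoeff_sg.
  by case: (i == j); rewrite ?mulr0z ?mulrN1z ?opprK ?mulr0n ?mulr1n ?subr0 ?addr0.
- by rewrite !rmorphD mulrDr mulrDl IHf IHg.
- by rewrite !rmorphM mulrA IHf -mulrA IHg mulrA.
Qed.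
End WeylRelations.

(** The relations in the form used from here on: moving an element of [D] past a generator shifts
    it, and [w_ind] says that scalars, [x_i] and [d_i] generate the algebra. *)
Record weyl_sys (K : fieldType) (I : choiceType) := WeylSys {
  wA :> pzRingType;
  wx : I -> wA;
  wd : I -> wA;
  wD : {rmorphism PD K I -> wA};
  wxx : forall i j, wx i * wx j = wx j * wx i;
  wdd : forall i j, wd i * wd j = wd j * wd i;
  wdx : forall i j, i != j -> wd i * wx j = wx j * wd i;
  wdxt : forall i, wd i * wx i = wD (tv K i);
  wxdt : forall i, wx i * wd i = wD (tv K i - 1);
  wxD : forall i f, wx i * wD f = wD (sh (sg 1 i) f) * wx i;
  wdD : forall i f, wd i * wD f = wD (sh (sg (-1) i) f) * wd i;
  w_ind : forall P : wA -> Prop,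
    (forall a b, P a -> P b -> P (a + b)) -> (forall c a, P a -> P (wD (cD I c) * a)) ->
    P 1 -> (forall i a, P a -> P (wx i * a)) -> (forall i a, P a -> P (wd i * a)) ->
    forall a, P a }.

Section WeylSystem.
Variables (K : fieldType) (I : choiceType).

Lemma weyl_constB : zmod_morphism (@weyl_const K I).
Proof. by move=> c e; rewrite /weyl_const scalerBl. Qed.

Lemma weyl_constM : monoid_morphism (@weyl_const K I).
Proof.
split; first by rewrite /weyl_const scale1r.
by move=> c e; rewrite weyl_constE /weyl_const scalerA.
Qed.

Definition weyl_D : {rmorphism PD K I -> weyl_algebra K I} :=
  D_rmap (@weyl_xx K I) (@weyl_dd K I) (@weyl_dx K I) weyl_constB weyl_constM
    (@weyl_const_comm K I).

Lemma weyl_DE f : weyl_D f = D_in_weyl f.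
Proof. by apply: eq_bigr => u _; rewrite weyl_constE. Qed.

Lemma weyl_DC c : weyl_D (cD I c) = weyl_const I c.
Proof. exact: (D_mapC _ _ weyl_constB). Qed.

Fact weyl_system_subproof :
  [/\ forall i j : I, i != j -> weyl_d K i * weyl_x K j = weyl_x K j * weyl_d K i,
      forall i : I, weyl_d K i * weyl_x K i = weyl_D (tv K i),
      forall i : I, weyl_x K i * weyl_d K i = weyl_D (tv K i - 1),
      forall (i : I) f, weyl_x K i * weyl_D f = weyl_D (sh (sg 1 i) f) * weyl_x K i &
      forall (i : I) f, weyl_d K i * weyl_D f = weyl_D (sh (sg (-1) i) f) * weyl_d K i].
Proof.
have h1 := @weyl_xx K I; have h2 := @weyl_dd K I; have h3 := @weyl_dx K I.
have h4 := weyl_constB; have h5 := weyl_constM; have h6 := @weyl_const_comm K I.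
split.
- by move=> i j /negPf ij; rewrite h3 ij addr0.
- by move=> i; rewrite tvE; exact/esym/(D_map_tvar _ _ h4 h5).
- move=> i; rewrite rmorphB rmorph1 tvE [weyl_D _](D_map_tvar _ _ h4 h5).
  exact: (rel_xd h3).
- by move=> i f; rewrite shE; exact: (rel_xD h1 h2 h3 h4 h5 h6).
- by move=> i f; rewrite shE; exact: (rel_dD h1 h2 h3 h4 h5 h6).
Qed.

Fact weyl_system_ind (P : weyl_algebra K I -> Prop) :
  (forall a b, P a -> P b -> P (a + b)) ->
  (forall c a, P a -> P (weyl_D (cD I c) * a)) -> P 1 ->
  (forall i a, P a -> P (weyl_x K i * a)) -> (forall i a, P a -> P (weyl_d K i * a)) ->
  forall a, P a.
Proof.
move=> PD PZ; apply: weyl_gen_ind => // c a Pa.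
by rewrite -weyl_constE -weyl_DC; apply: PZ.
Qed.

Definition weyl_system : weyl_sys K I :=
  @WeylSys K I (weyl_algebra K I) (@weyl_x K I) (@weyl_d K I) weyl_D
    (@weyl_xx K I) (@weyl_dd K I)
    (let: And5 h _ _ _ _ := weyl_system_subproof in h)
    (let: And5 _ h _ _ _ := weyl_system_subproof in h)
    (let: And5 _ _ h _ _ := weyl_system_subproof in h)
    (let: And5 _ _ _ h _ := weyl_system_subproof in h)
    (let: And5 _ _ _ _ h := weyl_system_subproof in h) weyl_system_ind.
End WeylSystem.

(** * Maximal ideals and weight spaces *)

Section MaximalIdeals.
Variables (K : fieldType) (I : choiceType).
Local Notation D := (PD K I).
Implicit Types (n m : maxD K I) (f g : D) (h : {malg int[I]}).

Definition inm n : set D := max_set n.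

Lemma max_ideal n : is_ideal (inm n). Proof. by case: (max_setP n). Qed.
Lemma max0 n : inm n 0. Proof. exact: ideal0 (max_ideal n). Qed.
Lemma max1 n : ~ inm n 1. Proof. by case: (max_setP n). Qed.
Lemma maxB n f g : inm n f -> inm n g -> inm n (f - g).
Proof. exact: idealB (max_ideal n) _ _. Qed.
Lemma maxDD n f g : inm n f -> inm n g -> inm n (f + g).
Proof. exact: is_idealD (max_ideal n). Qed.
Lemma maxMl n f g : inm n g -> inm n (f * g).
Proof. exact: idealMl (max_ideal n) _ _. Qed.
Lemma maxMr n f g : inm n f -> inm n (f * g).
Proof. by move=> h; apply: (Defs.idealMr (max_ideal n)). Qed.
Lemma maxN n f : inm n f -> inm n (- f).
Proof. by move=> nf; rewrite -sub0r; apply: maxB => //; apply: max0. Qed.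
Lemma maxC n f g : inm n (f - g) -> inm n (g - f).
Proof. by move/maxN; rewrite opprB. Qed.

Lemma act_mem h n f : inm (act h n) f <-> inm n (sh (- h) f).
Proof. by rewrite shE; apply: actE. Qed.

Lemma act_mem' h n f : inm (act h n) (sh h f) <-> inm n f.
Proof. by rewrite act_mem -shD addNr sh0. Qed.

Lemma max_inv n f : ~ inm n f -> exists g, inm n (g * f - 1).
Proof.
move=> nf; have [hn n1 nM] := max_setP n.
pose J : set D := [set e | exists a y, inm n y /\ e = a * f + y].
have hJ : is_ideal J.
  split.
  - by exists 0, 0; rewrite mul0r addr0; split=> //; apply: max0.
  - move=> _ _ [a [y [ny ->]]] [b [z [nz ->]]]; exists (a - b), (y - z).
    by split; [exact: maxB|rewrite mulrBl addrACA opprD].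
  - move=> c _ [a [y [ny ->]]]; exists (c * a), (c * y).
    by split; [exact: maxMl|rewrite mulrDr mulrA].
  - move=> c _ [a [y [ny ->]]]; exists (c * a), (c * y).
    by split; [exact: maxMl|rewrite mulrC mulrDr mulrA].
have nJ : inm n `<=` J.
  by move=> y ny; exists 0, y; rewrite mul0r add0r.
have [[a [y [ny e]]]|J1] := pselect (J 1); last first.
  case: nf; rewrite /inm -(nM J hJ J1 nJ); exists 1, 0; rewrite mul1r addr0.
  by split=> //; apply: max0.
by exists a; rewrite e opprD addNKr; apply: maxN.
Qed.

Lemma maxM_prime n f g : ~ inm n f -> ~ inm n g -> ~ inm n (f * g).
Proof.
move=> nf ng nfg; have [a na] := max_inv nf; apply: ng.
have -> : g = a * (f * g) - (a * f - 1) * g.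
  by rewrite mulrBl mul1r mulrA subKr.
by apply: maxB; [apply: maxMl|apply: maxMr].
Qed.

Lemma prod_notin n (T : Type) (s : seq T) (F : T -> D) :
  (forall t, ~ inm n (F t)) -> ~ inm n (\prod_(t <- s) F t).
Proof.
move=> hF; elim/big_ind: _ => //; first exact: max1.
by move=> f f'; apply: maxM_prime.
Qed.

Lemma maxD_sep n n' : n <> n' -> exists f, inm n' f /\ inm n (f - 1).
Proof.
move=> nn'; have [f n'f nf] : exists2 f, inm n' f & ~ inm n f.
  apply: contrapT => h; apply: nn'; apply: maxD_inj.
  have [hn' n'1 n'M] := max_setP n'; apply: n'M.
  - exact: max_ideal.
  - exact: max1.
  by move=> f n'f; apply: contrapT => nf; apply: h; exists f.
by have [g ng] := max_inv nf; exists (g * f); split=> //; apply: maxMl.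
Qed.

(** Chinese remainder theorem: multiply elements separating [n] from the members of [s] one by one.
    Such an [f] acts on weight vectors as the projection to weight [n] along the other weights in
    [s]. *)
Lemma maxD_projector (s : seq (maxD K I)) n :
  exists f, inm n (f - 1) /\ forall n', n' \in s -> n' != n -> inm n' f.
Proof.
elim: s => [|n' s [f [nf hf]]].
  by exists 1; rewrite subrr; split=> //; apply: max0.
have [->|/eqP nn'] := eqVneq n' n.
  exists f; split=> // n1; rewrite in_cons => /orP[/eqP ->|]; last exact: hf.
  by rewrite eqxx.
have [g [n'g ng]] := maxD_sep (nesym nn').
exists (g * f); split.
  have -> : g * f - 1 = (g - 1) * f + (f - 1) by rewrite mulrBl mul1r addrA subrK.
  by apply: maxDD => //; apply: maxMr.
move=> n1; rewrite in_cons => /orP[/eqP ->|n1s] n1n; first exact: maxMr.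
by apply: maxMl; apply: hf.
Qed.
End MaximalIdeals.

(** * Monomials, weight vectors and their translates *)

Section Monomials.
Variables (K : fieldType) (I : choiceType) (W : weyl_sys K I).
Local Notation x := (wx W).
Local Notation d := (wd W).
Local Notation D := (wD W).
Implicit Types (g : {malg int[I]}) (i j : I) (f : PD K I).

Definition zpow i (k : int) : W :=
  match k with Posz k => x i ^+ k | Negz k => d i ^+ k.+1 end.

Lemma wd_comm_x i j : i != j -> GRing.comm (d i) (x j).
Proof. exact: wdx. Qed.

Lemma zpow_comm i j k l : i != j -> GRing.comm (zpow i k) (zpow j l).
Proof.
move=> ij; rewrite /zpow; case: k => k; case: l => l.
- by apply/commrX/commr_sym/commrX; apply: wxx.
- by apply/commrX/commr_sym/commrX; apply: wd_comm_x; rewrite eq_sym.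
- by apply/commrX/commr_sym/commrX/commr_sym; apply: wd_comm_x.
- by apply/commrX/commr_sym/commrX; apply: wdd.
Qed.

Definition ymon g : W := lprod zpow g.

Let zpow0 i : zpow i 0 = 1. Proof. by []. Qed.
Let ymonE := lprodE zpow0 zpow_comm.

Lemma ymon0 : ymon 0 = 1.
Proof. exact: lprod0. Qed.

Lemma ymon_x g i : 0 <= g@_i -> x i * ymon g = ymon (g + sg 1 i).
Proof.
move=> gi; rewrite /ymon (ymonE g i) (ymonE (g + sg 1 i) i) lrestD mulrA; congr (_ * _).
rewrite mcoeffD mcoeff_sg eqxx; case: (g@_i) gi => // k _ /=.
by rewrite addn1 exprS.
Qed.

Lemma ymon_d g i : g@_i <= 0 -> d i * ymon g = ymon (g + sg (-1) i).
Proof.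
move=> gi; rewrite /ymon (ymonE g i) (ymonE (g + sg (-1) i) i) lrestD mulrA; congr (_ * _).
rewrite mcoeffD mcoeff_sg eqxx; case: (g@_i) gi => [[|k]|k] //= _.
  by rewrite mulr1 expr1.
by rewrite addn0 -exprS.
Qed.

Lemma ymon_xn g i (k : nat) : g@_i = k -> exists a, ymon g = a * x i ^+ k.
Proof.
move=> gi; exists (lrest zpow g i); rewrite /ymon (ymonE g i) gi.
exact: (lrest_comm zpow_comm g i k).
Qed.

Lemma ymon_dn g i (k : nat) : g@_i = - k%:Z -> exists a, ymon g = a * d i ^+ k.
Proof.
move=> gi; exists (lrest zpow g i); rewrite /ymon (ymonE g i) gi.
case: k {gi} => [|k]; first by rewrite oppr0 zpow0 mul1r mulr1.
by rewrite -NegzE; exact: (lrest_comm zpow_comm g i (Negz k)).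
Qed.

Lemma ymon_D g f : ymon g * D f = D (sh g f) * ymon g.
Proof.
elim/lattice_ind: g f => [|g i gi IH|g i gi IH] f.
- by rewrite ymon0 mul1r mulr1 sh0.
- by rewrite -ymon_x // -mulrA IH mulrA wxD -mulrA (addrC g) shD.
- by rewrite -ymon_d // -mulrA IH mulrA wdD -mulrA (addrC g) shD.
Qed.
End Monomials.

Section WeightSpaces.
Variables (K : fieldType) (I : choiceType) (W : weyl_sys K I) (V : lmodType W).
Local Notation x := (wx W).
Local Notation d := (wd W).
Local Notation D := (wD W).
Implicit Types (g : {malg int[I]}) (i j : I) (f : PD K I) (n : maxD K I) (v : V).

Definition wspace n : set V := [set v | forall f, inm n f -> D f *: v = 0].

Definition wsub (S : set V) : Prop :=
  [/\ S 0, forall u v, S u -> S v -> S (u + v) & forall (a : W) v, S v -> S (a *: v)].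

Lemma wsub_gen (S : set V) : S 0 -> (forall u v, S u -> S v -> S (u + v)) ->
  (forall c v, S v -> S (D (cD I c) *: v)) -> (forall i v, S v -> S (x i *: v)) ->
  (forall i v, S v -> S (d i *: v)) -> wsub S.
Proof.
move=> S0 SD Sc Sx Sd; split=> // a v Sv; move: a.
elim/w_ind => [a b Sa Sb|c a Sa||i a Sa|i a Sa].
- by rewrite scalerDl; apply: SD.
- by rewrite -scalerA; apply: Sc.
- by rewrite scale1r.
- by rewrite -scalerA; apply: Sx.
- by rewrite -scalerA; apply: Sd.
Qed.

Lemma wsubB (S : set V) u v : wsub S -> S u -> S v -> S (u - v).
Proof. by move=> [_ SD SZ] Su Sv; apply: SD => //; rewrite -scaleN1r; apply: SZ. Qed.

Lemma wspace0 n : wspace n 0. Proof. by move=> f _; rewrite scaler0. Qed.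
Lemma wspaceD n u v : wspace n u -> wspace n v -> wspace n (u + v).
Proof. by move=> hu hv f nf; rewrite scalerDr hu // hv // addr0. Qed.
Lemma wspaceB n u v : wspace n u -> wspace n v -> wspace n (u - v).
Proof. by move=> hu hv f nf; rewrite scalerBr hu // hv // subr0. Qed.

Lemma wspace_act n v (a : W) h : wspace n v ->
  (forall f, a * D f = D (sh h f) * a) -> wspace (act h n) (a *: v).
Proof.
move=> hv ha f /act_mem nf.
have -> : f = sh h (sh (- h) f) by rewrite -shD subrr sh0.
by rewrite scalerA -ha -scalerA hv // scaler0.
Qed.

Lemma wspace_x n v i : wspace n v -> wspace (act (sg 1 i) n) (x i *: v).
Proof. by move=> hv; apply: wspace_act => // f; apply: wxD. Qed.
Lemma wspace_d n v i : wspace n v -> wspace (act (sg (-1) i) n) (d i *: v).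
Proof. by move=> hv; apply: wspace_act => // f; apply: wdD. Qed.
Lemma wspace_ymon n v g : wspace n v -> wspace (act g n) (ymon W g *: v).
Proof. by move=> hv; apply: wspace_act => // f; apply: ymon_D. Qed.
Lemma wspace_D n v f : wspace n v -> wspace n (D f *: v).
Proof.
move=> hv; rewrite -[n]act0; apply: wspace_act => // e.
by rewrite sh0 -!rmorphM mulrC.
Qed.

Lemma wspace_eqm n v f f' : wspace n v -> inm n (f - f') -> D f *: v = D f' *: v.
Proof.
move=> hv nf; apply/eqP; rewrite -subr_eq0 -scalerBl -rmorphB; apply/eqP.
exact: hv.
Qed.

Lemma wspace_neq0 n v : wspace n v -> v != 0 -> forall f, D f *: v = 0 -> inm n f.
Proof.
move=> hv v0 f fv; apply: contrapT => nf; have [g ng] := max_inv nf.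
move/eqP: v0; apply; rewrite -[v]scale1r -(rmorph1 D) -(wspace_eqm hv ng) rmorphM.
by rewrite -scalerA fv scaler0.
Qed.

Lemma wspace_indep (T : eqType) (wt : T -> maxD K I) (s : seq T) (w : T -> V) :
  injective wt -> uniq s -> (forall t, wspace (wt t) (w t)) ->
  forall S : set V, wsub S -> S (\sum_(t <- s) w t) -> forall t, t \in s -> S (w t).
Proof.
move=> wt_inj us hw S [S0 SD SZ] Ss t ts.
have [f [nf hf]] := maxD_projector [seq wt u | u <- s] (wt t).
suff -> : w t = D f *: \sum_(u <- s) w u by apply: SZ.
rewrite scaler_sumr (bigD1_seq t) //= big1_seq ?addr0 => [|u /andP[ut us']].
  have nf1 : inm (wt t) (1 - f) by apply: maxC.
  by rewrite -(wspace_eqm (hw t) nf1) rmorph1 scale1r.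
apply: (hw u); apply: hf; first exact: map_f.
by apply: contra_neq ut => /wt_inj.
Qed.

Lemma wsub0 : wsub [set 0].
Proof.
split=> //= [u v -> ->|a v ->]; first by rewrite addr0.
by rewrite scaler0.
Qed.

Definition hom_vector : set V := [set v | exists n, wspace n v].

Definition spanned (E : set V) : Prop :=
  forall P : set V, P 0 -> (forall u v, P u -> P v -> P (u + v)) ->
    E `<=` P -> forall v, P v.

Lemma spanned_dec (T : choiceType) (Q : T -> zmodType) (e : forall t, {additive Q t -> V}) :
  spanned [set v | exists t q, v = e t q] ->
  forall v, exists (s : {fset T}) (q : forall t, Q t),
    (forall t, t \notin s -> q t = 0) /\ v = \sum_(t <- s) e t (q t).
Proof.
move=> hE; apply: hE => [|u v [s [q [hq ->]]] [s' [q' [hq' ->]]]|_ [t [q ->]]].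
- by exists fset0, (fun=> 0); rewrite big_seq_fset0.
- exists (s `|` s')%fset, (fun t => q t + q' t); split.
    by move=> t; rewrite in_fsetU negb_or => /andP[/hq -> /hq' ->]; rewrite addr0.
  rewrite (big_fset_incl _ (fsubsetUl s s')) /=; last by move=> t _ /hq ->; rewrite raddf0.
  rewrite (big_fset_incl _ (fsubsetUr s s')) /=; last by move=> t _ /hq' ->; rewrite raddf0.
  by rewrite -big_split; apply: eq_bigr => t _; rewrite raddfD.
exists [fset t]%fset, (@dfwith T (fun u => Q u) (fun=> 0) t q); split.
  by move=> t'; rewrite in_fset1 eq_sym => tt'; rewrite dfwith_out.
by rewrite big_seq_fset1 dfwith_in.
Qed.

(** Uniqueness of components: the difference of two decompositions of a vector has zero weight
    components by independence of distinct weights, and each [e t] is injective. *)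
Lemma direct_sum_crit (T : choiceType) (wt : T -> maxD K I) (Q : T -> zmodType)
    (e : forall t, {additive Q t -> V}) : injective wt ->
  (forall t q, wspace (wt t) (e t q)) -> (forall t q, e t q = 0 -> q = 0) ->
  spanned [set v | exists t q, v = e t q] -> is_direct_sum e.
Proof.
move=> wt_inj he einj hE v.
have sumE (q : forall t, Q t) (s : {fset T}) : (forall t, t \notin s -> q t = 0) ->
    \sum_(t \in setT) e t (q t) = \sum_(t <- s) e t (q t).
  by move=> hq; apply: fsbigTE => t /hq ->; rewrite raddf0.
have finq (q : forall t, Q t) (s : {fset T}) : (forall t, t \notin s -> q t = 0) ->
    finite_set [set t | q t != 0].
  move=> hq; apply: sub_finite_set (finite_fset s) => t /=.
  by move=> qt; apply: contra_neqT qt => /hq.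
have [s [q [hq ->]]] := spanned_dec hE v.
exists q; split; first by split; [exact: finq hq|rewrite (sumE _ _ hq)].
move=> q' [fq' eqq']; apply: functional_extensionality_dep => t.
pose s' := fset_set [set t | q' t != 0].
have hq' u : u \notin s' -> q' u = 0.
  by rewrite in_fset_set // => /negP h; have [//|q'u] := eqVneq (q' u) 0; case: h; apply: mem_set.
rewrite (sumE _ _ hq') in eqq'.
pose w u := e u (q u - q' u).
have [ts|] := boolP (t \in (s `|` s')%fset); last first.
  by rewrite in_fsetU negb_or => /andP[/hq -> /hq' ->].
apply/eqP; rewrite -subr_eq0; apply/eqP/einj.
apply: (@wspace_indep _ wt (s `|` s')%fset w wt_inj _ _ [set 0] wsub0) => //=.
  by move=> u; apply: he.
rewrite /w; under eq_bigr do rewrite raddfB.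
rewrite sumrB; apply/eqP; rewrite subr_eq0; apply/eqP.
rewrite -(big_fset_incl _ (fsubsetUl s s')) /=; last by move=> u _ /hq ->; rewrite raddf0.
rewrite -(big_fset_incl _ (fsubsetUr s s')) /=; last by move=> u _ /hq' ->; rewrite raddf0.
exact: eqq'.
Qed.

Lemma direct_sum_spanned (T : choiceType) (Q : T -> zmodType)
    (e : forall t, {additive Q t -> V}) : is_direct_sum e ->
  spanned [set v | exists t q, v = e t q].
Proof.
move=> hE P P0 PD PE v; have [q [[fq ->] _]] := hE v.
rewrite (fsbigTE (fset_set [set t | q t != 0])) => [|t].
  by elim/big_ind: _ => // t _; apply: PE; exists t, (q t).
rewrite in_fset_set // => /negP h; have [->|qt] := eqVneq (q t) 0.
  by rewrite raddf0.
by case: h; apply: mem_set.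
Qed.

Lemma direct_sum_inj (T : choiceType) (Q : T -> zmodType)
    (e : forall t, {additive Q t -> V}) : is_direct_sum e ->
  forall t q, e t q = 0 -> q = 0.
Proof.
move=> hE t q eq0; have [q0 [_ hq0]] := hE 0.
have fin : finite_set [set u | (fun u => 0 : Q u) u != 0].
  by apply: sub_finite_set (finite_fset fset0) => u /=; rewrite eqxx.
have e1 : q0 = fun=> 0.
  by apply: hq0; split=> //; rewrite fsbig1 // => u _; rewrite raddf0.
have e2 : q0 = @dfwith T (fun u => Q u) (fun=> 0) t q.
  apply: hq0; split.
    apply: sub_finite_set (finite_fset [fset t]%fset) => u /=.
    by rewrite in_fset1; apply: contra_neqT => ut; rewrite dfwith_out // eq_sym.
  rewrite fsbig1 // => u _; have [<-|tu] := eqVneq t u; first by rewrite dfwith_in.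
  by rewrite dfwith_out // raddf0.
by have := congr1 (fun h => h t) e2; rewrite dfwith_in e1 => <-.
Qed.

Lemma hom_dec : spanned hom_vector -> forall v, exists (s : {fset maxD K I}) w,
  [/\ forall n, wspace n (w n), forall n, n \notin s -> w n = 0 &
      v = \sum_(n <- s) w n].
Proof.
move=> hV; apply: hV => [|u v [s [w [hw ws ->]]] [s' [w' [hw' ws' ->]]]|v [n nv]].
- by exists fset0, (fun=> 0); split=> // [n|]; [exact: wspace0|rewrite big_seq_fset0].
- exists (s `|` s')%fset, (fun n => w n + w' n); split.
  + by move=> n; apply: wspaceD.
  + by move=> n; rewrite in_fsetU negb_or => /andP[/ws -> /ws' ->]; rewrite addr0.
  rewrite (big_fset_incl _ (fsubsetUl s s')) /=; last by move=> t _ /ws ->.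
  rewrite (big_fset_incl _ (fsubsetUr s s')) /=; last by move=> t _ /ws' ->.
  by rewrite -big_split.
exists [fset n]%fset, (fun n' => if n' == n then v else 0); split.
- by move=> n'; case: eqP => [->|_] //; apply: wspace0.
- by move=> n'; rewrite in_fset1 => /negPf ->.
by rewrite big_seq_fset1 eqxx.
Qed.

Lemma wsub_graded (S : set V) : spanned hom_vector -> wsub S ->
  forall v, S v -> v != 0 -> exists n w, [/\ wspace n w, S w & w != 0].
Proof.
move=> hV hS v; have [s [w [hw _ ->]]] := hom_dec hV v.
move=> Sw /eqP w0; apply: contrapT => h; apply: w0.
rewrite big_seq big1 // => n ns; apply: contrapT => /eqP wn; apply: h.
exists n, (w n); split=> //.
exact: (@wspace_indep _ id s w (fun _ _ => id) (fset_uniq s) hw S hS Sw n ns).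
Qed.
End WeightSpaces.

Section LatticeFamily.
Variables (K : fieldType) (I : choiceType) (W : weyl_sys K I) (V : lmodType W).
Local Notation x := (wx W).
Local Notation d := (wd W).
Local Notation D := (wD W).
Implicit Types (g : {malg int[I]}) (i j : I) (f : PD K I).
Variables (m : maxD K I) (v : V).
Hypothesis hv : wspace m v.

(** The factor produced by the k-th step down from [m] and back, replaced by 1 when it lies in [m].
    The product [Q g] of these factors from 0 to [g] is a unit modulo [m]; the scalars [r g] of
    [lattice_scalars] are its inverses. *)
Let fac i (k : nat) : PD K I :=
  if `[< inm m (tv K i - k%:R) >] then 1 else tv K i - k%:R.

Let fac_notin i k : ~ inm m (fac i k).
Proof. by rewrite /fac; case: asboolP => // _; apply: max1. Qed.

Let qfac i (k : int) : PD K I :=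
  match k with Posz _ => 1 | Negz k => \prod_(j < k.+1) fac i j.+1 end.

Let qfac_notin i k : ~ inm m (qfac i k).
Proof.
case: k => k /=; first exact: max1.
by apply: prod_notin => j; apply: fac_notin.
Qed.

Let qC i j k l : i != j -> GRing.comm (qfac i k) (qfac j l).
Proof. by move=> _; apply: mulrC. Qed.
Let q0 i : qfac i 0 = 1. Proof. by []. Qed.

Let Q g := lprod qfac g.
Let QE g i : Q g = qfac i g@_i * lrest qfac g i.
Proof. exact: lprodE q0 qC g i. Qed.

Let Q_notin g : ~ inm m (Q g).
Proof. by apply: prod_notin => i; apply: qfac_notin. Qed.

Let Qp g i : 0 <= g@_i -> Q (g + sg 1 i) = Q g.
Proof.
move=> gi; rewrite (QE g i) (QE (g + sg 1 i) i) lrestD; congr (_ * _).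
by rewrite mcoeffD mcoeff_sg eqxx; case: (g@_i) gi.
Qed.

Let Qm g i (k : nat) : g@_i = - k%:Z -> Q (g + sg (-1) i) = fac i k.+1 * Q g.
Proof.
move=> gi; rewrite (QE g i) (QE (g + sg (-1) i) i) lrestD mulrA; congr (_ * _).
rewrite mcoeffD mcoeff_sg eqxx gi; case: k {gi} => [|k].
  by rewrite oppr0 /= big_ord_recr big_ord0 mulrC.
by rewrite -opprD -[_ + 1]/(k.+1 + 1)%:Z addn1 -!NegzE /= big_ord_recr mulrC.
Qed.

Let lattice_scalars : exists r : {malg int[I]} -> PD K I,
  [/\ inm m (r 0 - 1),
      forall g i, 0 <= g@_i -> inm m (r (g + sg 1 i) - r g) &
      forall g i (k : nat), g@_i = - k%:Z ->
        inm m (fac i k.+1 * r (g + sg (-1) i) - r g)].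
Proof.
have [r rP] : exists r, forall g, inm m (r g * Q g - 1).
  by exists (fun g => sval (cid (max_inv (@Q_notin g)))) => g; case: cid.
have r_uniq g a q : q = Q g -> inm m (a * q - 1) -> inm m (a - r g).
  move=> -> ha.
  have -> : a - r g = r g * (a * Q g - 1) - a * (r g * Q g - 1) by ring.
  by apply: maxB; apply: maxMl; [exact: ha|exact: rP].
exists r; split.
- have h := rP 0; have Q0 : Q 0 = 1 by exact: lprod0.
  by rewrite Q0 mulr1 in h.
- by move=> g i gi; apply: (r_uniq _ _ _ (Qp gi)); apply: rP.
move=> g i k gi; apply: (r_uniq _ _ _ (erefl _)).
have -> : fac i k.+1 * r (g + sg (-1) i) * Q g =
    r (g + sg (-1) i) * (fac i k.+1 * Q g) by ring.
rewrite -(Qm gi); exact: rP.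
Qed.

Let intneg (k : int) : k <= 0 -> exists k' : nat, k = - k'%:Z.
Proof. by move=> k0; exists `|k|%N; rewrite lez0_abs // opprK. Qed.

Let sgK g i : g + sg 1 i + sg (-1) i = g.
Proof. by rewrite -addrA -sgD subrr sg0 addr0. Qed.
Let sgNK g i : g + sg (-1) i + sg 1 i = g.
Proof. by rewrite -addrA -sgD addNr sg0 addr0. Qed.

Let tvk (k : nat) : (- k%:Z)%:~R = - (k%:R) :> PD K I.
Proof. by rewrite rmorphN /= pmulrn. Qed.

(* The vectors w g are the translates of v by the monomials of exponent g,    *)
(* divided by the factors t_i - j that the path from 0 to g produces, except  *)
(* for those lying in m.                                                      *)
Lemma lattice_family : exists w : {malg int[I]} -> V,
  [/\ w 0 = v, forall g, wspace (act g m) (w g),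
      forall g i, 0 <= g@_i \/ ~ inm m (tv K i + (g@_i)%:~R) ->
        x i *: w g = w (g + sg 1 i),
      forall g i, g@_i < 0 -> inm m (tv K i + (g@_i)%:~R) -> x i *: w g = 0 &
      forall g i, 0 < g@_i \/ ~ inm m (tv K i + (g@_i)%:~R - 1) ->
        d i *: w g = D (tv K i) *: w (g + sg (-1) i)] /\
  [/\ forall g i, g@_i <= 0 -> inm m (tv K i + (g@_i)%:~R - 1) ->
        d i *: w g = w (g + sg (-1) i),
      forall g i (k : nat), g@_i = k -> x i ^+ k.+1 *: v = 0 -> x i *: w g = 0 &
      forall g i (k : nat), g@_i = - k%:Z -> d i ^+ k.+1 *: v = 0 -> d i *: w g = 0].
Proof.
have [r [r0 rp rm]] := lattice_scalars.
have r_eq a b : inm m (a - b) -> D a *: v = D b *: v by exact: wspace_eqm.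
pose w g : V := ymon W g *: (D (r g) *: v).
have coD g i k : (g + sg k i)@_i = g@_i + k by rewrite mcoeffD mcoeff_sg eqxx.
have xpos g i : 0 <= g@_i -> x i *: w g = w (g + sg 1 i).
  move=> gi; rewrite /w scalerA ymon_x //; congr (_ *: _).
  by apply: r_eq; apply: maxC; apply: rp.
have xneg g i : g@_i < 0 -> x i *: w g =
    ymon W (g + sg 1 i) *: (D ((tv K i + (g@_i)%:~R) * r g) *: v).
  (* Below zero [x_i] meets a [d_i] of the monomial and leaves [t_i - 1], which becomes [t_i + g_i]
     once moved to the right of the remaining monomial. *)
  move=> gi; rewrite /w scalerA -{1}[g](sgNK g i) addrAC -ymon_d; last first.
    by rewrite mcoeffD mcoeff_sg eqxx; lia.
  rewrite mulrA wxdt.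
  have -> : D (tv K i - 1) * ymon W (g + sg 1 i) =
      ymon W (g + sg 1 i) * D (tv K i + (g@_i)%:~R).
    rewrite ymon_D; congr (D _ * _); rewrite rmorphD rmorph_int /= sh_tv coD.
    by rewrite intrD; ring.
  by rewrite -scalerA; congr (_ *: _); rewrite scalerA -rmorphM.
have dpos g i : 0 < g@_i -> d i *: w g = D (tv K i) *: w (g + sg (-1) i).
  move=> gi; have e : D (r g) *: v = D (r (g + sg (-1) i)) *: v.
    by apply: r_eq; rewrite -{1}[g](sgNK g i); apply: rp; rewrite coD; lia.
  rewrite /w e -{1}[g](sgNK g i) -ymon_x; last by rewrite coD; lia.
  by rewrite [LHS]scalerA mulrA wdxt -scalerA.
have dneg g i : g@_i <= 0 -> d i *: w g = ymon W (g + sg (-1) i) *: (D (r g) *: v).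
  by move=> gi; rewrite /w scalerA ymon_d.
exists w; split; split.
- by rewrite /w ymon0 scale1r (r_eq _ _ r0) rmorph1 scale1r.
- by move=> g; apply: wspace_ymon; apply: wspace_D.
- move=> g i [/(xpos g i) //|ni].
  have [/(xpos g i) //|gi] := lerP 0 g@_i; rewrite (xneg _ _ gi); congr (_ *: _).
  have [k hk] : exists k : nat, g@_i + 1 = - k%:Z by apply: intneg; lia.
  have gik : g@_i = - (k.+1)%:Z by lia.
  have fE : fac i k.+1 = tv K i + (g@_i)%:~R.
    rewrite /fac; case: asboolP; rewrite gik tvk //.
    by move=> h; case: ni; rewrite gik tvk.
  apply: r_eq; rewrite -fE -{1}(sgK g i); apply: rm.
  by rewrite coD.
- move=> g i gi mi; rewrite (xneg _ _ gi); have -> : D ((tv K i + (g@_i)%:~R) * r g) *: v = 0.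
    by apply: hv; apply: maxMr.
  by rewrite scaler0.
- move=> g i [/(dpos g i) //|ni].
  have [/(dpos g i) //|gi] := ltrP 0 g@_i; rewrite (dneg _ _ gi).
  have [k hk] := intneg gi.
  have fE : fac i k.+1 = tv K i + (g@_i)%:~R - 1.
    have e : tv K i + (g@_i)%:~R - 1 = tv K i - k.+1%:R.
      by rewrite hk tvk -natr1; ring.
    by rewrite e in ni *; rewrite /fac; case: asboolP.
  have -> : D (r g) *: v = D (tv K i + (g@_i)%:~R - 1) *: (D (r (g + sg (-1) i)) *: v).
    by rewrite scalerA -rmorphM -fE; apply: r_eq; apply: maxC; apply: rm.
  rewrite [LHS]scalerA [RHS]scalerA ymon_D; congr (D _ * _ *: _).
  rewrite rmorphB rmorphD rmorph_int rmorph1 /= sh_tv coD.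
  by rewrite intrD; ring.
- move=> g i gi mi; rewrite (dneg _ _ gi); congr (_ *: _).
  have [k hk] := intneg gi.
  apply: r_eq; apply: maxC; have := rm _ _ _ hk.
  have -> : fac i k.+1 = 1.
    have e : tv K i + (g@_i)%:~R - 1 = tv K i - k.+1%:R.
      by rewrite hk tvk -natr1; ring.
    by rewrite e in mi; rewrite /fac; case: asboolP.
  by rewrite mul1r.
- move=> g i k gi xv; have gk : (g + sg 1 i)@_i = k.+1 by rewrite coD gi; lia.
  have [a ea] := ymon_xn W gk.
  rewrite /w scalerA ymon_x ?gi // ea -scalerA.
  have -> : x i ^+ k.+1 *: (D (r g) *: v) = D (sh (sg k.+1 i) (r g)) *: (x i ^+ k.+1 *: v).
    rewrite !scalerA; congr (_ *: _).
    elim: (k.+1) (r g) => [|l IH] f; first by rewrite sg0 sh0 mul1r mulr1.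
    by rewrite exprS -mulrA IH mulrA wxD -mulrA -[l.+1]add1n PoszD sgD shD.
  by rewrite xv !scaler0.
- move=> g i k gi dv; have gk : (g + sg (-1) i)@_i = - k.+1%:Z by rewrite coD gi; lia.
  have [a ea] := ymon_dn W gk.
  rewrite /w scalerA ymon_d ?gi ?oppr_le0 // ea -scalerA.
  have -> : d i ^+ k.+1 *: (D (r g) *: v) =
      D (sh (sg (- k.+1%:Z) i) (r g)) *: (d i ^+ k.+1 *: v).
    rewrite !scalerA; congr (_ *: _).
    elim: (k.+1) (r g) => [|l IH] f; first by rewrite oppr0 sg0 sh0 mul1r mulr1.
    by rewrite exprS -mulrA IH mulrA wdD -mulrA -[l.+1]add1n PoszD opprD sgD shD.
  by rewrite dv !scaler0.
Qed.
End LatticeFamily.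

(** * Constructing modules from operators *)

Section Representation.
Variables (K : fieldType) (I : choiceType) (V : zmodType).
Variables (kc : K -> V -> V) (X Y : I -> V -> V).
Hypotheses (kcB : forall c, zmod_morphism (kc c))
  (kcD : forall c e v, kc (c + e) v = kc c v + kc e v)
  (kcM : forall c e v, kc (c * e) v = kc c (kc e v)) (kc1 : forall v, kc 1 v = v)
  (XB : forall i, zmod_morphism (X i)) (YB : forall i, zmod_morphism (Y i))
  (kX : forall c i v, X i (kc c v) = kc c (X i v))
  (kY : forall c i v, Y i (kc c v) = kc c (Y i v))
  (XX : forall i j v, X i (X j v) = X j (X i v))
  (YY : forall i j v, Y i (Y j v) = Y j (Y i v))
  (YX : forall i j v, Y i (X j v) = X j (Y i v) + (if i == j then v else 0)).
Local Notation FA := (free_algebra K I).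

Let op (s : (I + I)%type) : V -> V := match s with inl i => X i | inr i => Y i end.
Let word (u : {fmonom (I + I)%type}) (v : V) : V := foldr op v u.

Let opB s : zmod_morphism (op s).
Proof. by case: s => i; [exact: XB|exact: YB]. Qed.
Let op_kc c s v : op s (kc c v) = kc c (op s v).
Proof. by case: s => i; [exact: kX|exact: kY]. Qed.

Let wordB u : zmod_morphism (word u).
Proof.
case: u => u v w; rewrite /word /=.
by elim: u => //= s u IH; rewrite IH opB.
Qed.

Let word_kc c u v : word u (kc c v) = kc c (word u v).
Proof. by case: u => u; rewrite /word /=; elim: u => //= s u ->; rewrite op_kc. Qed.

Let wordM u w v : word (mmul u w) v = word u (word w v).
Proof. by rewrite /word fmM foldr_cat. Qed.

Definition free_act (f : FA) (v : V) : V := malg_ext (fun u c => kc c (word u v)) f.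

Let kcN c v : kc (- c) v = - kc c v.
Proof.
have k0 : kc 0 v = 0 by apply: (addrI (kc 0 v)); rewrite -kcD !addr0.
by apply/eqP; rewrite -subr_eq0 opprK -kcD addNr k0.
Qed.

Let hF v (u : {fmonom (I + I)%type}) : zmod_morphism (fun c => kc c (word u v)).
Proof. by move=> c e; rewrite kcD kcN. Qed.

Lemma free_actU c u v : free_act << c *g u >> v = kc c (word u v).
Proof. exact: (malg_extU (hF v)). Qed.

Lemma free_actD f g v : free_act (f + g) v = free_act f v + free_act g v.
Proof. exact: (malg_extD (hF v)). Qed.

Lemma free_act0 v : free_act 0 v = 0.
Proof. exact: (malg_ext0 (hF v)). Qed.

Lemma free_actBl f g v : free_act (f - g) v = free_act f v - free_act g v.
Proof. exact: (malg_extB (hF v)). Qed.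

Lemma free_actBr f : zmod_morphism (free_act f).
Proof.
move=> v w; elim/malg_ind: f => [|f g IHf IHg|c u].
- by rewrite !free_act0 subrr.
- by rewrite !free_actD IHf IHg addrACA opprD.
by rewrite !free_actU wordB kcB.
Qed.

Let free_act_r0 f : free_act f 0 = 0.
Proof. exact: zmod_morphism0 (free_actBr f). Qed.
Let free_actDr f v w : free_act f (v + w) = free_act f v + free_act f w.
Proof. exact: zmod_morphismD (free_actBr f) _ _. Qed.

Lemma free_actM f g v : free_act (f * g) v = free_act f (free_act g v).
Proof.
elim/malg_ind: f => [|f f' IH IH'|c u].
- by rewrite mul0r !free_act0.
- rewrite mulrDl; apply: (etrans (free_actD _ _ _)).
  by rewrite (free_actD f f'); apply: (congr2 +%R IH IH').
elim/malg_ind: g => [|g g' IH IH'|e w].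
- by rewrite mulr0 !free_act0 free_act_r0.
- rewrite mulrDr; apply: (etrans (free_actD _ _ _)).
  by rewrite (free_actD g g') free_actDr; apply: (congr2 +%R IH IH').
rewrite malgM_def fgmulUU; apply: (etrans (free_actU _ _ _)).
by rewrite (free_actU e) (free_actU c) wordM kcM word_kc.
Qed.

Let free_act1 v : free_act 1 v = v.
Proof. by rewrite [LHS](free_actU 1) kc1 /word fm1. Qed.

Let free_act_x i v : free_act (@gen_x K I i) v = X i v.
Proof. by rewrite (free_actU 1 (fmu _)) kc1 /word fmU. Qed.
Let free_act_d i v : free_act (@gen_d K I i) v = Y i v.
Proof. by rewrite (free_actU 1 (fmu _)) kc1 /word fmU. Qed.

Let J : set FA := [set f | forall v, free_act f v = 0].

Let J_ideal : is_ideal J.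
Proof.
split=> [v|f g Jf Jg v|f g Jg v|f g Jg v].
- exact: free_act0.
- by rewrite free_actBl Jf Jg subrr.
- by rewrite free_actM Jg free_act_r0.
- by rewrite free_actM.
Qed.

Let free_act_relators (gx gd : I -> FA) :
  (forall i v, free_act (gx i) v = X i v) -> (forall i v, free_act (gd i) v = Y i v) ->
  forall i j, [/\ J (lie_bracket (gx i) (gx j)), J (lie_bracket (gd i) (gd j)) &
    J (lie_bracket (gd i) (gx j) - (i == j)%:R)].
Proof.
move=> hx hd i j.
have bracket f g v : free_act (lie_bracket f g) v =
    free_act f (free_act g v) - free_act g (free_act f v).
  by rewrite free_actBl; apply: (congr2 (fun a b => a - b) (free_actM _ _ v) (free_actM _ _ v)).
split=> v; first by rewrite bracket !hx XX subrr.
  by rewrite bracket !hd YY subrr.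
rewrite free_actBl bracket !hx !hd YX (addrAC (X j _)) subrr add0r.
by case: (i == j); rewrite ?free_act1 ?free_act0 subrr.
Qed.

Let weyl_ideal_J : @weyl_ideal K I `<=` J.
Proof.
move=> f; apply; first exact: J_ideal.
have h := free_act_relators free_act_x free_act_d.
by move=> _ [[i [j ->]]|[[i [j ->]]|[i [j ->]]]]; case: (h i j).
Qed.

Let weyl_act (a : weyl_algebra K I) (v : V) : V := free_act (repr a) v.

Let weyl_act_pi f v : weyl_act (weyl_pi f) v = free_act f v.
Proof.
have := weyl_ideal_J (weyl_repr f) v; rewrite free_actBl => /eqP.
by rewrite subr_eq0 => /eqP.
Qed.

Let weyl_actA a b v : weyl_act a (weyl_act b v) = weyl_act (a * b) v.
Proof.
elim/weyl_ind: a => f; elim/weyl_ind: b => g.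
by rewrite -weyl_piM !weyl_act_pi free_actM.
Qed.
Let weyl_act1 : left_id 1 weyl_act.
Proof. by move=> v; rewrite weyl_act_pi free_act1. Qed.
Let weyl_actDr : right_distributive weyl_act +%R.
Proof. by move=> a v w; apply: free_actDr. Qed.
Let weyl_actDl v : {morph weyl_act^~ v : a b / a + b}.
Proof.
move=> a b; elim/weyl_ind: a => f; elim/weyl_ind: b => g.
by rewrite -weyl_piD !weyl_act_pi free_actD.
Qed.

(** Binding [free_act] ties the type to the operators whose module structure it is going to
    carry. *)
Definition rep_module : Type := let _ := free_act in V.
HB.instance Definition _ := GRing.Zmodule.copy rep_module V.
HB.instance Definition _ := GRing.Zmodule_isLmodule.Build (weyl_algebra K I) rep_module
  weyl_actA weyl_act1 weyl_actDr weyl_actDl.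

(** The free algebra acts by words in the operators. Elements acting as zero form a two-sided ideal
    containing the relators, so the action factors through the Weyl algebra. *)
Lemma representation : exists (L : lmodType (weyl_algebra K I)) (h : {additive V -> L}),
  [/\ bijective h, forall c v, weyl_const I c *: h v = h (kc c v),
      forall i v, weyl_x K i *: h v = h (X i v) &
      forall i v, weyl_d K i *: h v = h (Y i v)].
Proof.
exists rep_module, (idfun : {additive V -> V}); split.
- by exists idfun.
- move=> c v; rewrite -[LHS]/(weyl_act _ _) /weyl_const -weyl_piZ weyl_act_pi.
  have -> : c *: 1 = << c *g mone >> :> FA.
    apply/malgP => u; apply: (etrans (mcoeffZ c (<< mone >> : {malg K[{fmonom (I + I)%type}]}) u)).
    by rewrite !mcoeffU mulrnAr mulr1.
  by rewrite free_actU /word fm1.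
- by move=> i v; rewrite -[LHS]/(weyl_act _ _) weyl_act_pi free_act_x.
- by move=> i v; rewrite -[LHS]/(weyl_act _ _) weyl_act_pi free_act_d.
Qed.
End Representation.

Section Model.
Variables (K : fieldType) (I : choiceType) (Q : zmodType) (P : choiceType) (T : set P).
Variables (kq : K -> Q -> Q) (rx rd tau : I -> P -> Q -> Q).
Variables (up dn : I -> P -> P).
Implicit Types (n : P) (q : Q) (i j : I).
Hypotheses (upK : forall i, cancel (up i) (dn i)) (dnK : forall i, cancel (dn i) (up i))
  (upC : forall i j n, up i (up j n) = up j (up i n))
  (dnC : forall i j n, dn i (dn j n) = dn j (dn i n))
  (updnC : forall i j n, up i (dn j n) = dn j (up i n)).
Hypotheses (kqB : forall c, zmod_morphism (kq c))
  (kqD : forall c e q, kq (c + e) q = kq c q + kq e q)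
  (kqM : forall c e q, kq (c * e) q = kq c (kq e q)) (kq1 : forall q, kq 1 q = q)
  (rxB : forall i n, zmod_morphism (rx i n)) (rdB : forall i n, zmod_morphism (rd i n))
  (kqx : forall c i n q, rx i n (kq c q) = kq c (rx i n q))
  (kqd : forall c i n q, rd i n (kq c q) = kq c (rd i n q))
  (rx_out : forall i n q, T n -> ~ T (up i n) -> rx i n q = 0)
  (rd_out : forall i n q, T n -> ~ T (dn i n) -> rd i n q = 0)
  (rx_up : forall i j n q, i != j -> T n -> T (up j n) -> rx i (up j n) q = rx i n q)
  (rd_up : forall i j n q, i != j -> T n -> T (up j n) -> rd i (up j n) q = rd i n q)
  (rxx : forall i j n q, rx i n (rx j n q) = rx j n (rx i n q))
  (rdd : forall i j n q, rd i n (rd j n q) = rd j n (rd i n q))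
  (rxd : forall i j n q, rx i n (rd j n q) = rd j n (rx i n q))
  (rdx_tau : forall i n q, T n -> T (up i n) -> rd i (up i n) (rx i n q) = tau i n q)
  (tau0 : forall i n q, T n -> ~ T (up i n) -> tau i n q = 0)
  (rxd_tau : forall i n q, T n -> T (dn i n) -> rx i (dn i n) (rd i n q) = tau i n q - q)
  (tau1 : forall i n q, T n -> ~ T (dn i n) -> tau i n q = q).

Let M := {malg Q[set_type T]}.

(** [B n q] is [q] placed at position [n], and 0 when [n] lies outside [T]. With this convention a
    step that leaves [T] is given by the same formula as any other. *)
Fact embed_subproof : {B : P -> Q -> M |
  [/\ forall (n : T) q, B (val n) q = << q *g n >>, forall n q, ~ T n -> B n q = 0 &
      forall n, zmod_morphism (B n)]}.
Proof.
exists (fun n q => if (insub n : option T) is Some n' then << q *g n' >> else 0).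
split=> [n q|n q Tn|n q q']; first by rewrite valK.
  by rewrite insubN //; apply/negP => /set_mem.
by case: insub => [n'|]; [exact: monalgUB|rewrite subrr].
Qed.
Let B : P -> Q -> M := sval embed_subproof.
Let B_in (n : T) q : B (val n) q = << q *g n >>.
Proof. by case: (svalP embed_subproof). Qed.
Let B_out n q : ~ T n -> B n q = 0.
Proof. by case: (svalP embed_subproof) => _ h _; apply: h. Qed.
Let BB n : zmod_morphism (B n).
Proof. by case: (svalP embed_subproof). Qed.

Let opX i (f : M) : M := malg_ext (fun (n : T) q => B (up i (val n)) (rx i (val n) q)) f.
Let opY i (f : M) : M := malg_ext (fun (n : T) q => B (dn i (val n)) (rd i (val n) q)) f.
Let opk c (f : M) : M := malg_ext (fun (n : T) q => B (val n) (kq c q)) f.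

Let hX i (n : T) : zmod_morphism (fun q => B (up i (val n)) (rx i (val n) q)).
Proof. by move=> q q'; rewrite rxB BB. Qed.
Let hY i (n : T) : zmod_morphism (fun q => B (dn i (val n)) (rd i (val n) q)).
Proof. by move=> q q'; rewrite rdB BB. Qed.
Let hk c (n : T) : zmod_morphism (fun q => B (val n) (kq c q)).
Proof. by move=> q q'; rewrite kqB BB. Qed.

Let opXB i : zmod_morphism (opX i). Proof. exact: malg_extB (hX i). Qed.
Let opYB i : zmod_morphism (opY i). Proof. exact: malg_extB (hY i). Qed.
Let opkB c : zmod_morphism (opk c). Proof. exact: malg_extB (hk c). Qed.

Let valT n : T n -> exists n' : T, val n' = n.
Proof. by move=> Tn; exists (SigSub (mem_set Tn)). Qed.

Let opXE i n q : T n -> opX i (B n q) = B (up i n) (rx i n q).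
Proof. by move=> /valT[n' <-]; rewrite B_in; apply: (malg_extU (hX i)). Qed.
Let opYE i n q : T n -> opY i (B n q) = B (dn i n) (rd i n q).
Proof. by move=> /valT[n' <-]; rewrite B_in; apply: (malg_extU (hY i)). Qed.
Let opkE c n q : T n -> opk c (B n q) = B n (kq c q).
Proof. by move=> /valT[n' <-]; rewrite B_in; apply: (malg_extU (hk c)). Qed.

Let B0 n : B n 0 = 0. Proof. exact/zmod_morphism0/BB. Qed.

Let ext_eq (F G : M -> M) : zmod_morphism F -> zmod_morphism G ->
  (forall n q, T n -> F (B n q) = G (B n q)) -> F =1 G.
Proof.
move=> hF hG hFG f; elim/malg_ind: f => [|f g IH IH'|q n]; first by rewrite (zmod_morphism0 hF) (zmod_morphism0 hG).
  by rewrite (zmod_morphismD hF) (zmod_morphismD hG) IH IH'.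
by rewrite -B_in; apply: hFG; apply: set_mem (valP n).
Qed.

Let zmod_comp (F G : M -> M) : zmod_morphism F -> zmod_morphism G ->
  zmod_morphism (fun v => F (G v)).
Proof. by move=> hF hG v w; rewrite hG hF. Qed.

Let rx_dn i j n q : i != j -> T n -> T (dn j n) -> rx i (dn j n) q = rx i n q.
Proof. by move=> ij Tn Td; rewrite -[in RHS](dnK j n) rx_up ?dnK. Qed.
Let rd_dn i j n q : i != j -> T n -> T (dn j n) -> rd i (dn j n) q = rd i n q.
Proof. by move=> ij Tn Td; rewrite -[in RHS](dnK j n) rd_up ?dnK. Qed.

Let XXE i j n q : i != j -> T n -> opX i (opX j (B n q)) =
  B (up i (up j n)) (rx i n (rx j n q)).
Proof.
move=> ij Tn; rewrite opXE //; have [Tj|Tj] := pselect (T (up j n)).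
  by rewrite opXE // rx_up.
rewrite B_out // (zmod_morphism0 (opXB i)) (rx_out _ Tn Tj).
by rewrite (zmod_morphism0 (rxB _ _)) B0.
Qed.
Let YYE i j n q : i != j -> T n -> opY i (opY j (B n q)) =
  B (dn i (dn j n)) (rd i n (rd j n q)).
Proof.
move=> ij Tn; rewrite opYE //; have [Tj|Tj] := pselect (T (dn j n)).
  by rewrite opYE // rd_dn.
rewrite B_out // (zmod_morphism0 (opYB i)) (rd_out _ Tn Tj).
by rewrite (zmod_morphism0 (rdB _ _)) B0.
Qed.
Let YXE i j n q : i != j -> T n -> opY i (opX j (B n q)) =
  B (dn i (up j n)) (rd i n (rx j n q)).
Proof.
move=> ij Tn; rewrite opXE //; have [Tj|Tj] := pselect (T (up j n)).
  by rewrite opYE // rd_up.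
rewrite B_out // (zmod_morphism0 (opYB i)) (rx_out _ Tn Tj).
by rewrite (zmod_morphism0 (rdB _ _)) B0.
Qed.
Let XYE i j n q : i != j -> T n -> opX i (opY j (B n q)) =
  B (up i (dn j n)) (rx i n (rd j n q)).
Proof.
move=> ij Tn; rewrite opYE //; have [Tj|Tj] := pselect (T (dn j n)).
  by rewrite opXE // rx_dn.
rewrite B_out // (zmod_morphism0 (opXB i)) (rd_out _ Tn Tj).
by rewrite (zmod_morphism0 (rxB _ _)) B0.
Qed.

Let YXEii i n q : T n -> opY i (opX i (B n q)) = B n (tau i n q).
Proof.
move=> Tn; rewrite opXE //; have [Ti|Ti] := pselect (T (up i n)).
  by rewrite opYE // upK rdx_tau.
by rewrite B_out // (zmod_morphism0 (opYB i)) tau0 // B0.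
Qed.
Let XYEii i n q : T n -> opX i (opY i (B n q)) = B n (tau i n q) - B n q.
Proof.
move=> Tn; rewrite opYE // -BB; have [Ti|Ti] := pselect (T (dn i n)).
  by rewrite opXE // dnK rxd_tau.
by rewrite B_out // (zmod_morphism0 (opXB i)) tau1 // subrr B0.
Qed.

(** The relations are checked on one summand at a time. For different indices they reduce to
    commutation of the coefficient maps. For equal indices [tau i n] is the action of [t_i] at [n]:
    a step leaving [T] is consistent with [d_i x_i - x_i d_i = 1] because [t_i] is 0 at an upper
    boundary and 1 at a lower one. *)
Lemma model : exists (L : lmodType (weyl_algebra K I)) (e : forall n : T, {additive Q -> L}),
  is_direct_sum e /\ forall (n : T) (q : Q),
    (forall c, weyl_const I c *: e n q = e n (kq c q)) /\
    forall i,
      [/\ forall n' : T, val n' = up i (val n) -> weyl_x K i *: e n q = e n' (rx i (val n) q),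
          ~ T (up i (val n)) -> weyl_x K i *: e n q = 0,
          forall n' : T, val n' = dn i (val n) -> weyl_d K i *: e n q = e n' (rd i (val n) q) &
          ~ T (dn i (val n)) -> weyl_d K i *: e n q = 0].
Proof.
have zmod_add (F G : M -> M) : zmod_morphism F -> zmod_morphism G ->
    zmod_morphism (fun v => F v + G v).
  by move=> hF hG v w; rewrite hF hG addrACA opprD.
have zmod_if (b : bool) : zmod_morphism (fun v : M => if b then v else 0).
  by move=> v w; case: b; rewrite ?subr0.
have hkD c e v : opk (c + e) v = opk c v + opk e v.
  apply: (ext_eq (opkB _) (zmod_add _ _ (opkB c) (opkB e))) v => n q Tn.
  by rewrite !opkE // kqD (zmod_morphismD (BB n)).
have hkM c e v : opk (c * e) v = opk c (opk e v).
  apply: (ext_eq (opkB _) (zmod_comp (opkB c) (opkB e))) v => n q Tn.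
  by rewrite !opkE // kqM.
have hk1 v : opk 1 v = v.
  have idB : zmod_morphism (@id M) by [].
  by apply: (ext_eq (opkB 1) idB) v => n q Tn; rewrite opkE // kq1.
have hkX c i v : opX i (opk c v) = opk c (opX i v).
  apply: (ext_eq (zmod_comp (opXB i) (opkB c)) (zmod_comp (opkB c) (opXB i))) v => n q Tn.
  rewrite opkE // !opXE // kqx; have [Ti|Ti] := pselect (T (up i n)); first by rewrite opkE.
  by rewrite !B_out // (zmod_morphism0 (opkB c)).
have hkY c i v : opY i (opk c v) = opk c (opY i v).
  apply: (ext_eq (zmod_comp (opYB i) (opkB c)) (zmod_comp (opkB c) (opYB i))) v => n q Tn.
  rewrite opkE // !opYE // kqd; have [Ti|Ti] := pselect (T (dn i n)); first by rewrite opkE.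
  by rewrite !B_out // (zmod_morphism0 (opkB c)).
have hXX i j v : opX i (opX j v) = opX j (opX i v).
  apply: (ext_eq (zmod_comp (opXB i) (opXB j)) (zmod_comp (opXB j) (opXB i))) v => n q Tn.
  have [->//|ij] := eqVneq i j.
  by rewrite !XXE // 1?eq_sym // upC rxx.
have hYY i j v : opY i (opY j v) = opY j (opY i v).
  apply: (ext_eq (zmod_comp (opYB i) (opYB j)) (zmod_comp (opYB j) (opYB i))) v => n q Tn.
  have [->//|ij] := eqVneq i j.
  by rewrite !YYE // 1?eq_sym // dnC rdd.
have hYX i j v : opY i (opX j v) = opX j (opY i v) + (if i == j then v else 0).
  apply: (ext_eq (zmod_comp (opYB i) (opXB j))
    (zmod_add _ _ (zmod_comp (opXB j) (opYB i)) (zmod_if (i == j)))) v => n q Tn.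
  have [->|ij] := eqVneq i j; first by rewrite YXEii // XYEii // subrK.
  by rewrite YXE // XYE 1?eq_sym // addr0 updnC rxd.
have [L [h [hbij hc hx hd]]] :=
  representation opkB hkD hkM hk1 opXB opYB hkX hkY hXX hYY hYX.
have eB (n : T) : zmod_morphism (fun q => h << q *g n >>).
  by move=> q q'; rewrite monalgUB raddfB.
pose e (n : T) : {additive Q -> L} :=
  HB.pack (fun q => h << q *g n >>) (GRing.isZmodMorphism.Build _ _ _ (eB n)).
have eE (n : T) q : e n q = h (B (val n) q) by rewrite B_in.
exists L, e; split; last first.
  move=> n q; have Tn : T (val n) by apply: set_mem (valP n).
  split=> [c|i]; first by rewrite !eE hc opkE.
  split=> [n' n'E|Ti|n' n'E|Ti]; rewrite !eE ?hx ?hd ?opXE ?opYE // ?n'E //.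
    by rewrite B_out // raddf0.
  by rewrite B_out // raddf0.
have [k hK kK] := hbij.
have kE (q : T -> Q) (s : {fset T}) : (forall n : T, n \notin s -> q n = 0) ->
    \sum_(n \in setT) e n (q n) = h (\sum_(n <- s) << q n *g n >>).
  move=> hq; rewrite (fsbigTE s) ?raddf_sum // => n /hq ->.
  by rewrite raddf0.
move=> v; exists (fun n : T => (k v)@_n); split.
  have hs (n : T) : n \notin msupp (k v) -> (k v)@_n = 0 by apply: mcoeff_outdom.
  split.
    apply: sub_finite_set (finite_fset (msupp (k v))) => n /= hn.
    by apply: contra_neqT hn => /hs.
  by rewrite (kE _ _ hs) -(monalgE (k v)) kK.
move=> q [fq ->]; apply: functional_extensionality_dep => n.
pose s := fset_set [set n : T | q n != 0].
have hs (u : T) : u \notin s -> q u = 0.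
  by rewrite in_fset_set // => /negP hu; have [//|qu] := eqVneq (q u) 0; case: hu; apply: mem_set.
rewrite (kE _ _ hs) hK raddf_sum /=.
have [ns|/[dup] ns /hs ->] := boolP (n \in s).
  rewrite (big_fsetD1 n) //= mcoeffUU big1_seq ?addr0 // => j /=.
  by rewrite in_fsetD1 mcoeffU => /andP[/negPf -> _].
rewrite big1_seq // => j /= js; rewrite mcoeffU.
by case: eqP ns => // <-; rewrite js.
Qed.
End Model.

(** * Local nilpotency, graded families and isomorphisms *)

Section PowerRelations.
Variables (K : fieldType) (I : choiceType) (W : weyl_sys K I).
Local Notation x := (wx W).
Local Notation d := (wd W).
Local Notation D := (wD W).
Implicit Types (i j : I) (f : PD K I) (k : nat).

Lemma wxn_D i k f : x i ^+ k * D f = D (sh (sg k i) f) * x i ^+ k.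
Proof.
elim: k f => [|k IH] f; first by rewrite sg0 sh0 mul1r mulr1.
by rewrite exprS -mulrA IH mulrA wxD -mulrA -[k.+1]add1n PoszD sgD shD.
Qed.

Lemma wdn_D i k f : d i ^+ k * D f = D (sh (sg (- k%:Z) i) f) * d i ^+ k.
Proof.
elim: k f => [|k IH] f; first by rewrite oppr0 sg0 sh0 mul1r mulr1.
by rewrite exprS -mulrA IH mulrA wdD -mulrA -[k.+1]add1n PoszD opprD sgD shD.
Qed.

Lemma wxn_d i k : x i ^+ k.+1 * d i = D (tv K i - k.+1%:R) * x i ^+ k.
Proof.
rewrite exprSr -mulrA wxdt wxn_D; congr (D _ * _).
rewrite rmorphB rmorph1 /= sh_tv mcoeff_sg eqxx -pmulrn -natr1; ring.
Qed.

Lemma wdn_x i k : d i ^+ k.+1 * x i = D (tv K i + k%:R) * d i ^+ k.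
Proof.
rewrite exprSr -mulrA wdxt wdn_D; congr (D _ * _).
by rewrite sh_tv mcoeff_sg eqxx rmorphN /= -pmulrn opprK.
Qed.

Lemma wx_dn i k : x i * d i ^+ k.+1 = D (tv K i - 1) * d i ^+ k.
Proof. by rewrite exprS mulrA wxdt. Qed.

Lemma wdn_xn i k : d i ^+ k * x i ^+ k = D (\prod_(j < k) (tv K i + j%:R)).
Proof.
elim: k => [|k IH]; first by rewrite big_ord0 rmorph1 mulr1.
rewrite big_ord_recr /= rmorphM /= -IH.
rewrite [x i ^+ k.+1]exprS mulrA wdn_x -mulrA IH.
by rewrite -!rmorphM mulrC.
Qed.

Lemma wxn_dn i k : x i ^+ k * d i ^+ k = D (\prod_(j < k) (tv K i - j.+1%:R)).
Proof.
elim: k => [|k IH]; first by rewrite big_ord0 rmorph1 mulr1.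
rewrite big_ord_recr /= rmorphM /= -IH.
rewrite [d i ^+ k.+1]exprS mulrA wxn_d -mulrA IH.
by rewrite -!rmorphM mulrC.
Qed.

Lemma wxn_comm_x i j k : x i ^+ k * x j = x j * x i ^+ k.
Proof. by apply/commr_sym/commrX; apply: wxx. Qed.
Lemma wdn_comm_d i j k : d i ^+ k * d j = d j * d i ^+ k.
Proof. by apply/commr_sym/commrX; apply: wdd. Qed.
Lemma wxn_comm_d i j k : i != j -> x i ^+ k * d j = d j * x i ^+ k.
Proof. by move=> ij; apply/commr_sym/commrX; apply: wdx; rewrite eq_sym. Qed.
Lemma wdn_comm_x i j k : i != j -> d i ^+ k * x j = x j * d i ^+ k.
Proof. by move=> ij; apply/commr_sym/commrX/commr_sym; apply: wdx. Qed.
End PowerRelations.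

Section ModuleLemmas.
Variables (K : fieldType) (I : choiceType) (W : weyl_sys K I).
Local Notation x := (wx W).
Local Notation d := (wd W).
Local Notation D := (wD W).
Implicit Types (i j : I) (f : PD K I) (k : nat) (V : lmodType W).

Definition wsimple V : Prop :=
  (exists v : V, v != 0) /\
  forall S : set V, wsub S -> (forall v, S v -> v = 0) \/ (forall v, S v).

(** Moving [d_i] to the left through [x_i^(k+1)] leaves [x_i^k] on the right, so applying [d_i]
    raises the order of nilpotency by at most one; the other generators do not raise it. *)
Lemma x_locnil_sub V i : wsub [set v : V | exists k, x i ^+ k *: v = 0].
Proof.
apply: wsub_gen => /= [|u v [k hu] [l hv]|c v [k hv]|j v [k hv]|j v [k hv]].
- by exists 0%N; rewrite scaler0.
- exists (k + l)%N; rewrite scalerDr [in X in _ + X]exprD -scalerA hv scaler0 addr0.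
  by rewrite addnC exprD -scalerA hu scaler0.
- by exists k; rewrite scalerA wxn_D -scalerA hv scaler0.
- by exists k; rewrite scalerA wxn_comm_x -scalerA hv scaler0.
have [<-|ij] := eqVneq i j.
  by exists k.+1; rewrite scalerA wxn_d -scalerA hv scaler0.
by exists k; rewrite scalerA wxn_comm_d // -scalerA hv scaler0.
Qed.

Lemma d_locnil_sub V i : wsub [set v : V | exists k, d i ^+ k *: v = 0].
Proof.
apply: wsub_gen => /= [|u v [k hu] [l hv]|c v [k hv]|j v [k hv]|j v [k hv]].
- by exists 0%N; rewrite scaler0.
- exists (k + l)%N; rewrite scalerDr [in X in _ + X]exprD -scalerA hv scaler0 addr0.
  by rewrite addnC exprD -scalerA hu scaler0.
- by exists k; rewrite scalerA wdn_D -scalerA hv scaler0.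
- have [<-|ij] := eqVneq i j.
    by exists k.+1; rewrite scalerA wdn_x -scalerA hv scaler0.
  by exists k; rewrite scalerA wdn_comm_x // -scalerA hv scaler0.
by exists k; rewrite scalerA wdn_comm_d -scalerA hv scaler0.
Qed.

Definition weyl_gen (a : W) : Prop :=
  (exists c, a = D (cD I c)) \/ (exists i, a = x i) \/ (exists i, a = d i).

Lemma weyl_gen_sub V (S : set V) : S 0 -> (forall u v, S u -> S v -> S (u + v)) ->
  (forall a v, weyl_gen a -> S v -> S (a *: v)) -> wsub S.
Proof.
move=> S0 SD Sa; apply: wsub_gen => // [c v|i v|i v]; apply: Sa.
- by left; exists c.
- by right; left; exists i.
- by right; right; exists i.
Qed.

Section Families.
Variables (T : choiceType) (Q : T -> zmodType).

Definition span_of V (e : forall t, Q t -> V) : set V :=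
  [set v | forall P : set V, P 0 -> (forall u w, P u -> P w -> P (u + w)) ->
     (forall t q, P (e t q)) -> P v].

Lemma span_of_sub V (e : forall t, Q t -> V) :
  (forall a t q, weyl_gen a -> span_of e (a *: e t q)) -> wsub (span_of e).
Proof.
move=> he; apply: weyl_gen_sub => [P //|u v hu hv P P0 PD Pe|a v ga hv].
  by apply: (PD); [exact: hu P P0 PD Pe|exact: hv P P0 PD Pe].
apply: (hv (fun v => span_of e (a *: v))) => [|u w hu hw|t q].
- by rewrite scaler0 => P.
- by rewrite scalerDr => P P0 PD Pe; apply: (PD); [exact: hu P P0 PD Pe|exact: hw P P0 PD Pe].
exact: he.
Qed.

Lemma span_of_mem V (e : forall t, Q t -> V) t q : span_of e (e t q).
Proof. by move=> P _ _; apply. Qed.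

Lemma graded_family V (e : forall t, {additive Q t -> V}) (wt : T -> maxD K I) :
  injective wt -> (forall t q, wspace (wt t) (e t q)) ->
  spanned [set v | exists t q, v = e t q] ->
  forall S : set V, wsub S -> forall v, S v -> v != 0 ->
  exists t q, e t q != 0 /\ S (e t q).
Proof.
move=> wt_inj he hE S hS v; have [s [q [_ ->]]] := spanned_dec hE v.
move=> Sv /eqP v0; apply: contrapT => h; apply: v0.
rewrite big_seq big1 // => t ts; apply: contrapT => /eqP et; apply: h.
exists t, (q t); split=> //.
exact: (@wspace_indep _ _ _ _ _ wt s (fun t => e t (q t)) wt_inj (fset_uniq s)
  (fun t => he t (q t)) S hS Sv t ts).
Qed.

(** Pairs of sums with the same components form a correspondence [R]. It is stable under the
    generators, hence under the whole algebra, and directness on both sides makes it the graph of a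
    bijection. *)
Lemma direct_sum_iso V V' (e : forall t, {additive Q t -> V})
    (e' : forall t, {additive Q t -> V'}) : is_direct_sum e -> is_direct_sum e' ->
  (forall a t q, weyl_gen a -> exists t' q', a *: e t q = e t' q' /\ a *: e' t q = e' t' q') ->
  exists phi : {linear V -> V'}, bijective phi /\ forall t q, phi (e t q) = e' t q.
Proof.
move=> hE hE' he.
pose R v v' := exists (s : {fset T}) (q : forall t, Q t),
  [/\ forall t, t \notin s -> q t = 0, v = \sum_(t <- s) e t (q t) &
      v' = \sum_(t <- s) e' t (q t)].
have RE t q : R (e t q) (e' t q).
  exists [fset t]%fset, (@dfwith T (fun u => Q u) (fun=> 0) t q).
  rewrite !big_seq_fset1 !dfwith_in; split=> // t'.
  by rewrite in_fset1 eq_sym => tt'; rewrite dfwith_out.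
have RD u u' v v' : R u u' -> R v v' -> R (u + v) (u' + v').
  move=> [s [q [hq -> ->]]] [s' [q' [hq' -> ->]]].
  exists (s `|` s')%fset, (fun t => q t + q' t); split.
  + by move=> t; rewrite in_fsetU negb_or => /andP[/hq -> /hq' ->]; rewrite addr0.
  + rewrite (big_fset_incl _ (fsubsetUl s s')) /=; last by move=> t _ /hq ->; rewrite raddf0.
    rewrite (big_fset_incl _ (fsubsetUr s s')) /=; last by move=> t _ /hq' ->; rewrite raddf0.
    by rewrite -big_split; apply: eq_bigr => t _; rewrite raddfD.
  rewrite (big_fset_incl _ (fsubsetUl s s')) /=; last by move=> t _ /hq ->; rewrite raddf0.
  rewrite (big_fset_incl _ (fsubsetUr s s')) /=; last by move=> t _ /hq' ->; rewrite raddf0.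
  by rewrite -big_split; apply: eq_bigr => t _; rewrite raddfD.
have R0 : R 0 0 by exists fset0, (fun=> 0); rewrite !big_seq_fset0.
have Rsum (s : {fset T}) (F : T -> V) (F' : T -> V') :
    (forall t, R (F t) (F' t)) -> R (\sum_(t <- s) F t) (\sum_(t <- s) F' t).
  by move=> h; elim/big_ind2: _ => // *; apply: RD.
have Rgen a v v' : weyl_gen a -> R v v' -> R (a *: v) (a *: v').
  move=> ga [s [q [_ -> ->]]]; rewrite !scaler_sumr; apply: Rsum => // t.
  by have [t' [q' [-> ->]]] := he a t (q t) ga; apply: RE.
have RZ a v v' : R v v' -> R (a *: v) (a *: v').
  move=> Rv; elim/w_ind: a => [a b Ra Rb|c a Ra||i a Ra|i a Ra].
  - by rewrite !scalerDl; apply: RD.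
  - by rewrite -!scalerA; apply: Rgen => //; left; exists c.
  - by rewrite !scale1r.
  - by rewrite -!scalerA; apply: Rgen => //; right; left; exists i.
  - by rewrite -!scalerA; apply: Rgen => //; right; right; exists i.
have uniq0 (U : lmodType W) (b : forall t, {additive Q t -> U}) (s : {fset T}) (q : forall t, Q t) :
    is_direct_sum b -> (forall t, t \notin s -> q t = 0) ->
    \sum_(t <- s) b t (q t) = 0 -> forall t, q t = 0.
  move=> hb hq eq0 t; have [q0 [_ hq0]] := hb 0.
  have e1 : q0 = fun=> 0.
    apply: hq0; split; last by rewrite fsbig1 // => u _; rewrite raddf0.
    by apply: sub_finite_set (finite_fset fset0) => u /=; rewrite eqxx.
  have e2 : q0 = q.
    apply: hq0; split.
      apply: sub_finite_set (finite_fset s) => u /= qu.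
      by apply: contra_neqT qu => /hq.
    by rewrite (fsbigTE s) // => u /hq ->; rewrite raddf0.
  by rewrite -e2 e1.
have R_fun v' : R 0 v' -> v' = 0.
  move=> [s [q [hq /esym eq0 ->]]].
  by rewrite big1 // => t _; rewrite (uniq0 _ e s q hE hq eq0) raddf0.
have R_inj v : R v 0 -> v = 0.
  move=> [s [q [hq -> /esym eq0]]].
  by rewrite big1 // => t _; rewrite (uniq0 _ e' s q hE' hq eq0) raddf0.
have R_tot v : exists v', R v v'.
  have [s [q [hq ->]]] := spanned_dec (direct_sum_spanned hE) v.
  by exists (\sum_(t <- s) e' t (q t)), s, q.
have R_surj v' : exists v, R v v'.
  have [s [q [hq ->]]] := spanned_dec (direct_sum_spanned hE') v'.
  by exists (\sum_(t <- s) e t (q t)), s, q.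
have RB u u' v v' : R u u' -> R v v' -> R (u - v) (u' - v').
  by move=> hu hv; rewrite -!scaleN1r; apply: RD => //; apply: RZ.
pose f v := sval (cid (R_tot v)).
have fP v : R v (f v) by apply: (svalP (cid (R_tot v))).
have fE v v' : R v v' -> f v = v'.
  move=> h; apply/eqP; rewrite -subr_eq0; apply/eqP/R_fun.
  by rewrite -(subrr v); apply: RB.
have f_lin : linear f by move=> a u v; apply: fE; apply: RD => //; apply: RZ.
pose phi : {linear V -> V'} := HB.pack f (GRing.isLinear.Build _ _ _ _ f f_lin).
exists phi; split; last by move=> t q; apply: fE.
pose h v' := sval (cid (R_surj v')).
have hP v' : R (h v') v' by apply: (svalP (cid (R_surj v'))).
exists h => [v|v']; last exact: fE.
apply/eqP; rewrite -subr_eq0; apply/eqP/R_inj; rewrite -(subrr (f v)).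
by apply: RB.
Qed.
End Families.
End ModuleLemmas.

Section FamilySupport.
Variables (K : fieldType) (I : choiceType) (W : weyl_sys K I) (V : lmodType W).

(** If [n] were none of the weights of the family, a projector onto [n] killing the weights in a
    decomposition of [v] would send [v] both to itself and to 0. *)
Lemma family_support (T : choiceType) (Q : T -> zmodType) (e : forall t, {additive Q t -> V})
    (wt : T -> maxD K I) : (forall t q, wspace (wt t) (e t q)) ->
  spanned [set v | exists t q, v = e t q] ->
  forall n (v : V), wspace n v -> v != 0 -> exists t, wt t = n.
Proof.
move=> he hE n v nv; have [s [q [_ vE]]] := spanned_dec hE v.
move=> /eqP v0; apply: contrapT => h; apply: v0.
have [f [nf hf]] := maxD_projector [seq wt t | t <- s] n.
rewrite -[v]scale1r -(rmorph1 (wD W)) (wspace_eqm nv (maxC nf)) vE scaler_sumr.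
rewrite big_seq big1 // => t ts; apply: (he t); apply: hf; first exact: map_f.
by apply/eqP => tn; apply: h; exists t.
Qed.
End FamilySupport.

Section Residues.
Variables (K : fieldType) (I : choiceType).
Implicit Types (n : maxD K I) (f : PD K I).

Definition rs n (f : PD K I) : residue n := res n f.

Lemma rsP n f f' : rs n f = rs n f' <-> inm n (f - f').
Proof. exact: resP. Qed.
Lemma rs_repr n (q : residue n) : rs n (repr q) = q.
Proof. exact: reprK. Qed.
Lemma rsB n f f' : rs n (f - f') = rs n f - rs n f'. Proof. exact: rmorphB. Qed.
Lemma rsD n f f' : rs n (f + f') = rs n f + rs n f'. Proof. exact: rmorphD. Qed.
Lemma rsM n f f' : rs n (f * f') = rs n f * rs n f'. Proof. exact: rmorphM. Qed.
Lemma rs1 n : rs n 1 = 1. Proof. exact: rmorph1. Qed.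
Lemma rs0 n : rs n 0 = 0. Proof. exact: rmorph0. Qed.
Lemma rs_eq0 n f : rs n f = 0 <-> inm n f.
Proof. by rewrite -(rs0 n) rsP subr0. Qed.
Lemma rs_ind n (P : residue n -> Prop) : (forall f, P (rs n f)) -> forall q, P q.
Proof. exact: residue_ind. Qed.

Lemma rs_inv n (q : residue n) : q != 0 -> exists q', q' * q = 1.
Proof.
elim/rs_ind: q => f /eqP; rewrite rs_eq0 => /max_inv[g ng]; exists (rs n g).
by rewrite -rsM -rs1; apply/rsP.
Qed.

Lemma act_tv n g i (k : int) : inm (act g n) (tv K i + k%:~R) <->
  inm n (tv K i + (g@_i + k)%:~R).
Proof.
rewrite act_mem rmorphD rmorph_int /= sh_tv.
by rewrite mcoeffN intrN opprK -addrA -intrD.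
Qed.

Lemma rs_shE n g f : rs n (sh g f) = res n (shift g f).
Proof. exact: (congr1 (res n) (shE g f)). Qed.

Lemma rs_tv_shE n i g f : rs n (tv K i * sh g f) = res n (tvar K i * shift g f).
Proof.
suff e : tv K i * sh g f = tvar K i * shift g f by exact: (congr1 (res n) e).
by have e1 := tvE K i; have e2 := shE g f; case: _ / e1; case: _ / e2; exact: erefl.
Qed.

Lemma act_tv0 n g i : inm (act g n) (tv K i) <-> inm n (tv K i + (g@_i)%:~R).
Proof. by rewrite act_mem sh_tv mcoeffN intrN opprK. Qed.

Lemma act_tv1 n g i : inm (act g n) (tv K i - 1) <-> inm n (tv K i + (g@_i - 1)%:~R).
Proof. by rewrite act_mem rmorphB rmorph1 /= sh_tv mcoeffN !intrN opprK intrD addrA. Qed.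
End Residues.

Section ScalarExtension.
Variables (K : fieldType) (I : choiceType) (W : weyl_sys K I) (V : lmodType W).
Variables (Q : comNzRingType) (e : {additive Q -> V}) (r : PD K I -> Q).

Lemma D_act_ind : {morph r : f g / f + g} -> {morph r : f g / f * g} ->
  (forall c q, wD W (cD I c) *: e q = e (r (cD I c) * q)) ->
  (forall i q, wD W (tv K i) *: e q = e (r (tv K i) * q)) ->
  forall f q, wD W f *: e q = e (r f * q).
Proof.
move=> rD rM ec et; elim/polyD_tv_ind => // f g IHf IHg q.
  by rewrite rmorphD scalerDl IHf IHg rD mulrDl raddfD.
by rewrite rmorphM -scalerA IHg IHf rM mulrA.
Qed.
End ScalarExtension.

Section ShiftLemmas.
Variables (K : fieldType) (I : choiceType).
Implicit Types (n : maxD K I) (g : {malg int[I]}) (i : I).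

Lemma act_sg k i g n : act (sg k i) (act g n) = act (g + sg k i) n.
Proof. by rewrite -actD addrC. Qed.

Lemma up_dn i n : act (sg 1 i) (act (sg (-1) i) n) = n.
Proof. by rewrite -actD -sgD subrr sg0 act0. Qed.

Lemma dn_up i n : act (sg (-1) i) (act (sg 1 i) n) = n.
Proof. by rewrite -actD -sgD addNr sg0 act0. Qed.

Lemma coD g k i j : (g + sg k i)@_j = g@_j + (if i == j then k else 0).
Proof. by rewrite mcoeffD mcoeff_sg. Qed.
End ShiftLemmas.

(** * Characteristic zero *)

(* T is the part of an orbit obtained from p by moving downwards only in the  *)
(* directions of U, upwards only in those of L, and freely otherwise; u is a  *)
(* generator of the weight spaces of the module supported on T.               *)
Section Regions.
Variables (K : fieldType) (I : choiceType) (p : maxD K I) (U L : set I).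
Implicit Types (n : maxD K I) (g : {malg int[I]}) (i : I).

Definition region g : Prop := forall i, (U i -> g@_i <= 0) /\ (L i -> 0 <= g@_i).
Definition region_orbit : set (maxD K I) := [set n | exists2 g, region g & n = act g p].

(** The walls seen from [p]. If [t_i] lies in [p], then [d_i x_i] vanishes at [p] and the step up is
    a wall; if [t_i - 1] does, then [x_i d_i] vanishes and the step down is one. As [t_i] lies in
    [act g p] iff [t_i + g_i] lies in [p], [reg_break] excludes any further wall in the orbit. *)
Record region_axioms : Prop := RegionAxioms {
  reg_stab : forall g h, act g p = act h p -> g = h;
  reg_U : forall i, U i -> inm p (tv K i);
  reg_L : forall i, L i -> inm p (tv K i - 1);
  reg_break : forall i (k : int), inm p (tv K i + k%:~R) -> (U i /\ k = 0) \/ (L i /\ k = -1) }.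

Hypothesis H : region_axioms.

Lemma region_act g : region_orbit (act g p) <-> region g.
Proof.
split; first by case=> h hh /(reg_stab H) ->.
by move=> hg; exists g.
Qed.

Lemma region_orbit_act g : region g -> region_orbit (act g p).
Proof. by move/region_act. Qed.

Lemma region0 : region 0.
Proof. by move=> i; rewrite mcoeff0. Qed.

Lemma region_up g i : region g -> ~ region (g + sg 1 i) -> U i /\ g@_i = 0.
Proof.
move=> hg h; apply: contrapT => h'; apply: h => j; rewrite coD.
have [hU hL] := hg j; have [ij|_] := eqVneq i j; last by rewrite addr0.
subst j; split=> [Ui|Li]; last by have := hL Li; lia.
suff : g@_i <> 0 by have := hU Ui; lia.
by move=> gi; apply: h'.
Qed.

Lemma region_dn g i : region g -> ~ region (g + sg (-1) i) -> L i /\ g@_i = 0.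
Proof.
move=> hg h; apply: contrapT => h'; apply: h => j; rewrite coD.
have [hU hL] := hg j; have [ij|_] := eqVneq i j; last by rewrite addr0.
subst j; split=> [Ui|Li]; first by have := hU Ui; lia.
suff : g@_i <> 0 by have := hL Li; lia.
by move=> gi; apply: h'.
Qed.

Lemma region_up_neq g i : region g -> region (g + sg 1 i) -> ~ (U i /\ g@_i = 0).
Proof.
by move=> hg h [Ui gi]; have := (h i).1 Ui; rewrite coD eqxx gi.
Qed.

Lemma region_ind (P : {malg int[I]} -> Prop) : P 0 ->
  (forall g i, region g -> region (g + sg 1 i) -> 0 <= g@_i -> P g -> P (g + sg 1 i)) ->
  (forall g i, region g -> region (g + sg (-1) i) -> g@_i <= 0 -> P g ->
     P (g + sg (-1) i)) -> forall g, region g -> P g.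
Proof.
move=> P0 Pu Pd; elim/lattice_ind => // g i gi IH hg.
  have hg' : region g.
    move=> j; have := hg j; rewrite coD; case: eqVneq => [<-|_]; last by rewrite addr0.
    by case=> hU hL; split=> [/hU|//]; lia.
  by apply: Pu => //; apply: IH.
have hg' : region g.
  move=> j; have := hg j; rewrite coD; case: eqVneq => [<-|_]; last by rewrite addr0.
  by case=> hU hL; split=> [//|/hL]; lia.
by apply: Pd => //; apply: IH.
Qed.

(** A wall of [U] is crossed by stepping up from coordinate 0, one of [L] by stepping up from
    coordinate -1; neither step has both ends in the region. *)
Lemma region_edge g i : region g -> region (g + sg 1 i) -> ~ inm p (tv K i + (g@_i)%:~R).
Proof.
move=> hg hg' /(reg_break H) [[Ui gi]|[Li gi]].
  by apply: (region_up_neq hg hg').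
by have := (hg i).2 Li; rewrite gi.
Qed.

Variable W : weyl_sys K I.
Local Notation x := (wx W).
Local Notation d := (wd W).
Local Notation D := (wD W).
Local Notation up i n := (act (sg 1 i) n).
Local Notation dn i n := (act (sg (-1) i) n).

(** Since [u] is 0 off the region, the two formulas also say that [x_i] and [d_i] kill [u n] when
    the step leaves the region. *)
Record region_family (V : lmodType W) (u : maxD K I -> V) : Prop := RegionFamily {
  rf_out : forall n, ~ region_orbit n -> u n = 0;
  rf_wspace : forall n, wspace n (u n);
  rf_neq0 : u p != 0;
  rf_x : forall n i, region_orbit n -> x i *: u n = u (up i n);
  rf_d : forall n i, region_orbit n -> d i *: u n = D (tv K i) *: u (dn i n);
  rf_span : spanned [set v | exists n f, v = D f *: u n] }.

Section Family.
Variables (V : lmodType W) (u : maxD K I -> V).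

(* Going back to p along the region inverts the steps leading away from p. *)
Lemma region_transport (S : set V) : wsub S ->
  (forall n, wspace n (u n)) ->
  (forall n i, region_orbit n -> x i *: u n = u (up i n)) ->
  (forall n i, region_orbit n -> d i *: u n = D (tv K i) *: u (dn i n)) ->
  forall g, region g -> S (u (act g p)) <-> S (u p).
Proof.
move=> [S0 SD SZ] hw hx hd.
have step g i : region g -> region (g + sg 1 i) ->
    S (u (act g p)) <-> S (u (act (g + sg 1 i) p)).
  move=> hg hg'; have e := act_sg 1 i g p; split=> h.
    by rewrite -e -(hx _ i (region_orbit_act hg)); apply: SZ.
  have hd' : d i *: u (act (g + sg 1 i) p) = D (tv K i) *: u (act g p).
    by rewrite (hd _ i (region_orbit_act hg')) -e dn_up.
  have tg : ~ inm (act g p) (tv K i).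
    by move/act_tv0; exact: (region_edge hg hg').
  have [f hf] := max_inv tg.
  have -> : u (act g p) = D f *: (D (tv K i) *: u (act g p)).
    by rewrite scalerA -rmorphM (wspace_eqm (hw _) hf) rmorph1 scale1r.
  by rewrite -hd'; apply/SZ/SZ.
apply: region_ind => [|g i hg hg' gi <-|g i hg hg' gi <-]; first by rewrite act0.
  by rewrite -step.
have e : g = g + sg (-1) i + sg 1 i by rewrite -addrA -sgD addNr sg0 addr0.
by rewrite [in X in _ <-> X]e; apply: step; rewrite -?e.
Qed.

Hypothesis Hu : region_family u.

Lemma rf_neq g : region g -> u (act g p) != 0.
Proof.
move=> hg; apply/eqP => h; have := rf_neq0 Hu; case/eqP.
have [_ hw _ hx hd _] := Hu.
by apply: (region_transport (@wsub0 _ _ _ V) hw hx hd hg).1.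
Qed.

Lemma rf_D n f f' : inm n (f - f') -> D f *: u n = D f' *: u n.
Proof. by move=> h; apply: wspace_eqm h; apply: (rf_wspace Hu). Qed.

Lemma rf_direct_sum : exists e : forall n : region_orbit, {additive residue (val n) -> V},
  is_direct_sum e /\ forall (n : region_orbit) f, e n (rs (val n) f) = D f *: u (val n).
Proof.
have eB (n : region_orbit) : zmod_morphism (fun q : residue (val n) => D (repr q) *: u (val n)).
  move=> q q'; rewrite -scalerBl -rmorphB; apply: rf_D; apply/rsP.
  by rewrite rsB !rs_repr.
pose e (n : region_orbit) : {additive residue (val n) -> V} :=
  HB.pack (fun q : residue (val n) => D (repr q) *: u (val n))
    (GRing.isZmodMorphism.Build _ _ _ (eB n)).
have eE (n : region_orbit) f : e n (rs (val n) f) = D f *: u (val n).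
  by apply: rf_D; apply/rsP; rewrite rs_repr.
exists e; split=> //.
apply: (@direct_sum_crit _ _ _ _ _ (fun n : region_orbit => val n)) => //.
- by move=> n q; rewrite -(rs_repr q) eE; apply: wspace_D; apply: (rf_wspace Hu).
- move=> n; elim/rs_ind=> f; rewrite eE => h; apply/rs_eq0.
  have [g hg ng] := set_mem (valP n).
  have := rf_neq hg; rewrite -ng => un.
  have uw : forall n, wspace n (u n) by exact: (rf_wspace Hu).
  exact: (wspace_neq0 (uw _) un h).
move=> P P0 PD PE; apply: (rf_span Hu) => // _ [n [f ->]].
have [Tn|Tn] := pselect (region_orbit n); last by rewrite (rf_out Hu Tn) scaler0.
pose n' : region_orbit := SigSub (mem_set Tn).
by apply: PE; exists n', (rs (val n') f); rewrite eE.
Qed.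

Lemma rf_formulas : exists e : forall n : region_orbit, {additive residue (val n) -> V},
  is_direct_sum e /\ forall (n : region_orbit) f, let v := e n (rs (val n) f) in
  (forall c, D (cD I c) *: v = e n (rs (val n) (cD I c * f))) /\
  forall i,
    [/\ forall n' : region_orbit, val n' = up i (val n) ->
          x i *: v = e n' (rs (val n') (sh (sg 1 i) f)),
        ~ region_orbit (up i (val n)) -> x i *: v = 0,
        forall n' : region_orbit, val n' = dn i (val n) ->
          d i *: v = e n' (rs (val n') (tv K i * sh (sg (-1) i) f)) &
        ~ region_orbit (dn i (val n)) -> d i *: v = 0].
Proof.
have [e [he eE]] := rf_direct_sum; exists e; split=> // n f /=.
have Tn := set_mem (valP n); rewrite eE.
split=> [c|i]; first by rewrite eE scalerA -rmorphM.
rewrite !scalerA wxD wdD -!scalerA (rf_x Hu _ Tn) (rf_d Hu _ Tn).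
split=> [n' n'E|Ti|n' n'E|Ti].
- by rewrite eE; congr (_ *: u _); exact/esym.
- by rewrite (rf_out Hu Ti) scaler0.
- by rewrite eE mulrC rmorphM scalerA; congr (_ *: u _); exact/esym.
by rewrite (rf_out Hu Ti) !scaler0.
Qed.

(** A nonzero submodule contains a nonzero multiple of some [u n], hence [u n] itself because the
    residue ring is a field. Invertible steps lead from there to [p] and on to every weight of the
    region. *)
Lemma rf_simple : wsimple V.
Proof.
split; first by exists (u p); apply: (rf_neq0 Hu).
move=> S hS; have [[v [Sv v0]]|h] := pselect (exists v, S v /\ v != 0); last first.
  by left=> v Sv; apply: contrapT => /eqP v0; apply: h; exists v.
right; have [e [he eE]] := rf_direct_sum; have [S0 SD SZ] := hS.
have ew (n : region_orbit) q : wspace (val n) (e n q).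
  elim/rs_ind: q => f; rewrite eE; apply: wspace_D; exact: (rf_wspace Hu).
have wt_inj : injective (fun n : region_orbit => val n) by exact: val_inj.
have [n [q [eq0 Seq]]] :=
  graded_family wt_inj ew (direct_sum_spanned he) hS Sv v0.
have [g hg ng] := set_mem (valP n).
have [_ hw _ hx hd _] := Hu.
have Su : S (u (val n)).
  have q0 : q != 0 by apply: contra_neq eq0 => ->; rewrite raddf0.
  have [q' qq'] := rs_inv q0.
  have -> : u (val n) = D (repr q') *: e n q.
    rewrite -[in RHS](rs_repr q) eE scalerA -rmorphM -[LHS]scale1r -(rmorph1 D).
    by apply: rf_D; apply/rsP; rewrite rsM !rs_repr qq' rs1.
  exact: SZ.
have Sp : S (u p) by move: Su; rewrite ng; apply: (region_transport hS hw hx hd hg).1.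
apply: (rf_span Hu) => // _ [n' [f ->]]; apply: SZ.
have [[g' hg' ->]|/(rf_out Hu) ->//] := pselect (region_orbit n').
exact: (region_transport hS hw hx hd hg').2.
Qed.

Lemma rf_hom : spanned (@hom_vector _ _ _ V).
Proof.
move=> P P0 PD PE; apply: (rf_span Hu) => // _ [n [f ->]]; apply: PE.
by exists n; apply: wspace_D; apply: (rf_wspace Hu).
Qed.

Lemma rf_support n (v : V) : wspace n v -> v != 0 -> region_orbit n.
Proof.
have [e [he eE]] := rf_direct_sum.
have ew (t : region_orbit) q : wspace (val t) (e t q).
  elim/rs_ind: q => f; rewrite eE; apply: wspace_D; exact: (rf_wspace Hu).
move=> nv v0.
have [t <-] := family_support ew (direct_sum_spanned he) nv v0.
exact: set_mem (valP t).
Qed.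
End Family.

Lemma rf_iso (V V' : lmodType W) (u : maxD K I -> V) (u' : maxD K I -> V') :
  region_family u -> region_family u' -> exists phi : {linear V -> V'}, bijective phi.
Proof.
move=> Hu Hu'; have [e [he eE]] := rf_direct_sum Hu; have [e' [he' eE']] := rf_direct_sum Hu'.
have [|phi [phib _]] := direct_sum_iso he he'; last by exists phi.
move=> a n; elim/rs_ind=> f; rewrite eE eE'.
have Tn := set_mem (valP n).
case=> [[c ->]|[[i ->]|[i ->]]].
- by exists n, (rs (val n) (cD I c * f)); rewrite eE eE' rmorphM !scalerA.
- rewrite !scalerA wxD -!scalerA (rf_x Hu _ Tn) (rf_x Hu' _ Tn).
  have [Ti|Ti] := pselect (region_orbit (up i (val n))).
    pose n' : region_orbit := SigSub (mem_set Ti).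
    by exists n', (rs (val n') (sh (sg 1 i) f)); rewrite eE eE'.
  by exists n, 0; rewrite !raddf0 (rf_out Hu Ti) (rf_out Hu' Ti) !scaler0.
rewrite !scalerA wdD -!scalerA (rf_d Hu _ Tn) (rf_d Hu' _ Tn) !scalerA -rmorphM.
have [Ti|Ti] := pselect (region_orbit (dn i (val n))).
  pose n' : region_orbit := SigSub (mem_set Ti).
  by exists n', (rs (val n') (sh (sg (-1) i) f * tv K i)); rewrite eE eE'.
by exists n, 0; rewrite !raddf0 (rf_out Hu Ti) (rf_out Hu' Ti) !scaler0.
Qed.

(** The exponent leading from [p] to [n], unique by [reg_stab]; the default 0 is taken off the
    orbit. *)
Definition gam n : {malg int[I]} :=
  if pselect (exists g, n = act g p) is left h then sval (cid h) else 0.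

Lemma gamE g : gam (act g p) = g.
Proof.
rewrite /gam; case: pselect => [h|[]]; last by exists g.
by case: cid => /= h' /(reg_stab H).
Qed.

(** Keep the translates of [v] whose exponent lies in the region and put 0 elsewhere. Inside the
    region no wall is crossed; at its boundary the vanishing of [x_i v] or [d_i v] propagates to the
    translates. The span is a nonzero submodule, hence all of [V]. *)
Lemma simple_region_family (V : lmodType W) (v : V) : wsimple V -> wspace p v -> v != 0 ->
  (forall i, U i -> x i *: v = 0) -> (forall i, L i -> d i *: v = 0) ->
  exists u : maxD K I -> V, region_family u.
Proof.
move=> Vs pv v0 xv dv.
have [w [[w0 ww wX wX0 wY] [wY0 wx0 wd0]]] := lattice_family pv.
pose u n := if `[< region_orbit n >] then w (gam n) else 0.
have uE g : region g -> u (act g p) = w g.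
  by move=> hg; rewrite /u (asboolT (region_orbit_act hg)) gamE.
have u_out n : ~ region_orbit n -> u n = 0.
  by move=> h; rewrite /u (asboolF h).
have u_w n : wspace n (u n).
  have [[g hg ->]|/u_out ->] := pselect (region_orbit n); last exact: wspace0.
  by rewrite uE.
have up0 : u p = v by rewrite -[p]act0 (uE _ region0) w0.
have u_x n i : region_orbit n -> x i *: u n = u (up i n).
  move=> [g hg ->]; rewrite (uE _ hg) act_sg.
  have [hg'|hg'] := pselect (region (g + sg 1 i)).
    by rewrite (uE _ hg') wX //; right; exact: (region_edge hg hg').
  rewrite (u_out _ (fun h => hg' ((region_act _).1 h))); have [Ui gi] := region_up hg hg'.
  by apply: (wx0 _ _ 0%N gi); rewrite expr1 xv.
have u_d n i : region_orbit n -> d i *: u n = D (tv K i) *: u (dn i n).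
  move=> [g hg ->]; rewrite (uE _ hg) act_sg.
  have [hg'|hg'] := pselect (region (g + sg (-1) i)).
    rewrite (uE _ hg') wY //; right => h.
    have e : g = g + sg (-1) i + sg 1 i by rewrite -addrA -sgD addNr sg0 addr0.
    have hge : region (g + sg (-1) i + sg 1 i) by rewrite -e.
    apply: (region_edge hg' hge); by rewrite coD eqxx intrD addrA.
  rewrite (u_out _ (fun h => hg' ((region_act _).1 h))) scaler0; have [Li gi] := region_dn hg hg'.
  by apply: (wd0 _ _ 0%N) => //; rewrite ?gi ?oppr0 // expr1 dv.
exists u; split=> //; first by rewrite up0.
pose e (n : maxD K I) (q : PD K I) := D q *: u n.
have [S0 SD SZ] : wsub (span_of e).
  apply: span_of_sub => a n q.
  have [Tn|Tn] := pselect (region_orbit n); last first.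
    by rewrite /e (u_out _ Tn) !scaler0 => _ P.
  case=> [[c ->]|[[i ->]|[i ->]]]; rewrite /e.
  - by rewrite scalerA -rmorphM; apply: (@span_of_mem K I W _ _ V e n (cD I c * q)).
  - rewrite scalerA wxD -scalerA (u_x _ _ Tn).
    exact: (@span_of_mem K I W _ _ V e (up i n) (sh (sg 1 i) q)).
  rewrite scalerA wdD -scalerA (u_d _ _ Tn) scalerA -rmorphM.
  exact: (@span_of_mem K I W _ _ V e (dn i n) (sh (sg (-1) i) q * tv K i)).
have Sv : span_of e v.
  have := @span_of_mem K I W _ _ V e p 1; rewrite /e rmorph1 scale1r up0.
  exact.
have [h|h] := Vs.2 _ (And3 S0 SD SZ); first by rewrite (h _ Sv) eqxx in v0.
by move=> P P0 PD PE v'; apply: (h v' P) => // n q; apply: PE; exists n, q.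
Qed.

(** Walk back to [p] inside the region. Each step is injective on weight vectors, since followed by
    the opposite generator it is multiplication by a unit of the residue field. *)
Lemma region_weight_base (V : lmodType W) g (v : V) : region g ->
  wspace (act g p) v -> v != 0 -> exists v' : V, wspace p v' /\ v' != 0.
Proof.
move=> hg; move: g hg v.
apply: region_ind => [v|g i hg hg' gi IH v gv v0|g i hg hg' gi IH v gv v0].
- by rewrite act0; exists v.
- have dv : d i *: v != 0.
    apply: contra_neq v0 => dv0; apply: contrapT => /eqP v0.
    have /(wspace_neq0 gv v0)/act_tv1 : D (tv K i - 1) *: v = 0.
      by rewrite -wxdt -scalerA dv0 scaler0.
    by rewrite coD eqxx addrK; exact: (region_edge hg hg').
  refine (IH (d i *: v) _ dv).
  by have := wspace_d (i := i) gv; rewrite -act_sg dn_up.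
have xv : x i *: v != 0.
  apply: contra_neq v0 => xv0; apply: contrapT => /eqP v0.
  have /(wspace_neq0 gv v0)/act_tv0 : D (tv K i) *: v = 0.
    by rewrite -wdxt -scalerA xv0 scaler0.
  have e : g = g + sg (-1) i + sg 1 i by rewrite -addrA -sgD addNr sg0 addr0.
  have hge : region (g + sg (-1) i + sg 1 i) by rewrite -e.
  exact: (region_edge hg' hge).
refine (IH (x i *: v) _ xv).
by have := wspace_x (i := i) gv; rewrite -act_sg up_dn.
Qed.
End Regions.

(** * The module notions of the theorem in terms of [weyl_system] *)

Section Conversions.
Variables (K : fieldType) (I : choiceType).
Local Notation W := (weyl_system K I).
Implicit Types (V : lmodType (weyl_algebra K I)) (n : maxD K I).

Lemma wspaceE V n : @weight_space K I V n = @wspace K I W V n.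
Proof.
apply/seteqP; split=> v hv f nf; first by rewrite weyl_DE; apply: hv.
by rewrite -weyl_DE; apply: hv.
Qed.

Lemma wsimpleE V : simple_module V <-> @wsimple K I W V.
Proof.
split=> [[V0 hV]|[V0 hV]]; split=> // S.
  case=> S0 SD SZ; pose p : {pred V} := fun v => `[< S v >].
  have [|h|h] := hV p.
  - split; first by apply/asboolP.
    by move=> a u v /asboolP Su /asboolP Sv; apply/asboolP; apply: SD => //; apply: SZ.
  - by left=> v Sv; apply/eqP; rewrite -[_ == _]/(v \in pred1 0) -h; apply/asboolP.
  - by right=> v; apply/asboolP; rewrite -[asbool _]/(v \in p) h.
case=> S0 SZ; have [|h|h] := hV [set v | v \in S].
- split=> //= [u v Su Sv|a v Sv]; first by have := SZ 1 u v Su Sv; rewrite scale1r.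
  by have := SZ a v 0 Sv S0; rewrite addr0.
- left=> v; rewrite inE; apply/idP/eqP => [/h //|->]; exact: S0.
- by right=> v; rewrite h.
Qed.

Lemma wweightE V : weight_module V <-> spanned (@hom_vector K I W V).
Proof.
split=> [hV P P0 PD PE v|hV v].
  have [w [[hw fw ->] _]] := hV v.
  rewrite (fsbigTE (fset_set [set n | w n != 0])) => [|n].
    elim/big_ind: _ => // n _; apply: PE; exists n.
    by rewrite -wspaceE; apply: hw.
  rewrite in_fset_set // => /negP h; have [//|wn] := eqVneq (w n) 0.
  by case: h; apply: mem_set.
have [s [w [hw ws ->]]] := hom_dec hV v.
exists w; split.
  split=> [n||]; first by rewrite wspaceE; apply: hw.
    by apply: sub_finite_set (finite_fset s) => n /=; apply: contra_neqT => /ws.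
  by rewrite (fsbigTE s).
move=> w' [hw' fw' eqw]; apply/funext => n.
pose s' := fset_set [set n | w' n != 0].
have ws' k : k \notin s' -> w' k = 0.
  rewrite in_fset_set // => /negP h; have [//|wk] := eqVneq (w' k) 0.
  by case: h; apply: mem_set.
rewrite (fsbigTE s') // in eqw.
have [ns|] := boolP (n \in (s `|` s')%fset); last first.
  by rewrite in_fsetU negb_or => /andP[/ws -> /ws' ->].
apply/eqP; rewrite -subr_eq0; apply/eqP.
have uniq_s := fset_uniq (s `|` s')%fset.
apply: (@wspace_indep K I W V _ id _ (fun k => w k - w' k) _ uniq_s _ [set 0]
  (@wsub0 _ _ _ _) _ n ns) => //=.
  by move=> k; apply: wspaceB => //; rewrite -wspaceE.
rewrite sumrB; apply/eqP; rewrite subr_eq0; apply/eqP.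
rewrite -(big_fset_incl _ (fsubsetUl s s')) /=; last by move=> k _ /ws ->.
rewrite -(big_fset_incl _ (fsubsetUr s s')) /=; last by move=> k _ /ws' ->.
exact: eqw.
Qed.

Lemma wconstE V c (v : V) : weyl_const I c *: v = wD W (cD I c) *: v.
Proof. by rewrite -[wD W _]/(weyl_D K I (cD I c)) weyl_DC. Qed.
End Conversions.

(** * Freeness of the action on maximal ideals in characteristic zero *)

Section LocallyNilpotent.
Variables (R : comNzRingType) (phi : {rmorphism R -> R}).
Implicit Types f g : R.

Definition rdelta f := phi f - f.

Lemma rdeltaD f g : rdelta (f + g) = rdelta f + rdelta g.
Proof. by rewrite /rdelta rmorphD opprD addrACA. Qed.

Lemma rdelta_iter0 N : iter N rdelta 0 = 0.
Proof. by elim: N => //= N ->; rewrite /rdelta rmorph0 subrr. Qed.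

Lemma rdelta_iterD N f g : iter N rdelta (f + g) = iter N rdelta f + iter N rdelta g.
Proof. by elim: N => //= N ->; rewrite rdeltaD. Qed.

Lemma rdelta_nilD N M f g : iter N rdelta f = 0 -> iter M rdelta g = 0 ->
  iter (N + M) rdelta (f + g) = 0.
Proof.
move=> hf hg; rewrite rdelta_iterD [in X in X + _]addnC !iterD hf hg.
by rewrite !rdelta_iter0 addr0.
Qed.

(** By the twisted Leibniz rule [rdelta (f * g) = rdelta f * g + f * rdelta g + rdelta f * rdelta
    g], every term of one application to a product lowers [N + M] by at least one. *)
Lemma rdelta_nilM s N M f g : (N + M <= s)%N ->
  iter N rdelta f = 0 -> iter M rdelta g = 0 -> iter s rdelta (f * g) = 0.
Proof.
elim: s N M f g => [|s IH] N M f g.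
  by rewrite leqn0 addn_eq0 => /andP[/eqP -> _] /= -> _; rewrite mul0r.
case: N => [|N]; first by move=> _ /= -> _; rewrite mul0r -iterS rdelta_iter0.
case: M => [|M]; first by move=> _ _ /= ->; rewrite mulr0 -iterS rdelta_iter0.
move=> hs hf hg; rewrite iterSr.
have -> : rdelta (f * g) = rdelta f * g + f * rdelta g + rdelta f * rdelta g.
  by rewrite /rdelta rmorphM; ring.
rewrite !rdelta_iterD (IH N M.+1 (rdelta f) g); [|lia|by rewrite -iterSr|by []].
rewrite (IH N.+1 M f (rdelta g)); [|lia|by []|by rewrite -iterSr].
rewrite (IH N M (rdelta f) (rdelta g)); [|lia|by rewrite -iterSr|by rewrite -iterSr].
by rewrite !addr0.
Qed.
End LocallyNilpotent.

Section CharZeroStabilizer.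
Variables (K : fieldType) (I : choiceType).
Implicit Types (m n : maxD K I) (i : I) (h g : {malg int[I]}).

Lemma inm_unit m (f f' : PD K I) : f * f' = 1 -> ~ inm m f.
Proof. by move=> e mf; apply: (@max1 _ _ m); rewrite -e; apply: maxMr. Qed.

Lemma int_notin m (z : int) : z%:~R != 0 :> K -> ~ inm m z%:~R.
Proof.
move=> z0; pose r : {rmorphism K -> PD K I} := @malgC _ K.
rewrite -(rmorph_int r); apply: (@inm_unit _ _ (r (z%:~R)^-1)).
by rewrite -rmorphM mulfV // rmorph1.
Qed.

Lemma char0_int : [pchar K] =i pred0 -> forall z : int, z != 0 -> z%:~R != 0 :> K.
Proof.
move=> /pcharf0P c0 [k|k] z0; first by rewrite -pmulrn c0.
by rewrite NegzE intrN oppr_eq0 -pmulrn c0.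
Qed.

(* A translation stabilizing a maximal ideal of the residue field moves some  *)
(* 1/t by t |-> t - z; since sh h - 1 is locally nilpotent on D, iterating it *)
(* on 1/t gives 0, but also N! z^N / (t (t - z) ... (t - N z)).               *)
Lemma char0_stab0 m h : [pchar K] =i pred0 -> act h m = m -> h = 0.
Proof.
move=> K0 hm; apply/malgP => i; rewrite mcoeff0.
apply: contrapT => /eqP zn0; pose z := h@_i.
have mS f : inm m f -> inm m (sh h f) by move=> mf; rewrite -hm; apply/act_mem'.
pose dl := rdelta (sh h : {rmorphism PD K I -> PD K I}).
have nil f : exists N, iter N dl f = 0.
  elim/polyD_tv_ind: f => [c|j|f g [N hN] [M hM]|f g [N hN] [M hM]].
  - by exists 1%N; rewrite /= /dl /rdelta shC subrr.
  - exists 2%N; rewrite /= /dl /rdelta sh_tv rmorphB rmorphB sh_tv rmorph_int; ring.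
  - by exists (N + M)%N; apply: rdelta_nilD.
  by exists (N + M)%N; apply: (rdelta_nilM (leqnn _)).
pose s (j : nat) : PD K I := tv K i - j%:R * z%:~R.
have shs j : sh h (s j) = s j.+1.
  rewrite /s rmorphB rmorphM rmorph_nat rmorph_int sh_tv -natr1 /z; ring.
pose P N := \prod_(j < N.+1) s j.
have Pl N : P N.+1 = s 0%N * sh h (P N).
  by rewrite /P big_ord_recl rmorph_prod; congr (_ * _); apply: eq_bigr => j _; rewrite shs.
have Pr N : P N.+1 = P N * s N.+1 by rewrite /P big_ord_recr.
(* If [t_i] lay in [m], so would its shift [t_i - z], and then the nonzero integer [z], a unit in
   characteristic 0. *)
have s0 : ~ inm m (s 0%N).
  move=> ms; have := maxB ms (mS _ ms); rewrite shs /s !mul0r subr0 mul1r subKr.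
  by apply/int_notin/char0_int.
have [u hu] := max_inv s0.
pose a N : int := (N`!)%:Z * z ^+ N.
have claim N : inm m (iter N dl u * P N - (a N)%:~R).
  elim: N => [|N IH].
    by rewrite /a fact0 expr0 mulr1 /P big_ord1.
  have e : iter N.+1 dl u * P N.+1 - (a N.+1)%:~R =
      s 0%N * sh h (iter N dl u * P N - (a N)%:~R)
      - s N.+1 * (iter N dl u * P N - (a N)%:~R).
    rewrite iterS {1}/dl {1}/rdelta mulrBl {1}Pl Pr rmorphB rmorphM rmorph_int.
    rewrite /a factS exprS PoszM /s !rmorphM /= -!pmulrn; ring.
  by rewrite e; apply: maxB; apply: maxMl => //; apply: mS.
have [N hN] := nil u; have := claim N; rewrite hN mul0r sub0r => /maxN.
rewrite opprK; apply: int_notin; apply: char0_int => //.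
by rewrite /a mulf_neq0 ?expf_neq0 // -lt0n fact_gt0.
Qed.

Lemma char0_stab m g h : [pchar K] =i pred0 -> act g m = act h m -> g = h.
Proof.
move=> K0 e; have gh : act (g - h) m = m.
  by rewrite addrC (actD (- h) g) e -(actD (- h) h) addNr act0.
have /subr0_eq := char0_stab0 K0 gh; exact.
Qed.
End CharZeroStabilizer.

(** * Existence of the module on a region *)

Section RegionExistence.
Variables (K : fieldType) (I : choiceType) (p : maxD K I) (U L : set I).
Hypothesis H : region_axioms p U L.
Local Notation W := (weyl_system K I).
Local Notation T := (region_orbit p U L).
Local Notation up i n := (act (sg 1 i) n).
Local Notation dn i n := (act (sg (-1) i) n).
Implicit Types (n : maxD K I) (i j : I) (q : residue p).

(** The class of [t_i] at [n = act g p], carried back to the residue field of [p] by sigma^-g, which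
    sends [t_i] to [t_i + g_i]. At the lower neighbour the value is one less, which explains the
    factor in [rd]. *)
Let tv_at n i : residue p := rs p (tv K i + ((gam p n)@_i)%:~R).

Let kq (c : K) q : residue p := rs p (cD I c) * q.
Let rx i n q : residue p := if `[< T (up i n) >] then q else 0.
Let rd i n q : residue p := if `[< T (dn i n) >] then (tv_at n i - 1) * q else 0.

Let gam_act g : gam p (act g p) = g. Proof. exact: gamE H g. Qed.
Let T_act g : T (act g p) <-> region U L g. Proof. exact: region_act H g. Qed.

Let regionE g j k : region U L g -> region U L (g + sg k j) -> forall i l, i != j ->
  region U L (g + sg k j + sg l i) <-> region U L (g + sg l i).
Proof.
move=> hg hgj i l ij; split=> h a.
  have [<-|ia] := eqVneq i a.
    by have := h i; rewrite !coD eqxx eq_sym (negPf ij) addr0.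
  by have := hg a; rewrite coD (negPf ia) addr0.
have [<-|ia] := eqVneq i a.
  by have := h i; rewrite !coD eqxx eq_sym (negPf ij) addr0.
by have := hgj a; rewrite [in X in _ -> X]coD (negPf ia) addr0.
Qed.

Let tv_at_act g i : tv_at (act g p) i = rs p (tv K i + (g@_i)%:~R).
Proof. by rewrite /tv_at gam_act. Qed.

Let tv_at_up g i : tv_at (up i (act g p)) i - 1 = tv_at (act g p) i.
Proof.
rewrite act_sg !tv_at_act coD eqxx -(rs1 p) -rsB; congr (rs p _).
by rewrite intrD addrA addrK.
Qed.
Let tv_at_dn g i : tv_at (dn i (act g p)) i = tv_at (act g p) i - 1.
Proof. by rewrite act_sg !tv_at_act coD eqxx -(rs1 p) -rsB intrD addrA. Qed.

Let model_region : exists (V : lmodType (weyl_algebra K I))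
    (e : forall n : T, {additive residue p -> V}),
  is_direct_sum e /\ forall (n : T) q,
    (forall c, weyl_const I c *: e n q = e n (kq c q)) /\
    forall i,
      [/\ forall n' : T, val n' = up i (val n) -> weyl_x K i *: e n q = e n' (rx i (val n) q),
          ~ T (up i (val n)) -> weyl_x K i *: e n q = 0,
          forall n' : T, val n' = dn i (val n) -> weyl_d K i *: e n q = e n' (rd i (val n) q) &
          ~ T (dn i (val n)) -> weyl_d K i *: e n q = 0].
Proof.
have rxT i n q : T (up i n) -> rx i n q = q by move=> h; rewrite /rx asboolT.
have rxF i n q : ~ T (up i n) -> rx i n q = 0 by move=> h; rewrite /rx asboolF.
have rdT i n q : T (dn i n) -> rd i n q = (tv_at n i - 1) * q.
  by move=> h; rewrite /rd asboolT.
have rdF i n q : ~ T (dn i n) -> rd i n q = 0 by move=> h; rewrite /rd asboolF.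
have neq_up i j n : i != j -> T n -> T (up j n) ->
    [/\ T (up i (up j n)) <-> T (up i n), T (dn i (up j n)) <-> T (dn i n) &
        tv_at (up j n) i = tv_at n i].
  move=> ij [g hg ->]; rewrite !act_sg !T_act => hgj; split.
  - by rewrite !T_act; exact: (regionE hg hgj 1 ij).
  - by rewrite !T_act; exact: (regionE hg hgj (-1) ij).
  by rewrite !tv_at_act coD eq_sym (negPf ij) addr0.
apply: (@model K I (residue p) (maxD K I) T kq rx rd (fun i n q => tv_at n i * q)
  (fun i n => up i n) (fun i n => dn i n)).
- exact: dn_up.
- exact: up_dn.
- by move=> i j n; rewrite -!actD addrC.
- by move=> i j n; rewrite -!actD addrC.
- by move=> i j n; rewrite -!actD addrC.
- by move=> c q q'; rewrite /kq mulrBr.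
- move=> c c' q; pose r : {rmorphism K -> PD K I} := @malgC _ K.
  by rewrite /kq -[cD I (c + c')]/(r (c + c')) rmorphD rsD mulrDl.
- move=> c c' q; pose r : {rmorphism K -> PD K I} := @malgC _ K.
  by rewrite /kq -[cD I (c * c')]/(r (c * c')) rmorphM rsM mulrA.
- move=> q; pose r : {rmorphism K -> PD K I} := @malgC _ K.
  by rewrite /kq -[cD I 1]/(r 1) rmorph1 rs1 mul1r.
- by move=> i n q q'; rewrite /rx; case: ifP; rewrite ?subr0.
- by move=> i n q q'; rewrite /rd; case: ifP; rewrite ?subr0 // mulrBr.
- by move=> c i n q; rewrite /rx /kq; case: ifP; rewrite ?mulr0.
- by move=> c i n q; rewrite /rd /kq; case: ifP; rewrite ?mulr0 // mulrCA.
- by move=> i n q _; apply: rxF.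
- by move=> i n q _; apply: rdF.
- move=> i j n q ij Tn Tj; have [h _ _] := neq_up i j n ij Tn Tj.
  by rewrite /rx (asbool_equiv_eq h).
- move=> i j n q ij Tn Tj; have [_ h e] := neq_up i j n ij Tn Tj.
  by rewrite /rd (asbool_equiv_eq h) e.
- by move=> i j n q; rewrite /rx; do 2 case: ifP.
- by move=> i j n q; rewrite /rd; do 2 case: ifP; rewrite ?mulr0 // mulrCA.
- by move=> i j n q; rewrite /rx /rd; do 2 case: ifP; rewrite ?mulr0.
- move=> i n q Tn Ti; rewrite (rxT _ _ _ Ti) rdT ?dn_up //.
  by have [g _ ng] := Tn; rewrite ng tv_at_up.
- move=> i n q [g hg ->]; rewrite act_sg T_act => hgi.
  have [Ui gi] := region_up hg hgi; rewrite tv_at_act gi mulr0z addr0.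
  by rewrite (_ : rs p _ = 0) ?mul0r //; apply/rs_eq0/(reg_U H).
- move=> i n q Tn Ti; rewrite (rdT _ _ _ Ti) rxT ?up_dn //.
  by rewrite mulrBl mul1r.
move=> i n q [g hg ->]; rewrite act_sg T_act => hgi.
have [Li gi] := region_dn hg hgi; rewrite tv_at_act gi mulr0z addr0.
rewrite (_ : rs p _ = 1) ?mul1r // -(rs1 p); apply/rsP/(reg_L H) => //.
Qed.

Lemma region_exists : exists (V : lmodType (weyl_algebra K I)) (u : maxD K I -> V),
  @region_family K I p U L W V u.
Proof.
have [V [e [he eE]]] := model_region.
pose u n : V := if (insub n : option T) is Some n' then e n' 1 else 0.
have uT (n : T) : u (val n) = e n 1 by rewrite /u valK.
have uF n : ~ T n -> u n = 0.
  by move=> Tn; rewrite /u insubN //; apply/negP => /set_mem.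
have hT n : T n -> exists n' : T, val n' = n by move=> h; exists (SigSub (mem_set h)).
have ex i (n : T) q : wx W i *: e n q =
    if (insub (up i (val n)) : option T) is Some n' then e n' q else 0.
  have [_ /(_ i)[h1 h2 _ _]] := eE n q.
  have [/[dup] Ti /hT[n' nn']|Ti] := pselect (T (up i (val n))).
    by rewrite (h1 n' nn') -nn' valK /rx (asboolT Ti).
  by rewrite h2 // insubN //; apply/negP => /set_mem.
have ed i (n : T) q : wd W i *: e n q =
    if (insub (dn i (val n)) : option T) is Some n' then e n' ((tv_at (val n) i - 1) * q) else 0.
  have [_ /(_ i)[_ _ h1 h2]] := eE n q.
  have [/[dup] Ti /hT[n' nn']|Ti] := pselect (T (dn i (val n))).
    by rewrite (h1 n' nn') -nn' valK /rd (asboolT Ti).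
  by rewrite h2 // insubN //; apply/negP => /set_mem.
(* [D] acts on the copy at position [n] through sigma^-g. It suffices to check scalars and
   [t_i = d_i x_i]; where [x_i] leaves the region, [t_i] acts as 0 by [reg_U]. *)
have eD (n : T) f q : wD W f *: e n q = e n (rs p (sh (- gam p (val n)) f) * q).
  apply: (@D_act_ind K I W V _ (e n) (fun f => rs p (sh (- gam p (val n)) f))) => {f q}.
  - by move=> f f'; rewrite rmorphD rsD.
  - by move=> f f'; rewrite rmorphM rsM.
  - by move=> c q; rewrite -wconstE (eE n q).1 shC.
  move=> i q; rewrite -wdxt -scalerA ex; have [g hg ng] := set_mem (valP n).
  have tE : rs p (sh (- gam p (val n)) (tv K i)) = tv_at (val n) i.
    by rewrite sh_tv mcoeffN intrN opprK.
  have [/[dup] Ti /hT[n' nn']|Ti] := pselect (T (up i (val n))).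
    rewrite -nn' valK ed nn' dn_up valK tE; congr (e n (_ * _)).
    by rewrite ng tv_at_up.
  rewrite insubN; last by apply/negP => /set_mem.
  rewrite scaler0 tE ng tv_at_act; move: Ti; rewrite ng act_sg T_act => hgi.
  have [Ui gi] := region_up hg hgi; rewrite gi mulr0z addr0.
  by rewrite (_ : rs p _ = 0) ?mul0r ?raddf0 //; apply/rs_eq0/(reg_U H).
exists V, u; split=> //.
- move=> n f nf; have [/hT[n' nn']|/uF ->] := pselect (T n); last by rewrite scaler0.
  rewrite -nn' uT eD; have [g hg ng] := set_mem (valP n').
  rewrite ng gam_act (_ : rs p _ = 0) ?mul0r ?raddf0 //; apply/rs_eq0.
  by apply/act_mem; rewrite -ng nn'.
- have pT : T p by exists 0; [exact: region0|rewrite act0].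
  have [p' pp'] := hT p pT; apply/eqP; rewrite -pp' uT => /(@direct_sum_inj K I W V _ _ e he) /eqP.
  by rewrite oner_eq0.
- by move=> n i /hT[n' <-]; rewrite uT ex.
- move=> n i /hT[n' <-]; rewrite uT ed /u.
  case: insubP => [k _ kE|_]; last by rewrite scaler0.
  rewrite eD sh_tv mcoeffN intrN opprK; congr (e k (_ * _)).
  have [g hg ng] := set_mem (valP n').
  by rewrite -[RHS]/(tv_at (val k) i) kE ng tv_at_dn.
move=> P P0 PD PE; apply: (@direct_sum_spanned K I W V _ _ e he) => // _ [n [q ->]]; apply: PE.
exists (val n), (sh (gam p (val n)) (repr q)); rewrite uT eD -shD addNr sh0 mulr1.
by rewrite rs_repr.
Qed.
End RegionExistence.

(** * Simple modules in characteristic zero *)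

(** Coordinatewise comparison of two breaks: if the one with coordinate [b] lies in the region of
    the one with coordinate [b'], the two coordinates agree. *)
Lemma bool_shift (b b' : bool) (z : int) : b%:Z = z + b'%:Z ->
  (b' -> 0 <= z) -> (~~ b' -> z <= 0) -> b = b'.
Proof. by case: b; case: b' => //= e h h'; [have := h' isT|have := h isT]; lia. Qed.

Section DeadEdges.
Variables (K : fieldType) (I : choiceType) (W : weyl_sys K I) (V : lmodType W).
Implicit Types (p : maxD K I) (i : I) (v : V).
Hypotheses (K0 : [pchar K] =i pred0) (Vs : wsimple V).

Lemma nat_notin p k : ~ inm p (k.+1%:R).
Proof. by rewrite pmulrn; apply/int_notin/(char0_int K0). Qed.

(** If [x_i v] were nonzero, it would be killed by [d_i], as [d_i x_i v = t_i v = 0]; by simplicity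
    [d_i] would be locally nilpotent on all of [V]. But [x_i^k d_i^k] acts on [v] as the product of
    the [t_i - j] for j from 1 to k, and modulo [p] each factor is [-j], a unit in characteristic
    0. *)
Lemma dead_x p i v : wspace p v -> inm p (tv K i) -> wx W i *: v = 0.
Proof.
move=> pv pt; apply: contrapT => /eqP xv0.
have v0 : v != 0 by apply: contra_neq xv0 => ->; rewrite scaler0.
have [h|h] := Vs.2 _ (@d_locnil_sub _ _ W V i).
  move/eqP: xv0; apply; apply: h; exists 1%N; rewrite expr1 scalerA wdxt.
  exact: pv.
have [k hk] := h v.
have /(wspace_neq0 pv v0) : wD W (\prod_(j < k) (tv K i - j.+1%:R)) *: v = 0.
  by rewrite -wxn_dn -scalerA hk scaler0.
apply: prod_notin => j pj; apply: (@nat_notin p j).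
by rewrite -[j.+1%:R](subKr (tv K i)); apply: maxB.
Qed.

Lemma dead_d p i v : wspace p v -> inm p (tv K i - 1) -> wd W i *: v = 0.
Proof.
move=> pv pt; apply: contrapT => /eqP dv0.
have v0 : v != 0 by apply: contra_neq dv0 => ->; rewrite scaler0.
have [h|h] := Vs.2 _ (@x_locnil_sub _ _ W V i).
  move/eqP: dv0; apply; apply: h; exists 1%N; rewrite expr1 scalerA wxdt.
  exact: pv.
have [k hk] := h v.
have /(wspace_neq0 pv v0) : wD W (\prod_(j < k) (tv K i + j%:R)) *: v = 0.
  by rewrite -wdn_xn -scalerA hk scaler0.
apply: prod_notin => j pj; apply: (@nat_notin p j).
have -> : j.+1%:R = tv K i + j%:R - (tv K i - 1) :> PD K I.
  by rewrite -natr1; ring.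
exact: maxB.
Qed.
End DeadEdges.

Section CharZero.
Variables (K : fieldType) (I : choiceType) (m : maxD K I) (Ib : set I).
Hypotheses (K0 : [pchar K] =i pred0) (hm : maximal_break m Ib).
Implicit Types (delta : {fset I}) (i : I).
Local Notation W := (weyl_system K I).
Local Notation pt delta := (act (delta_exp delta) m).

(** At the break given by [delta] the wall in a direction of [Ib] is just above when the coordinate
    of [delta] is 0, and just below when it is 1. *)
Definition up_blocked delta : set I := [set i | Ib i /\ i \notin delta].
Definition dn_blocked delta : set I := [set i | Ib i /\ i \in delta].

Lemma delta_expE delta i : (delta_exp delta)@_i = (i \in delta)%:Z.
Proof.
rewrite /delta_exp raddf_sum /=; have [id|id] := boolP (i \in delta).
  rewrite (big_fsetD1 i) //= mcoeff_sg eqxx big1_seq ?addr0 // => j /=.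
  by rewrite in_fsetD1 mcoeff_sg => /andP[/negPf ->].
rewrite big1_seq // => j /= jd; rewrite mcoeff_sg.
by case: eqP id => // <-; rewrite jd.
Qed.

Lemma break_int i (k : int) : inm m (tv K i + k%:~R) -> Ib i /\ k = 0.
Proof.
move=> h; have [Ii|Ii] := pselect (Ib i); last first.
  by case: (hm.2 i Ii (sg k i)); rewrite -tvE; apply/act_tv0; rewrite mcoeff_sg eqxx.
split=> //; apply: contrapT => /eqP k0; apply: (@int_notin K I m k).
  exact: char0_int.
rewrite -[k%:~R](addKr (tv K i)); apply: maxDD => //; apply: maxN.
by rewrite tvE; apply: hm.1.
Qed.

Lemma break_region delta : region_axioms (pt delta) (up_blocked delta) (dn_blocked delta).
Proof.
have Ib_tv i : Ib i -> inm m (tv K i) by move=> Ii; rewrite tvE; apply: hm.1.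
split.
- by move=> g h; apply: char0_stab.
- move=> i [Ii id]; apply/act_tv0; rewrite delta_expE (negPf id) addr0.
  exact: Ib_tv.
- move=> i [Ii id]; apply/act_tv1; rewrite delta_expE id subrr addr0.
  exact: Ib_tv.
move=> i k /act_tv/break_int[Ii]; rewrite delta_expE.
have [id|id] := boolP (i \in delta) => e; [right|left]; split=> //; lia.
Qed.

Lemma rf_is_S0 p U L (V : lmodType (weyl_algebra K I)) (u : maxD K I -> V) :
  region_axioms p U L -> @region_family K I p U L W V u -> is_S0 (region_orbit p U L) V.
Proof.
move=> H Hu; have [e [he eE]] := rf_formulas H Hu; exists e; split; first exact: he.
move=> n f; have [hc hi] := eE n f; split=> [c|i].
  apply: (etrans (wconstE _ _)); apply: (etrans (hc c)).
  by congr (e n (res _ _)); apply: mul_malgC.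
have [h1 h2 h3 h4] := hi i; split; [|exact: h2| |exact: h4] => n' n'E.
  exact: (etrans (h1 n' n'E) (congr1 (e n') (rs_shE _ _ _))).
exact: (etrans (h3 n' n'E) (congr1 (e n') (rs_tv_shE _ _ _ _))).
Qed.

Lemma rf_class p U L (V : lmodType (weyl_algebra K I)) (u : maxD K I -> V) :
  region_axioms p U L -> @region_family K I p U L W V u -> 
  [/\ simple_module V, weight_module V & weight_support V `<=` region_orbit p U L].
Proof.
move=> H Hu; split.
- exact/wsimpleE/(rf_simple H Hu).
- by apply/wweightE; exact: (rf_hom Hu).
move=> n [v]; rewrite wspaceE => nv v0; exact: (rf_support H Hu nv v0).
Qed.

Lemma O_p_region delta p : (forall i, i \in delta -> Ib i) -> p = pt delta ->
  O_p m Ib p = region_orbit p (up_blocked delta) (dn_blocked delta).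
Proof.
move=> hd ->; apply/seteqP; split=> n.
  move=> [delta' [hd' e [g hg ->]]]; exists g; last exact: erefl.
  move=> i; have dd : (i \in delta) = (i \in delta').
    have := congr1 (fun h => h@_i) (char0_stab K0 e).
    by rewrite !delta_expE; do 2 case: (i \in _).
  by rewrite /up_blocked /dn_blocked /= dd; split=> -[Ii id]; have [k ->] := hg i Ii;
    rewrite ?id ?(negPf id) /=; lia.
move=> [g hg ->]; exists delta; split; [exact: hd|exact: erefl|exists g; last exact: erefl].
move=> i Ii.
have [hU hL] := hg i; have [id|id] := boolP (i \in delta).
  exists `|g@_i|%N; rewrite /= expr2 mulN1r opprK mul1r gez0_abs //.
  by apply: hL.
by exists `|g@_i|%N; rewrite /= expr1 mulN1r lez0_abs ?opprK //; apply: hU.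
Qed.

Lemma region_orbit_sub p U L : G_orbit m p -> region_orbit p U L `<=` G_orbit m.
Proof. by move=> [g _ <-] n [h _ ->]; apply: G_orbit_act; exists g. Qed.

Lemma class0_exhaustive (V : lmodType (weyl_algebra K I)) :
  simple_module V -> weight_module V -> weight_support V `<=` G_orbit m ->
  exists delta, (forall i, i \in delta -> Ib i) /\ exists u : maxD K I -> V,
    @region_family K I (pt delta) (up_blocked delta) (dn_blocked delta) W V u.
Proof.
move=> /wsimpleE Vs /wweightE Vw Vsupp.
have [[v0 v0n] _] := Vs.
have VT : @wsub K I W V setT by split.
have [n [v [nv _ vn]]] := @wsub_graded K I W V setT Vw VT v0 Logic.I v0n.
have [g _ ng] : G_orbit m n by apply: Vsupp; exists v => //; rewrite wspaceE.
(* [delta] records the directions of [Ib] in which the weight [n = act g m] lies above the wall of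
   [m]; then [g - delta_exp delta] points into the region of that break. *)
pose delta := [fset i in msupp g | `[< Ib i >] && (0 < g@_i)]%fset.
have dE i : (i \in delta) = `[< Ib i >] && (0 < g@_i).
  rewrite !inE /=; case: msuppP => //=; first by rewrite ltxx andbF.
have hd i : i \in delta -> Ib i by rewrite dE => /andP[/asboolP].
exists delta; split=> //.
have H := break_region delta.
pose h := g - delta_exp delta.
have hh : region (up_blocked delta) (dn_blocked delta) h.
  move=> i; rewrite mcoeffB delta_expE; split=> -[Ii id].
    by rewrite (negPf id) subr0; move: id; rewrite dE (asboolT Ii) /= -leNgt.
  by rewrite id; move: id; rewrite dE => /andP[_]; lia.
have nE : n = act h (pt delta) by rewrite -ng -actD subrK.
rewrite nE in nv; have [v' [pv' v'n]] := region_weight_base H hh nv vn.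
apply: (simple_region_family H Vs pv' v'n) => i hi.
  exact: (dead_x K0 Vs pv' (reg_U H hi)).
exact: (dead_d K0 Vs pv' (reg_L H hi)).
Qed.

(** The statement is about a maximal break, so [Ib = set0] gives the nondegenerate case.
    Non-isomorphism: an isomorphism carries the generator at one break into a weight space of the
    other module, so the first break lies in the region of the second and both coincide. *)
Lemma char0_degenerate : exists S : B_O m Ib -> lmodType (weyl_algebra K I),
  (forall p, is_S0 (O_p m Ib (val p)) (S p)) /\
  exhaustive_list S (fun V =>
    [/\ simple_module V, weight_module V & weight_support V `<=` G_orbit m]).
Proof.
have hB (p : B_O m Ib) : exists delta, (forall i, i \in delta -> Ib i) /\ val p = pt delta.
  by have [delta hd e] := set_mem (valP p); exists delta.
pose dl p := sval (cid (hB p)).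
have dlP p : (forall i, i \in dl p -> Ib i) /\ val p = pt (dl p) by exact: (svalP (cid (hB p))).
have hS p : exists V : lmodType (weyl_algebra K I), exists u : maxD K I -> V,
    @region_family K I (pt (dl p)) (up_blocked (dl p)) (dn_blocked (dl p)) W V u.
  exact: region_exists (break_region (dl p)).
pose S p := sval (cid (hS p)).
have SP p : exists u : maxD K I -> S p,
    @region_family K I (pt (dl p)) (up_blocked (dl p)) (dn_blocked (dl p)) W (S p) u.
  exact: (svalP (cid (hS p))).
exists S; split.
  move=> p; have [hd pE] := dlP p; rewrite (O_p_region hd pE) pE.
  have [u Hu] := SP p; exact: (rf_is_S0 (break_region (dl p)) Hu).
split.
- move=> p; have [u Hu] := SP p; have [h1 h2 h3] := rf_class (break_region (dl p)) Hu.
  split=> // n /h3; apply: region_orbit_sub; by exists (delta_exp (dl p)).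
- move=> p p' [phi phib].
  have [u Hu] := SP p; have [u' Hu'] := SP p'.
  have H := break_region (dl p); have H' := break_region (dl p').
  have w0 : wspace (W := W) (pt (dl p)) (phi (u (pt (dl p)))).
    move=> f pf; have := rf_wspace Hu pf => /(congr1 phi).
    by rewrite raddf0 linearZ.
  have p0 : phi (u (pt (dl p))) != 0.
    by rewrite raddf_eq0; [exact: (rf_neq0 Hu)|exact: bij_inj].
  have [g hg e] := rf_support H' Hu' w0 p0.
  have eg : delta_exp (dl p) = g + delta_exp (dl p').
    by apply: (char0_stab K0 (m := m)); rewrite actD -e.
  have dd : dl p = dl p'.
    apply/fsetP => i; have := congr1 (fun h => h@_i) eg.
    rewrite mcoeffD !delta_expE; have [hU hL] := hg i.
    have [Ii|Ii] := pselect (Ib i); last first.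
      have -> : (i \in dl p) = false by apply/negP => /((dlP p).1 i).
      by have -> : (i \in dl p') = false by apply/negP => /((dlP p').1 i).
    move=> e1; apply: (bool_shift e1) => id'; first exact: hL (conj Ii id').
    exact: hU (conj Ii id').
  by apply: val_inj; rewrite (dlP p).2 (dlP p').2 dd.
move=> V [Vs Vw Vsupp].
have [delta [hd [u Hu]]] := class0_exhaustive Vs Vw Vsupp.
have pB : B_O m Ib (pt delta) by exists delta.
pose p : B_O m Ib := SigSub (mem_set pB).
exists p; have [u' Hu'] := SP p.
have dE : dl p = delta.
  have [_ e] := dlP p; apply/fsetP => i.
  have := congr1 (fun h => h@_i) (char0_stab K0 e); rewrite !delta_expE.
  by do 2 case: (i \in _).
rewrite dE in Hu'; have [phi phib] := rf_iso (break_region delta) Hu Hu'.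
by exists phi.
Qed.
End CharZero.

Lemma char0_nondegenerate (K : fieldType) (I : choiceType) (m : maxD K I) :
  [pchar K] =i pred0 -> maximal_break m set0 ->
  exists S : lmodType (weyl_algebra K I),
    is_S0 (G_orbit m) S /\ exhaustive_list (fun _ : unit => S) (fun V =>
      [/\ simple_module V, weight_module V & weight_support V `<=` G_orbit m]).
Proof.
move=> K0 hm; have [S [SP [SC _ Sex]]] := char0_degenerate K0 hm.
have d0 : delta_exp fset0 = 0 :> {malg int[I]} by rewrite /delta_exp big_seq_fset0.
have mB : B_O m set0 m by exists fset0; rewrite ?d0 ?act0.
pose p : B_O m set0 := SigSub (mem_set mB).
have pE (p' : B_O m set0) : p' = p.
  have [delta hd e] := set_mem (valP p'); apply: val_inj; rewrite e /=.
  suff -> : delta = fset0 by rewrite d0 act0.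
  by apply/fsetP => i; rewrite in_fset0; apply/negP => /hd.
have OE : O_p m set0 m = G_orbit m.
  apply/seteqP; split=> n; first by move=> [_ [_ _ [g _ ->]]]; exists g.
  move=> [g _ <-]; exists fset0; split=> //; first by rewrite d0 act0.
  by exists g.
exists (S p); split; first by have := SP p; rewrite /= OE.
split=> [_|[] []//|V /Sex[p']]; first exact: SC.
by rewrite (pE p'); exists tt.
Qed.

Lemma mcoeff_sum_sg (I : choiceType) (F : I -> int) (g : {malg int[I]}) i :
  (forall j, j \notin msupp g -> F j = 0) -> (\sum_(j <- msupp g) sg (F j) j)@_i = F i.
Proof.
move=> F0; rewrite raddf_sum /=; have [ig|ig] := boolP (i \in msupp g).
  rewrite (big_fsetD1 i) //= mcoeff_sg eqxx big1_seq ?addr0 // => j /=.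
  by rewrite in_fsetD1 mcoeff_sg => /andP[/negPf ->].
rewrite (F0 i ig) big1_seq // => j /= jg.
by rewrite mcoeff_sg; case: eqP ig => // <-; rewrite jg.
Qed.

(** * Positive characteristic *)

Section PDChar.
Variables (K : fieldType) (I : choiceType) (q : nat).
Hypothesis Kq : q \in [pchar K].

Lemma PD_pchar : q \in [pchar PD K I].
Proof.
pose r : {rmorphism K -> PD K I} := @malgC _ K.
by rewrite inE (pcharf_prime Kq) -(rmorph_nat r) (pcharf0 (Kq)) rmorph0 eqxx.
Qed.

Lemma PD_int (k : int) : (q %| k)%Z -> k%:~R = 0 :> PD K I.
Proof.
by move=> /dvdzP[l ->]; rewrite intrM -pmulrn (pcharf0 PD_pchar) mulr0.
Qed.

End PDChar.

Section CharP.
Variables (K : fieldType) (I : choiceType) (q : nat) (m : maxD K I) (Ib : set I).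
Implicit Types (n : maxD K I) (g h : {malg int[I]}) (i j : I).

(** The geometry of the orbit in characteristic q: weights are exponents modulo q, and the walls lie
    at the multiples of q in the directions of [Ib]. *)
Record charp_axioms : Prop := CharpAxioms {
  cp_q : q \in [pchar K];
  cp_stab : forall g h, act g m = act h m <-> forall i, (q %| g@_i - h@_i)%Z;
  cp_Ib : forall i, Ib i -> inm m (tv K i);
  cp_break : forall i (k : int), inm m (tv K i + k%:~R) -> Ib i /\ (q %| k)%Z }.

Hypothesis H : charp_axioms.

Lemma cp_prime : prime q. Proof. exact: pcharf_prime (cp_q H). Qed.
Lemma cp_gt0 : (0 < q)%N. Proof. exact: prime_gt0 cp_prime. Qed.
Lemma cp_gt1 : (1 < q)%N. Proof. exact: prime_gt1 cp_prime. Qed.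

(* hc n has coordinates in {0, ..., q - 1}, and n = act (- hc n) m; the        *)
(* exponents are taken modulo q because q Z^(I) stabilizes m.                  *)
Definition red (k : int) : int := (- k %% q)%Z.

Lemma red_bound k : 0 <= red k < q.
Proof.
rewrite /red modz_ge0 ?ltz_mod //; apply/eqP => -[q0]; by have := cp_gt0; rewrite q0.
Qed.

Definition hc n : {malg int[I]} :=
  if pselect (exists g, n = act g m) is left e
  then let g := sval (cid e) in \sum_(i <- msupp g) sg (red g@_i) i else 0.

Lemma hc_coef g i :
  (\sum_(i <- msupp g) sg (red g@_i) i)@_i = red g@_i.
Proof.
by apply: mcoeff_sum_sg => j /mcoeff_outdom ->; rewrite /red oppr0 mod0z.
Qed.

Lemma dvd_eq (a b : int) : a = b -> (q %| a)%Z -> (q %| b)%Z.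
Proof. by move->. Qed.

Lemma red_dvd k : (q %| red k + k)%Z.
Proof. by rewrite /red -[X in _ + X]opprK -eqz_mod_dvd modz_mod. Qed.

Lemma dvd_bound_eq (a b : int) : 0 <= a < q -> 0 <= b < q -> (q %| a - b)%Z -> a = b.
Proof. by move=> ha hb; rewrite -eqz_mod_dvd !modz_small // => /eqP. Qed.

Lemma hcE g i : (hc (act g m))@_i = red g@_i.
Proof.
rewrite /hc; case: pselect => [e|[]]; last by exists g.
case: cid => /= h /(cp_stab H)/(_ i) gh; rewrite hc_coef.
apply: dvd_bound_eq; try exact: red_bound.
apply: (dvd_eq _ (rpredD gh (rpredB (red_dvd h@_i) (red_dvd g@_i)))); lia.
Qed.

Lemma hc_eq g i (a : int) : 0 <= a < q -> (q %| a + g@_i)%Z -> (hc (act g m))@_i = a.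
Proof.
move=> ha da; rewrite hcE; apply: dvd_bound_eq => //; first exact: red_bound.
apply: (dvd_eq _ (rpredB (red_dvd g@_i) da)); lia.
Qed.

Lemma hc_bound n i : 0 <= (hc n)@_i < q.
Proof.
have [[g ->]|h] := pselect (exists g, n = act g m); first by rewrite hcE red_bound.
rewrite /hc; case: pselect => // _; rewrite mcoeff0 lexx /=.
exact: cp_gt0.
Qed.

Lemma hcK n : G_orbit m n -> act (- hc n) m = n.
Proof.
move=> [g _ <-]; apply/(cp_stab H) => i; rewrite mcoeffN hcE.
apply: (dvd_eq _ (rpredB (dvdz0 q) (red_dvd g@_i))); lia.
Qed.

Lemma hc_dvd g i : (q %| (hc (act g m))@_i + g@_i)%Z.
Proof. by rewrite hcE red_dvd. Qed.

Lemma hc0 : hc m = 0.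
Proof.
apply/malgP => i; rewrite -[m in LHS]act0 mcoeff0; apply: hc_eq.
  by rewrite lexx; exact: cp_gt0.
by rewrite mcoeff0 dvdz0.
Qed.

(** [hc] counts downwards, so [x_i] lowers it by one and wraps from 0 to q - 1. The wrapping steps
    are the ones at which the variables of R enter. *)
Lemma hc_up n i j : G_orbit m n -> (hc (act (sg 1 i) n))@_j =
  if i == j then (if (hc n)@_i == 0 then q%:Z - 1 else (hc n)@_i - 1) else (hc n)@_j.
Proof.
move=> [g _ <-]; rewrite act_sg; have hb := hc_bound (act g m).
have hd := hc_dvd g j; apply: hc_eq; rewrite ?coD.
  have := hb j; have := cp_gt0; case: eqVneq => [<-|_]; last by [].
  by case: eqVneq => [->|h] *; lia.
case: eqVneq hd => [<-|_] hd; last by rewrite addr0.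
case: eqVneq hd => [e|_] hd; last by apply: (dvd_eq _ hd); lia.
rewrite e in hd; apply: (dvd_eq _ (rpredD hd (dvdzz q))); lia.
Qed.

Lemma hc_dn n i j : G_orbit m n -> (hc (act (sg (-1) i) n))@_j =
  if i == j then (if (hc n)@_i == q%:Z - 1 then 0 else (hc n)@_i + 1) else (hc n)@_j.
Proof.
move=> [g _ <-]; rewrite act_sg; have hb := hc_bound (act g m).
have hd := hc_dvd g j; apply: hc_eq; rewrite ?coD.
  have := hb j; have := cp_gt0; case: eqVneq => [<-|_]; last by [].
  by case: eqVneq => [->|h] *; lia.
case: eqVneq hd => [<-|_] hd; last by rewrite addr0.
case: eqVneq hd => [e|_] hd; last by apply: (dvd_eq _ hd); lia.
rewrite e in hd; apply: (dvd_eq _ (rpredB hd (dvdzz q))); lia.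
Qed.

Lemma orbit0 : G_orbit m m. Proof. by exists 0; rewrite ?act0. Qed.

Lemma tv_notin i (k : int) : ~ (Ib i /\ (q %| k)%Z) -> ~ inm m (tv K i + k%:~R).
Proof. by move=> h /(cp_break H). Qed.
End CharP.

Lemma not_dvd_range (q : nat) (a : int) : - q%:Z < a < 0 -> ~ (q %| a)%Z.
Proof. by move=> h /dvdzP[k ak]; case: (lerP 0 k) => hk; nia. Qed.

(** * Modules presented by a commutative ring at every weight *)

Section SFamilies.
Variables (K : fieldType) (I : choiceType) (q : nat) (m : maxD K I) (Ib : set I).
Hypothesis H : charp_axioms q m Ib.
Variables (R : nzRingType) (c : {rmorphism PD K I -> R}) (Vp Vm : I -> R).

(* R stands for R_{Gamma,xi}(m), Vp i and Vm i for the factors by which x_i and  *)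
(* d_i act where they cross the hyperplane of m; all the rings R(n) are        *)
(* identified with R(m), so that an s_family e n : R -> V is a surjection onto *)
(* the weight space of weight n.                                               *)
Record s_axioms : Prop := SAxioms {
  sx_comm : commutative (@GRing.mul R);
  sx_c0 : forall f, inm m f -> c f = 0;
  sx_t : forall i, Vm i * Vp i = c (tv K i);
  sx_gen : forall J : set R, J 0 -> (forall r s, J r -> J s -> J (r + s)) ->
    (forall f r, J r -> J (c f * r)) -> (forall i r, J r -> J (Vp i * r)) ->
    (forall i r, J r -> J (Vm i * r)) -> forall a r, J r -> J (a * r) }.
Hypothesis HR : s_axioms.
Let RC := sx_comm HR.

Local Notation O := (G_orbit m).
Local Notation up i n := (act (sg 1 i) n).
Local Notation dn i n := (act (sg (-1) i) n).
Implicit Types (n : maxD K I) (i : I) (r s : R) (f : PD K I).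

(** By [sf_D], [t_i] acts at weight [n] as [c (t_i - hc_i)]. The factor of [d_i] is this value at
    the lower neighbour, where [hc_i] is one larger; the wrapping steps carry [Vp i] and [Vm i]
    instead. *)
Definition xc n i : R := if (hc q m n)@_i == 0 then Vp i else 1.
Definition dc n i : R :=
  if (hc q m n)@_i == q%:Z - 1 then Vm i else c (tv K i - ((hc q m n)@_i + 1)%:~R).

Lemma dc_xc n i : O n -> dc (up i n) i * xc n i = c (tv K i - ((hc q m n)@_i)%:~R).
Proof.
move=> On; rewrite /dc /xc (hc_up H i i On) eqxx.
have hb := hc_bound H n i.
case: (eqVneq (hc q m n)@_i 0) => [->|h0]; first by rewrite eqxx subr0 (sx_t HR).
have -> : ((hc q m n)@_i - 1 == q%:Z - 1) = false by lia.
by rewrite mulr1 subrK.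
Qed.

Section OneModule.
Variables (W : weyl_sys K I) (V : lmodType W).
Local Notation x := (wx W).
Local Notation d := (wd W).
Local Notation D := (wD W).

Record s_family (e : maxD K I -> R -> V) : Prop := SFamily {
  sf_B : forall n, zmod_morphism (e n);
  sf_c : forall n a r, O n -> D (cD I a) *: e n r = e n (c (cD I a) * r);
  sf_x : forall n i r, O n -> x i *: e n r = e (up i n) (xc n i * r);
  sf_d : forall n i r, O n -> d i *: e n r = e (dn i n) (dc n i * r) }.

Variable e : maxD K I -> R -> V.
Hypothesis He : s_family e.

Lemma sf_0 n : e n 0 = 0.
Proof. exact: zmod_morphism0 (sf_B He n). Qed.

Lemma sf_add n r s : e n (r + s) = e n r + e n s.
Proof. exact: zmod_morphismD (sf_B He n) r s. Qed.

Lemma sf_D n f r : O n -> D f *: e n r = e n (c (sh (hc q m n) f) * r).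
Proof.
move=> On; elim/polyD_tv_ind: f r => [a r|i r|f g IHf IHg r|f g IHf IHg r].
- by rewrite shC (sf_c He).
- rewrite -(wdxt W) -scalerA (sf_x He _ _ On) (sf_d He _ _ (G_orbit_act _ On)).
  by rewrite dn_up mulrA (dc_xc _ On) sh_tv.
- by rewrite rmorphD scalerDl IHf IHg !rmorphD mulrDl sf_add.
- by rewrite rmorphM -scalerA IHg IHf !rmorphM mulrA.
Qed.

Lemma sf_wspace n r : O n -> wspace n (e n r).
Proof.
move=> On f nf; rewrite (sf_D _ _ On) (sx_c0 HR) ?mul0r ?sf_0 //.
by move: nf; rewrite -{1}(hcK H On) act_mem opprK.
Qed.

(** Follow the path from [m] to [n] with exponents between -q and 0. It never wraps, so along it
    [x_i] acts as 1 on the coordinate [r], and [d_i] undoes this up to [t_i], a unit at each lower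
    end because no multiple of q is met. *)
Lemma sf_move (S : set V) : wsub S -> forall n r, O n -> S (e n r) <-> S (e m r).
Proof.
move=> [S0 SD SZ] n r On; rewrite -{1}(hcK H On).
have : forall i, - q%:Z < (- hc q m n)@_i <= 0.
  by move=> i; rewrite mcoeffN; have := hc_bound H n i; lia.
move: (- hc q m n) => g {n On}; elim/lattice_ind: g => [_|g i gi _ hg|g i gi IH hg].
- by rewrite act0.
- by have := hg i; rewrite coD eqxx; lia.
have hgi := hg i; rewrite coD eqxx in hgi.
rewrite -IH; last first.
  by move=> j; have := hg j; rewrite coD; case: eqVneq => [<-|_]; lia.
have [gO gO'] : O (act g m) /\ O (act (g + sg (-1) i) m) by split; apply: G_orbit_act; exact: orbit0.
have nE : act (g + sg (-1) i) m = dn i (act g m) by rewrite act_sg.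
have h : (hc q m (act g m))@_i = - g@_i.
  by apply: (hc_eq H); [lia|rewrite addNr dvdz0].
split=> Sn.
  have -> : e (act g m) r = x i *: e (act (g + sg (-1) i) m) r; last exact: SZ.
  rewrite (sf_x He _ _ gO') nE up_dn /xc (hc_dn H i i gO) eqxx h.
  have -> : (- g@_i == q%:Z - 1) = false by lia.
  have -> : (- g@_i + 1 == 0) = false by lia.
  by rewrite mul1r.
have dE : d i *: e (act g m) r = D (tv K i) *: e (act (g + sg (-1) i) m) r.
  rewrite (sf_d He _ _ gO) (sf_D _ _ gO') nE /dc sh_tv (hc_dn H i i gO) eqxx h.
  by have -> : (- g@_i == q%:Z - 1) = false by lia.
have tn : ~ inm (act (g + sg (-1) i) m) (tv K i).
  move/act_tv0; apply: (tv_notin H) => -[_]; apply: not_dvd_range.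
  by rewrite coD eqxx; lia.
have [f hf] := max_inv tn.
have -> : e (act (g + sg (-1) i) m) r = D f *: (D (tv K i) *: e (act (g + sg (-1) i) m) r).
  rewrite scalerA -rmorphM.
  by rewrite (wspace_eqm (sf_wspace _ gO') hf) rmorph1 scale1r.
by rewrite -dE; apply/SZ/SZ.
Qed.

Lemma sf_ideal (S : set V) : wsub S -> is_ideal [set r | S (e m r)].
Proof.
move=> hS; have [S0 SD SZ] := hS; have Om := orbit0 m.
have JD r s : S (e m r) -> S (e m s) -> S (e m (r + s)).
  by move=> Sr Ss; rewrite sf_add; apply: SD.
have JM a r : S (e m r) -> S (e m (a * r)).
  apply: (sx_gen HR (J := [set r | S (e m r)])) => //= [|f {}r Sr|i {}r Sr|i {}r Sr].
  - by rewrite sf_0.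
  - have := SZ (D f) _ Sr; rewrite (sf_D _ _ Om) (hc0 H) sh0; exact.
  - have := SZ (x i) _ Sr; rewrite (sf_x He _ _ Om) /xc (hc0 H) mcoeff0 eqxx.
    by move/(sf_move hS _ (G_orbit_act _ Om)).
  (* The factor [Vm i] appears when [d_i] wraps from sigma_i(m) back to [m], so [r] is moved up to
     sigma_i(m) beforehand. *)
  have Su : S (e (up i m) r) by apply/(sf_move hS _ (G_orbit_act _ Om)).
  have := SZ (d i) _ Su; rewrite (sf_d He _ _ (G_orbit_act _ Om)) dn_up /dc.
  by rewrite (hc_up H i i Om) eqxx (hc0 H) mcoeff0 !eqxx.
split=> /= [|r s Sr Ss|a r|a r].
- by rewrite sf_0.
- by rewrite (sf_B He); apply: wsubB.
- exact: JM.
- by rewrite RC; apply: JM.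
Qed.

Definition s_spanned : Prop := spanned [set v | exists n r, O n /\ v = e n r].

Fact s_additive (n : O) : {E : {additive R -> V} | forall r, E r = e (val n) r}.
Proof.
pose E : {additive R -> V} := HB.pack (e (val n)) (GRing.isZmodMorphism.Build _ _ _ (sf_B He (val n))).
by exists E.
Qed.

Lemma s_spanned_additive : s_spanned ->
  spanned [set v | exists (n : O) r, v = sval (s_additive n) r].
Proof.
move=> hE P P0 PD PE; apply: hE => // _ [n [r [On ->]]]; apply: PE.
exists (SigSub (mem_set On)), r; exact/esym/(svalP (s_additive _)).
Qed.

Lemma s_additive_wspace (n : O) r : wspace (val n) (sval (s_additive n) r).
Proof. by rewrite (svalP (s_additive n)); apply/sf_wspace/set_mem/valP. Qed.

Lemma s_graded (S : set V) v : s_spanned -> wsub S -> S v -> v != 0 ->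
  exists r, S (e m r) /\ e m r != 0.
Proof.
move=> hE hS Sv v0; have := graded_family val_inj s_additive_wspace (s_spanned_additive hE) hS Sv v0.
move=> [n [r [nr Sr]]]; rewrite (svalP (s_additive n)) in nr Sr.
have On := set_mem (valP n); exists r; split; first by apply/(sf_move hS _ On).
by apply: contra_neq nr => er; apply/(sf_move (@wsub0 _ _ _ _) _ On).
Qed.

Lemma sf_simple : s_spanned -> maximal_ideal [set r | e m r = 0] -> wsimple V.
Proof.
move=> hE [hN N1 NM]; split; first by exists (e m 1); apply/eqP.
move=> S hS; have [[v [Sv v0]]|h] := pselect (exists v, S v /\ v != 0); last first.
  by left=> v Sv; apply: contrapT => /eqP v0; apply: h; exists v.
right; have [r [Sr /eqP er]] := s_graded hE hS Sv v0.
have [S0 SD SZ] := hS.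
have S1 : S (e m 1).
  apply: contrapT => h1; apply: er.
  have sub : [set r | e m r = 0] `<=` [set r | S (e m r)] by move=> s /= ->.
  by have : [set r | S (e m r)] r by []; rewrite (NM _ (sf_ideal hS) h1 sub).
apply: hE => // _ [n [s [On ->]]]; apply/(sf_move hS _ On).
by have := Defs.idealMl (sf_ideal hS) s S1; rewrite /= mulr1.
Qed.

(** [r] collects the terms of weight [k]; the rest of [v] is killed by all elements of [D] lying in
    the remaining finitely many ideals. The set [J] keeps track of where the coefficients come
    from. *)
Lemma weight_split k (J : set R) : J 0 -> (forall r s, J r -> J s -> J (r + s)) ->
  forall v, (forall P : set V, P 0 -> (forall u w, P u -> P w -> P (u + w)) ->
    (forall n r, O n -> J r -> P (e n r)) -> P v) ->
  exists2 r, J r & exists s : seq (maxD K I),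
  k \notin s /\ forall f, (forall n, n \in s -> inm n f) -> D f *: (v - e k r) = 0.
Proof.
move=> J0 JD v hv; apply: (hv (fun v => exists2 r, J r & exists s : seq (maxD K I),
  k \notin s /\ forall f, (forall n, n \in s -> inm n f) -> D f *: (v - e k r) = 0)).
- by exists 0 => //; exists [::]; split=> // f _; rewrite sf_0 subr0 scaler0.
- move=> u w [r Jr [s [ms hs]]] [r' Jr' [s' [ms' hs']]].
  exists (r + r'); first exact: JD.
  exists (s ++ s'); split; first by rewrite mem_cat negb_or ms.
  move=> f hf; rewrite sf_add opprD addrACA scalerDr hs => [|n ns]; last first.
    by apply: hf; rewrite mem_cat ns.
  by rewrite hs' ?addr0 // => n ns; apply: hf; rewrite mem_cat ns orbT.
move=> n r On Jr; have [->|nm] := eqVneq n k.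
  by exists r => //; exists [::]; split=> // f _; rewrite subrr scaler0.
exists 0 => //; exists [:: n]; split; first by rewrite inE eq_sym.
move=> f hf; rewrite sf_0 subr0; apply: (sf_wspace r On).
by apply: hf; rewrite inE.
Qed.

Lemma weight_proj k v r (s : seq (maxD K I)) : O k -> wspace k v -> k \notin s ->
  (forall f, (forall n, n \in s -> inm n f) -> D f *: (v - e k r) = 0) -> v = e k r.
Proof.
move=> Ok mv ms h; have [f [nf hf]] := maxD_projector s k.
have fs n : n \in s -> inm n f.
  by move=> ns; apply: hf => //; apply: contraNneq ms => <-.
apply/eqP; rewrite -subr_eq0 -[_ - _]scale1r -(rmorph1 D).
rewrite -(wspace_eqm (wspaceB mv (sf_wspace r Ok)) nf).
by rewrite h.
Qed.

Lemma sf_weight k v : O k -> s_spanned -> wspace k v -> exists r, v = e k r.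
Proof.
move=> Ok hE mv; have [|r _ [s [ms hs]]] := weight_split k (J := setT) Logic.I (fun _ _ _ _ => Logic.I) (v := v).
  by move=> P P0 PD PE; apply: hE => // _ [n [r [On ->]]]; apply: PE.
by exists r; apply: (weight_proj Ok mv ms hs).
Qed.

(** Let [J] be a proper ideal containing the kernel. The elements with coefficients in [J] span a
    submodule. If it is 0, [J] is the kernel. If it is everything, comparing weight components gives
    [e m 1 = e m r] with [r] in [J], so 1 lies in [J]. *)
Lemma sf_maximal : s_spanned -> wsimple V -> e m 1 != 0 ->
  maximal_ideal [set r | e m r = 0].
Proof.
move=> hE [_ Vs] /eqP e1; split=> // [|J hJ J1 sub].
  exact: sf_ideal (@wsub0 _ _ _ _).
have Om := orbit0 m.
pose T : set V := [set v | forall P : set V, P 0 -> (forall u w, P u -> P w -> P (u + w)) ->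
    (forall n r, O n -> J r -> P (e n r)) -> P v].
have hT : wsub T.
  have Te n r : O n -> J r -> T (e n r) by move=> On Jr P _ _; apply.
  apply: weyl_gen_sub => [P //|u v Tu Tv P P0 PD PE|a v ga Tv].
    by apply: (PD); [apply: Tu|apply: Tv].
  apply: (Tv (fun v => T (a *: v))) => [|u w Tu Tw|n r On Jr].
  - by rewrite scaler0 => P.
  - by rewrite scalerDr => P P0 PD PE; apply: (PD); [apply: Tu|apply: Tw].
  case: ga => [[b ->]|[[i ->]|[i ->]]].
  - by rewrite (sf_c He _ _ On); apply: Te => //; apply: (idealMl hJ).
  - rewrite (sf_x He _ _ On); apply: Te; first exact: G_orbit_act.
    exact: (idealMl hJ).
  rewrite (sf_d He _ _ On); apply: Te; first exact: G_orbit_act.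
  exact: (idealMl hJ).
have [T0|TT] := Vs T hT.
  by apply/seteqP; split=> // r Jr /=; apply: T0 => P _ _; apply.
case: J1.
have [r Jr [s [ms hs]]] := weight_split m (ideal0 hJ) (fun r s => @is_idealD _ _ r s hJ) (TT (e m 1)).
have /eqP := weight_proj Om (sf_wspace 1 Om) ms hs; rewrite -subr_eq0 -(sf_B He) => /eqP Nr.
rewrite -[1](subrK r); apply: (is_idealD hJ) => //; exact: sub.
Qed.

Lemma sf_support n : s_spanned -> e m 1 != 0 -> (exists2 v : V, wspace n v & v != 0) <-> O n.
Proof.
move=> hE e1; split=> [[v nv v0]|On].
  have [t <-] := family_support s_additive_wspace (s_spanned_additive hE) nv v0.
  exact: set_mem (valP t).
exists (e n 1); first exact: sf_wspace.
by apply: contra_neq e1 => h; apply/(sf_move (@wsub0 _ _ _ _) _ On).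
Qed.

(** The left-hand side depends on [V] alone, the right-hand side on its presentation. This is how
    Gamma and xi are recovered from the module. *)
Lemma sf_x_vanish i : s_spanned ->
  (forall v : V, wspace m v -> x i *: v = 0) <-> e m (Vp i) = 0.
Proof.
have Om := orbit0 m; have S0 := @wsub0 _ _ _ V.
have xE r : x i *: e m r = e (up i m) (Vp i * r).
  by rewrite (sf_x He _ _ Om) /xc (hc0 H) mcoeff0 eqxx.
move=> hE; split=> [h|h v /(sf_weight Om hE)[r ->]].
  have := h _ (sf_wspace 1 Om); rewrite xE mulr1.
  by move/(sf_move S0 _ (G_orbit_act _ Om)).
rewrite xE; apply/(sf_move S0 _ (G_orbit_act _ Om)).
by rewrite RC; apply: (Defs.idealMl (sf_ideal S0)).
Qed.

Lemma sf_d_vanish i : s_spanned ->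
  (forall v : V, wspace (up i m) v -> d i *: v = 0) <-> e m (Vm i) = 0.
Proof.
have Om := orbit0 m; have S0 := @wsub0 _ _ _ V; have Ou := G_orbit_act (sg 1 i) Om.
have dE r : d i *: e (up i m) r = e m (Vm i * r).
  by rewrite (sf_d He _ _ Ou) dn_up /dc (hc_up H i i Om) eqxx (hc0 H) mcoeff0 !eqxx.
move=> hE; split=> [h|h v /(sf_weight Ou hE)[r ->]].
  by have := h _ (sf_wspace 1 Ou); rewrite dE mulr1.
by rewrite dE RC; apply: (Defs.idealMl (sf_ideal S0)).
Qed.

Lemma sf_hom : s_spanned -> spanned (@hom_vector _ _ _ V).
Proof.
move=> hE P P0 PD PE; apply: hE => // _ [n [r [On ->]]]; apply: PE.
by exists n; apply: sf_wspace.
Qed.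
End OneModule.

(** If [phi (e m 1) = e' m a], the differences [phi (e n r) - e' n (r * a)] form again an
    [s_family], which vanishes at 1 and hence on all of R at [m]. By commutativity the kernel of
    [e'] at [m] then lies in that of [e], and maximality gives equality. *)
Lemma sf_ker_eq (W : weyl_sys K I) (V V' : lmodType W) (e : maxD K I -> R -> V)
    (e' : maxD K I -> R -> V') (phi : {linear V -> V'}) :
  s_family e -> s_family e' -> s_spanned e' -> injective phi ->
  maximal_ideal [set r | e' m r = 0] -> e m 1 != 0 ->
  [set r | e m r = 0] = [set r | e' m r = 0].
Proof.
move=> He He' hE' phi_inj [_ _ NM] /eqP e1; have Om := orbit0 m.
have [a ha] : exists a, phi (e m 1) = e' m a.
  apply: (sf_weight He' Om hE') => f mf; rewrite -linearZ.
  by rewrite (sf_wspace He 1 Om mf) linear0.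
pose u n r := phi (e n r) - e' n (r * a).
have Hu : s_family u.
  split=> [n r s|n b r On|n i r On|n i r On]; rewrite /u.
  - by rewrite (sf_B He) mulrBl (sf_B He') linearB opprD addrACA -opprD.
  - by rewrite scalerBr -linearZ (sf_c He _ _ On) (sf_c He' _ _ On) mulrA.
  - by rewrite scalerBr -linearZ (sf_x He _ _ On) (sf_x He' _ _ On) mulrA.
  - by rewrite scalerBr -linearZ (sf_d He _ _ On) (sf_d He' _ _ On) mulrA.
have u1 : u m 1 = 0 by rewrite /u mul1r ha subrr.
have phiE r : phi (e m r) = e' m (r * a).
  apply/eqP; rewrite -subr_eq0; apply/eqP.
  by have := Defs.idealMl (sf_ideal Hu (@wsub0 _ _ _ V')) r u1; rewrite mulr1.
apply: NM => // [|r /= er]; first exact: (sf_ideal He (@wsub0 _ _ _ V)).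
apply: phi_inj; rewrite phiE linear0 RC.
exact: (Defs.idealMl (sf_ideal He' (@wsub0 _ _ _ V')) a er).
Qed.
End SFamilies.

Lemma quotient_by_ideal (R : nzRingType) (N : set R) : is_ideal N ->
  exists (Q : zmodType) (p : {additive R -> Q}) (mul : R -> Q -> Q),
    [/\ forall u, exists r, u = p r, forall r, p r = 0 <-> N r &
        forall a r, mul a (p r) = p (a * r)].
Proof.
move=> hN; pose P : {pred R} := fun r => `[< N r >].
have hP : zmod_closed P.
  split=> [|r s /asboolP Nr /asboolP Ns]; apply/asboolP; first exact: ideal0 hN.
  exact: idealB hN _ _ Nr Ns.
pose Pz : zmodClosed R := HB.pack P (GRing.isZmodClosed.Build R P hP).
pose Q : zmodType := Quotient.quot Pz.
pose p0 (r : R) : Q := \pi_(Quotient.quot Pz) r.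
have pB : zmod_morphism p0 by move=> r s; rewrite /p0 raddfB.
pose p : {additive R -> Q} := HB.pack p0 (GRing.isZmodMorphism.Build _ _ _ pB).
have pE r s : p r = p s <-> N (r - s).
  split; first by move=> /eqP; rewrite /= /p0 -Quotient.idealrBE => /asboolP.
  by move=> h; apply/eqP; rewrite /= /p0 -Quotient.idealrBE; apply/asboolP.
exists Q, p, (fun a u => p (a * repr u)); split.
- by move=> u; exists (repr u); rewrite /= /p0 reprK.
- by move=> r; rewrite -(raddf0 p) pE subr0.
move=> a r; apply/pE; rewrite -mulrBr; apply: idealMl hN _ _ _; apply/pE.
by rewrite /= /p0 reprK.
Qed.

Lemma scalar_rmorph (K : fieldType) (I : choiceType) (R : nzRingType)
    (c : {rmorphism PD K I -> R}) : exists k : K -> R,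
  [/\ forall a, c (cD I a) = k a, {morph k : a b / a + b}, {morph k : a b / a * b} & k 1 = 1].
Proof.
pose r : {rmorphism K -> PD K I} := @malgC _ K.
by exists (c \o r); split=> // [a b|a b|]; rewrite (rmorphD, rmorphM, rmorph1).
Qed.

Section SExistence.
Variables (K : fieldType) (I : choiceType) (q : nat) (m : maxD K I) (Ib : set I).
Hypothesis H : charp_axioms q m Ib.
Variables (R : nzRingType) (c : {rmorphism PD K I -> R}) (Vp Vm : I -> R).
Hypothesis HR : s_axioms m c Vp Vm.
Let RC := sx_comm HR.

Local Notation O := (G_orbit m).
Local Notation up i n := (act (sg 1 i) n).
Local Notation dn i n := (act (sg (-1) i) n).
Local Notation xq := (xc q m Vp).
Local Notation dq := (dc q m c Vm).
Let W : weyl_sys K I := weyl_system K I.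

Lemma xc_dc n i : O n -> xq (dn i n) i * dq n i = c (tv K i - ((hc q m n)@_i)%:~R) - 1.
Proof.
move=> On; rewrite RC; have := dc_xc H HR i (G_orbit_act (sg (-1) i) On).
rewrite up_dn => ->; rewrite (hc_dn H i i On) eqxx.
rewrite -(rmorph1 c) -rmorphB -addrA -opprD.
(* At the wrapping step the two sides differ by the integer q, which is 0 in [D]. *)
case: eqVneq => [->|_]; last by rewrite intrD.
by rewrite intrB subrK (PD_int I (cp_q H) (dvdzz q)).
Qed.

(** [model] over the whole orbit with coefficients R/N; no step leaves the orbit, so the boundary
    conditions are vacuous. *)
Lemma s_family_exists (N : set R) : is_ideal N ->
  exists (V : lmodType (weyl_algebra K I)) (e : maxD K I -> R -> V),
  [/\ @s_family K I q m R c Vp Vm W V e, @s_spanned K I m R W V e &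
      [set r | e m r = 0] = N].
Proof.
move=> hN; have [Q [p [mul [psurj p0 pM]]]] := quotient_by_ideal hN.
have mulB a : zmod_morphism (mul a).
  move=> u v; have [[r ->] [s ->]] := (psurj u, psurj v).
  by rewrite -raddfB !pM mulrBr raddfB.
have mulC a b u : mul a (mul b u) = mul b (mul a u).
  by have [r ->] := psurj u; rewrite !pM !mulrA (RC a b).
have mulD a b u : mul (a + b) u = mul a u + mul b u.
  by have [r ->] := psurj u; rewrite !pM mulrDl raddfD.
have mulM a b u : mul (a * b) u = mul a (mul b u).
  by have [r ->] := psurj u; rewrite !pM mulrA.
have mul_1 u : mul 1 u = u by have [r ->] := psurj u; rewrite pM mul1r.
have mul_B1 a u : mul (a - 1) u = mul a u - u.
  by have [r ->] := psurj u; rewrite !pM mulrBl mul1r raddfB.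
have [cc [ccE ccD ccM cc1]] := scalar_rmorph c.
have [||||||||||||||||||||||V [e [he eE]]] := @model K I Q (maxD K I) O (fun a => mul (cc a))
  (fun i n => mul (xq n i)) (fun i n => mul (dq n i))
  (fun i n => mul (c (tv K i - ((hc q m n)@_i)%:~R)))
  (fun i n => up i n) (fun i n => dn i n) (fun i => @dn_up K I i) (fun i => @up_dn K I i).
- by move=> i j n; rewrite -!actD addrC.
- by move=> i j n; rewrite -!actD addrC.
- by move=> i j n; rewrite -!actD addrC.
- by move=> a; apply: mulB.
- by move=> a b u; rewrite ccD mulD.
- by move=> a b u; rewrite ccM mulM.
- by move=> u; rewrite cc1 mul_1.
- by move=> i n; apply: mulB.
- by move=> i n; apply: mulB.
- by move=> a i n u; apply: mulC.
- by move=> a i n u; apply: mulC.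
- by move=> i n u On []; apply: G_orbit_act.
- by move=> i n u On []; apply: G_orbit_act.
- by move=> i j n u ij On _; rewrite /xc (hc_up H j i On) [j == i]eq_sym (negPf ij).
- by move=> i j n u ij On _; rewrite /dc (hc_up H j i On) [j == i]eq_sym (negPf ij).
- by move=> *; apply: mulC.
- by move=> *; apply: mulC.
- by move=> *; apply: mulC.
- by move=> i n u On _; rewrite -mulM (dc_xc H HR i On).
- by move=> i n u On []; apply: G_orbit_act.
- by move=> i n u On _; rewrite -mulM (xc_dc i On) mul_B1.
- by move=> i n u On []; apply: G_orbit_act.
pose e' n r : V := if (insub n : option O) is Some n' then e n' (p r) else 0.
have e'E (n : O) r : e' (val n) r = e n (p r) by rewrite /e' valK.
have hT n : O n -> exists n' : O, val n' = n by move=> h; exists (SigSub (mem_set h)).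
exists V, e'; split.
- split=> [n r s|n a r On|n i r On|n i r On].
  + by rewrite /e'; case: insub => [k|]; rewrite ?subrr // !raddfB.
  + have [n' <-] := hT n On; rewrite !e'E -wconstE (eE n' _).1.
    by rewrite ccE pM.
  + have [n' nn'] := hT n On; have [k kk] := hT _ (G_orbit_act (sg 1 i) On).
    rewrite -kk -nn' !e'E -pM.
    have [_ /(_ i)[h _ _ _]] := eE n' (p r); apply: h.
    by rewrite nn'.
  have [n' nn'] := hT n On; have [k kk] := hT _ (G_orbit_act (sg (-1) i) On).
  rewrite -kk -nn' !e'E -pM.
  have [_ /(_ i)[_ _ h _]] := eE n' (p r); apply: h.
  by rewrite nn'.
- move=> P P0 PD PE; apply: (@direct_sum_spanned K I W V _ _ e he) => // _ [n [u ->]].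
  have [r ->] := psurj u; apply: PE; exists (val n), r; rewrite e'E.
  by split=> //; exact: set_mem (valP n).
have [k kk] := hT _ (orbit0 m); apply/seteqP; split=> r /=; rewrite -kk e'E.
  by move/(@direct_sum_inj K I W V _ _ e he)/p0.
by move/p0 => ->; rewrite raddf0.
Qed.
End SExistence.

(** * Stabilizers and transport along the orbit in characteristic q *)

Section CharpAxioms.
Variables (K : fieldType) (I : choiceType) (q : nat) (m : maxD K I) (Ib : set I).
Hypothesis Kq : q \in [pchar K].

Lemma pchar_int0 (k : int) : (k%:~R == 0 :> K) = (q %| k)%Z.
Proof.
have abs_k : (k%:~R == 0 :> K) = (`|k|%N%:R == 0 :> K).
  case: k => // k; rewrite NegzE -[(- _)%:~R]/((- k.+1%:Z)%:~R) mulrNz oppr_eq0 abszN.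
  by [].
by rewrite abs_k -(dvdn_pcharf Kq) dvdzE.
Qed.

Lemma int_in_max (n : maxD K I) (k : int) : inm n k%:~R -> (q %| k)%Z.
Proof.
by move=> nk; rewrite -pchar_int0; apply: contrapT => /negP k0; apply: int_notin k0 nk.
Qed.

Lemma fixed_break : fixed_ideal m Ib -> maximal_break m Ib.
Proof.
move=> [hd hn]; have [dm|dm] := pselect (degenerate m); first exact: hd.
rewrite (hn dm); split=> [i []|j _ g gj]; apply: dm.
exact: (ex_intro2 _ _ (act g m) (ex_intro2 _ _ g Logic.I (erefl _)) (ex_intro _ j gj)).
Qed.

Lemma well_defined_rs g h (f : PD K I) : sigma_well_defined m -> act g m = act h m ->
  rs (act g m) (sh g f) = rs (act g m) (sh h f).
Proof.
move=> swd gh; apply: (etrans (rs_shE _ g f)).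
apply: (etrans (esym (res_shiftE f (erefl (act g m))))).
apply: (etrans (congr1 (fun F => F (res m f)) (swd g h gh))).
apply: (etrans (res_shiftE f (esym gh))); exact: esym (rs_shE _ h f).
Qed.

Lemma PD_int_eq (a b : int) : (q %| a - b)%Z -> a%:~R = b%:~R :> PD K I.
Proof. by move/(PD_int I Kq); rewrite intrB => /eqP; rewrite subr_eq0 => /eqP. Qed.

Lemma sh_dvd g h (f : PD K I) : (forall i, (q %| g@_i - h@_i)%Z) -> sh g f = sh h f.
Proof.
move=> gh; elim/polyD_tv_ind: f => [a|i|f f' IH IH'|f f' IH IH'].
- exact: etrans (shC g a) (esym (shC h a)).
- apply: (etrans (sh_tv K g i)); apply: (etrans _ (esym (sh_tv K h i))).
  exact: (congr1 (fun z => tv K i - z) (PD_int_eq (gh i))).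
- by rewrite !rmorphD IH IH'.
by rewrite !rmorphM IH IH'.
Qed.

(** If two exponents move [m] to the same ideal, well-definedness on the class of [t_i] puts the
    difference of their coordinates into a maximal ideal, so q divides it. Conversely a shift by
    multiples of q is the identity on [D]. *)
Lemma charp_axiomsP : fixed_ideal m Ib -> sigma_well_defined m -> charp_axioms q m Ib.
Proof.
move=> /fixed_break [hI hb] swd; split; first exact: Kq.
- move=> g h; split=> [gh i|gh].
    have /rsP := well_defined_rs (tv K i) swd gh.
    rewrite (sh_tv K g i) (sh_tv K h i) opprD opprK addrACA subrr add0r.
    by rewrite -intrN -intrD => /int_in_max hh; apply: (dvd_eq _ (rpredB (dvdz0 q) hh)); lia.
  apply: maxD_inj; apply/seteqP.
  have sE (f : PD K I) : sh (- g) f = sh (- h) f.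
    apply: sh_dvd => i; rewrite !mcoeffN.
    apply: (dvd_eq _ (rpredB (dvdz0 q) (gh i))).
    by rewrite sub0r opprB opprK addrC.
  split=> f /(act_mem _ m f).
    by rewrite sE => /(act_mem _ m f).
  by rewrite -sE => /(act_mem _ m f).
- by move=> i /hI; rewrite tvE.
move=> i k mk.
have Ii : Ib i.
  apply: contrapT => Ii; apply: (hb i Ii (sg k i)).
  by have : inm (act (sg k i) m) (tv K i); [apply/act_tv0; rewrite mcoeff_sg eqxx|rewrite tvE].
split=> //; apply: (@int_in_max m); have := hI i Ii; rewrite -tvE => mi.
by have := maxB mk mi; rewrite addrAC subrr add0r.
Qed.
End CharpAxioms.

Lemma coeff_mapU (E : choiceType) (L L' : zmodType) (phi : L -> L') (a : L) (u : E) :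
  phi 0 = 0 -> coeff_map phi << a *g u >> = << phi a *g u >>.
Proof.
move=> p0; rewrite /coeff_map msuppU; case: eqVneq => [->|a0].
  by rewrite big_seq_fset0 p0 monalgU0.
by rewrite big_seq_fset1 mcoeffUU.
Qed.

Section Transport.
Variables (K : fieldType) (I : choiceType) (q : nat) (m : maxD K I) (Ib : set I).
Hypothesis H : charp_axioms q m Ib.
Hypothesis swd : sigma_well_defined m.
Local Notation O := (G_orbit m).
Implicit Types (n : maxD K I) (g h : {malg int[I]}).

Lemma orbit_neq n i : O n -> act (sg 1 i) n <> n.
Proof.
move=> On e; have := hc_up H i i On; rewrite e eqxx.
have := hc_bound H n i; have := cp_gt1 H; case: eqVneq => *; lia.
Qed.

Lemma res_shift_eq g h n' : act g m = n' -> act h m = n' ->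
  @res_shift K I g m n' = @res_shift K I h m n'.
Proof. by move=> gn hn; have := swd (etrans gn (esym hn)); rewrite gn. Qed.

(** The canonical identification of residue fields along the orbit: by well-definedness every
    exponent leading from [m] to [n] induces it, which makes it compatible with further shifts
    ([tl_shift]). *)
Definition tl n : residue m -> residue n := res_shift (- hc q m n) n.

Lemma tl_morph n : O n -> zmod_morphism (tl n) * monoid_morphism (tl n).
Proof. by move=> On; apply: res_shift_morph; exact: (hcK H On). Qed.

Lemma tl_rs n f : O n -> tl n (rs m f) = rs n (sh (- hc q m n) f).
Proof.
move=> On; apply: (etrans (res_shiftE f (hcK H On))).
exact: esym (rs_shE n _ f).
Qed.

Lemma tl_shift g n n' a : O n -> act g n = n' -> res_shift g n' (tl n a) = tl n' a.
Proof.
move=> On gn; have On' : O n' by rewrite -gn; apply: G_orbit_act.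
have e : act (g + (- hc q m n)) m = n' by rewrite actD (hcK H On).
rewrite /tl -(res_shift_eq e (hcK H On')); elim/residue_ind: a => f.
rewrite (res_shiftE f (hcK H On)) (res_shiftE _ gn) (res_shiftE f e).
exact: (congr1 (res n') (esym (shiftD _ _ f))).
Qed.

Lemma tl_rep g n a : act g m = n -> res_shift g n a = tl n a.
Proof.
move=> gn; have On : O n by exists g.
exact: (congr1 (fun F => F a) (res_shift_eq gn (hcK H On))).
Qed.

Lemma tl_surj n b : O n -> exists a, tl n a = b.
Proof.
move=> On; elim/rs_ind: b => f; exists (rs m (sh (hc q m n) f)).
by rewrite (tl_rs _ On) -shD addNr sh0.
Qed.
End Transport.

Section SpanExtensions.
Variables (A B : nzRingType) (F G : A -> B) (U : set A).
Hypotheses (FB : zmod_morphism F) (GB : zmod_morphism G).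
Hypothesis Uspan : forall P : A -> Prop, P 0 -> (forall a b, P a -> P b -> P (a + b)) ->
  (forall u, U u -> P u) -> forall a, P a.

Let F0 : F 0 = 0 := zmod_morphism0 FB.
Let FD : {morph F : a b / a + b} := zmod_morphismD FB.
Let G0 : G 0 = 0 := zmod_morphism0 GB.
Let GD : {morph G : a b / a + b} := zmod_morphismD GB.

Lemma mul_morph_span : (forall u v, U u -> U v -> F (u * v) = F u * F v) ->
  {morph F : a b / a * b}.
Proof.
move=> FM a b; elim/Uspan: b a => [a|b b' IH IH' a|v Uv].
- by rewrite !(mulr0, F0).
- by rewrite mulrDr !FD IH IH' mulrDr.
elim/Uspan=> [|a a' IH IH'|u Uu]; first by rewrite !(mul0r, F0).
  by rewrite mulrDl !FD IH IH' mulrDl.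
exact: FM.
Qed.

Lemma additive_ext_span : (forall u, U u -> F u = G u) -> F =1 G.
Proof.
move=> FG; elim/Uspan=> [|a a' IH IH'|]; first by rewrite F0 G0.
  by rewrite FD GD IH IH'.
exact: FG.
Qed.
End SpanExtensions.

(** * The rings R(n) and their generators *)

Section ConcreteR.
Variables (K : fieldType) (I : choiceType) (q : nat) (m : maxD K I) (Ib : set I).
Hypothesis H : charp_axioms q m Ib.
Hypothesis swd : sigma_well_defined m.
Variables (Gamma : set I) (xi : Gamma -> bool).
Hypothesis GI : Gamma `<=` Ib.
Local Notation O := (G_orbit m).
Local Notation E := (expo Ib Gamma).
Local Notation R n := (R_ring Ib xi n).
Local Notation sU n := (skewU (tau_twist Ib xi n)).
Implicit Types (n : maxD K I).

(** [sigma_i] fixes no weight of the orbit, because it changes [hc_i] when q > 1; so all [tau_i] are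
    1 and R(n) is commutative. *)
Lemma tau_trivial n (u : E) : O n -> @tau_fun K I Ib Gamma xi n u =1 id.
Proof.
move=> On; elim/residue_ind=> f; rewrite tau_funE.
suff -> : tau_exp xi n u = 0 by rewrite shift0.
apply/malgP => i; rewrite tau_expE mcoeff0.
by case: asboolP => // /(orbit_neq H On).
Qed.

Lemma R_mulU n a b (u v : E) : O n -> sU n a u * sU n b v = sU n (a * b) (u + v).
Proof.
move=> On; apply: (etrans (skew_mulUU (tau_twist Ib xi n) a b u v)).
by rewrite -[tau_twist _ _ _ _ _]/(@tau_fun K I Ib Gamma xi n u b) (tau_trivial u On).
Qed.

Lemma R_1U n : sU n 1 0 = 1. Proof. by []. Qed.

Lemma R_ind n (P : R n -> Prop) : P 0 -> (forall f g, P f -> P g -> P (f + g)) ->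
  (forall a u, P (sU n a u)) -> forall f, P f.
Proof. exact: skew_ind. Qed.

Lemma R_comm n : O n -> commutative (@GRing.mul (R n)).
Proof.
move=> On f; elim/R_ind => [|h h' IH IH'|a u]; first by rewrite mul0r mulr0.
  by rewrite mulrDl mulrDr IH IH'.
elim/R_ind: f => [|h h' IH IH'|b v].
- exact: (etrans (mul0r _) (esym (mulr0 _))).
- by rewrite mulrDl mulrDr IH IH'.
apply: (etrans (R_mulU b a v u On)); apply: (etrans _ (esym (R_mulU a b u v On))).
exact: (congr2 (skewU _) (mulrC b a) (addrC v u)).
Qed.

Lemma R_rmorph n n' (phi : residue n -> residue n') (F : R n -> R n') : O n -> O n' ->
  zmod_morphism phi * monoid_morphism phi -> zmod_morphism F ->
  (forall a u, F (sU n a u) = sU n' (phi a) u) -> monoid_morphism F.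
Proof.
move=> On On' [pB [p1 pM]] FB FU; split; first by rewrite -R_1U FU p1.
apply: (mul_morph_span FB (U := [set f | exists a u, f = sU n a u])).
  by move=> P P0 PD PU; apply: R_ind => // a u; apply: PU; exists a, u.
move=> _ _ [a [u ->]] [b [v ->]].
apply: (etrans (congr1 F (R_mulU a b u v On))).
apply: (etrans (FU (a * b) (u + v))).
apply: (etrans _ (esym (congr2 *%R (FU a u) (FU b v)))).
apply: (etrans _ (esym (R_mulU (phi a) (phi b) u v On'))).
exact: (congr1 (skewU _ ^~ (u + v)) (pM a b)).
Qed.

Lemma R_shiftB g n n' : act g n = n' -> zmod_morphism (@R_shift K I Ib Gamma xi g n n').
Proof. by move=> gn; apply: coeff_map_zmod; apply: (res_shift_morph gn).1. Qed.

Lemma R_shiftU g n n' a (u : E) : act g n = n' ->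
  R_shift g n' (sU n a u) = sU n' (res_shift g n' a) u.
Proof.
move=> gn; apply: coeff_mapU; exact: zmod_morphism0 (res_shift_morph gn).1.
Qed.

Lemma R_additive_ext n n' (F G : R n -> R n') : zmod_morphism F -> zmod_morphism G ->
  (forall a u, F (sU n a u) = G (sU n a u)) -> F =1 G.
Proof.
move=> FB GB FG; apply: (additive_ext_span FB GB (U := [set f | exists a u, f = sU n a u])).
  by move=> P P0 PD PU; apply: R_ind => // a u; apply: PU; exists a, u.
by move=> _ [a [u ->]]; apply: FG.
Qed.

Definition TR n : R m -> R n := R_shift (- hc q m n) n.

Lemma TR_B n : O n -> zmod_morphism (TR n).
Proof. by move=> On; apply: R_shiftB; exact: (hcK H On). Qed.

Lemma TR_U n a (u : E) : O n -> TR n (sU m a u) = sU n (tl q n a) u.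
Proof. by move=> On; apply: R_shiftU; exact: (hcK H On). Qed.

Lemma TR_M n : O n -> monoid_morphism (TR n).
Proof.
move=> On; apply: (R_rmorph (orbit0 m) On (tl_morph H On) (TR_B On)) => a u.
exact: (TR_U a u On).
Qed.

Lemma TR_0 n : O n -> TR n 0 = 0.
Proof. by move=> On; apply: zmod_morphism0 (TR_B On). Qed.

Lemma TR_D n f g : O n -> TR n (f + g) = TR n f + TR n g.
Proof. by move=> On; apply: zmod_morphismD (TR_B On) f g. Qed.

Lemma TR_shift g n n' f : O n -> act g n = n' -> R_shift g n' (TR n f) = TR n' f.
Proof.
move=> On gn; have On' : O n' by rewrite -gn; apply: G_orbit_act.
apply: (R_additive_ext (F := fun f => R_shift g n' (TR n f)) _ (TR_B On')) => [r s|a u].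
  by rewrite (TR_B On) (R_shiftB gn).
by rewrite !TR_U // (R_shiftU _ _ gn) (tl_shift H swd _ On gn).
Qed.

Lemma TR_rep g n f : act g m = n -> R_shift g n f = TR n f.
Proof.
move=> gn; have On : O n by exists g.
apply: (R_additive_ext (R_shiftB gn) (TR_B On)) => a u.
by rewrite TR_U // (R_shiftU _ _ gn) (tl_rep H swd _ gn).
Qed.

Lemma TR_back n f : O n -> R_shift (hc q m n) m (TR n f) = f.
Proof.
move=> On; have e : act (hc q m n) n = m.
  by rewrite -{2}(hcK H On) -actD addrN act0.
rewrite (TR_shift _ On e) -(TR_rep _ (act0 m)).
apply: (R_additive_ext (G := id) (R_shiftB (act0 m)) (fun _ _ => erefl _)) => a u.
apply: (etrans (R_shiftU a u (act0 m))); apply: (congr1 (skewU _ ^~ u)).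
by elim/residue_ind: a => f0; rewrite (res_shiftE _ (act0 m)) shift0.
Qed.

Lemma TR_inj n : O n -> injective (TR n).
Proof. by move=> On f f' e; rewrite -(TR_back f On) e (TR_back f' On). Qed.

Lemma TR_surj n f : O n -> exists f0, f = TR n f0.
Proof.
move=> On; elim/R_ind: f => [|f g [f0 ->] [g0 ->]|a u].
- by exists 0; rewrite (TR_0 On).
- by exists (f0 + g0); rewrite (TR_D _ _ On).
have [a0 <-] := tl_surj H a On; exists (sU m a0 u).
by rewrite (TR_U _ _ On).
Qed.

Fact cR_subproof : {c : {rmorphism PD K I -> R m} | forall f, c f = sU m (rs m f) 0}.
Proof.
pose c0 (f : PD K I) : R m := sU m (rs m f) 0.
have cB : zmod_morphism c0.
  move=> f f'; apply: (etrans (congr1 (skewU _ ^~ 0) (rsB m f f'))); exact: monalgUB.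
have cM : monoid_morphism c0.
  split; first exact: (congr1 (skewU _ ^~ 0) (rs1 m)).
  move=> f f'; apply: (etrans (congr1 (skewU _ ^~ 0) (rsM m f f'))).
  apply: (etrans _ (esym (R_mulU _ _ 0 0 (orbit0 m)))).
  exact: (congr1 (skewU _ _) (esym (addr0 0))).
pose h1 := GRing.isZmodMorphism.Build _ _ c0 cB.
pose h2 := GRing.isMonoidMorphism.Build _ _ c0 cM.
pose c : {rmorphism PD K I -> R m} := HB.pack c0 h1 h2.
by exists c.
Qed.
Definition cR : {rmorphism PD K I -> R m} := sval cR_subproof.
Lemma cRE f : cR f = sU m (rs m f) 0. Proof. exact: (svalP cR_subproof). Qed.

Lemma cR0 f : inm m f -> cR f = 0.
Proof.
move=> mf; apply: (etrans (cRE f)).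
apply: (etrans (congr1 (skewU _ ^~ 0) (proj2 (rs_eq0 m f) mf))); exact: monalgU0.
Qed.

Lemma cR_mulU f b (v : E) : cR f * sU m b v = sU m (rs m f * b) v.
Proof.
apply: (etrans (congr1 ( *%R^~ _) (cRE f))).
apply: (etrans (R_mulU _ _ _ _ (orbit0 m))); exact: (congr1 (skewU _ _) (add0r v)).
Qed.

Definition vR k i : R m := R_var Ib xi m k i.

Lemma expo_varE k i : (Gamma i /\ 0 <= k) \/ ~ Ib i ->
  \val (expo_var Ib Gamma k i) = sg k i.
Proof.
move=> h; rewrite insubdK //; apply/asboolP => j; rewrite mcoeff_sg.
have [<-|_] := eqVneq i j; last by [].
by case: h => [[Gi k0]|Ii]; split=> // /GI.
Qed.

Lemma xi_isG b i : xi_is xi b i -> Gamma i.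
Proof. by case=> j <- _; apply: set_mem (valP j). Qed.

Lemma xi_is_total i : Gamma i -> xi_is xi true i \/ xi_is xi false i.
Proof.
move=> Gi; pose j : Gamma := SigSub (mem_set Gi).
by case e: (xi j); [left|right]; exists j.
Qed.

Lemma xi_is_excl i : xi_is xi true i -> xi_is xi false i -> False.
Proof. by case=> j <- xj [k /val_inj -> ]; rewrite xj. Qed.

(** [VpR] and [VmR] are the coefficients [x_coef] and [d_coef] of the wrapping steps, read in
    R(m). *)
Definition VpR i : R m := if `[< xi_is xi true i >] then vR 1 i
  else if `[< ~ Ib i >] then vR 1 i else 0.
Definition VmR i : R m := if `[< xi_is xi false i >] then vR 1 i
  else if `[< ~ Ib i >] then vR (-1) i * cR (tv K i) else 0.

Lemma VmR_VpR i : VmR i * VpR i = cR (tv K i).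
Proof.
have [Ii|Ii] := pselect (Ib i).
  have -> : cR (tv K i) = 0 by apply: cR0; apply: (cp_Ib H).
  rewrite /VmR /VpR (asboolF (P := ~ Ib i)) //.
  case: asboolP => [xf|xf]; case: asboolP => [xt|xt]; rewrite ?(mulr0, mul0r) //.
  by case: (xi_is_excl xt xf).
have nG b : ~ xi_is xi b i by move/xi_isG/GI.
rewrite /VmR /VpR !(asboolF (nG _)) (asboolT Ii) (R_comm (orbit0 m)) mulrA.
suff -> : vR 1 i * vR (-1) i = 1 by rewrite mul1r.
apply: (etrans (R_mulU 1 1 _ _ (orbit0 m))).
apply: (etrans (congr1 (skewU _ ^~ _) (mulr1 1))); apply: (congr1 (skewU _ 1)).
by apply: val_inj; rewrite raddfD /= !expo_varE; [rewrite -sgD subrr sg0|right|right].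
Qed.

(** A monomial is built one variable at a time. Each variable [a_i], [b_i] or [c_i] is one of the
    generators, and [c_i^-1] is one up to a unit of [D] modulo [m]. *)
Lemma R_gen (J : set (R m)) : J 0 -> (forall r s, J r -> J s -> J (r + s)) ->
  (forall f r, J r -> J (cR f * r)) -> (forall i r, J r -> J (VpR i * r)) ->
  (forall i r, J r -> J (VmR i * r)) -> forall a r, J r -> J (a * r).
Proof.
move=> J0 JD Jc Jp Jm a r Jr; elim/R_ind: a => [|a b Ja Jb|l u].
- by rewrite mul0r.
- by rewrite mulrDl; apply: JD.
have -> : sU m l u = cR (repr l) * sU m 1 u.
  apply: (etrans _ (esym (cR_mulU _ _ _))); apply: (congr1 (skewU _ ^~ u)).
  exact: (etrans (esym (rs_repr l)) (esym (mulr1 _))).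
rewrite -mulrA; apply: (Jc); move: r Jr.
have main : forall g (hg : admissible Ib Gamma g) r, J r -> J (sU m 1 (Expo hg) * r).
  elim/lattice_ind=> [hg r Jr|g i gi IH hg r Jr|g i gi IH hg r Jr].
  - suff -> : Expo hg = 0 by rewrite R_1U mul1r.
    exact: val_inj.
  - have /asboolP ha := hg.
    have hg' : admissible Ib Gamma g.
      apply/asboolP => j; have := ha j; rewrite coD.
      case: eqVneq => [<-|_]; rewrite ?addr0 //; case=> h1 h2; split=> // Ii Gi.
      by have := h2 Ii Gi; lia.
    have Gi : Gamma i \/ ~ Ib i.
      apply: contrapT => h; have [h1|h1] := pselect (Gamma i); first by apply: h; left.
      have [h2|h2] := pselect (Ib i); last by apply: h; right.
      by have := (ha i).2 h2 h1; rewrite coD eqxx; lia.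
    have uE : Expo hg = expo_var Ib Gamma 1 i + Expo hg'.
      apply: val_inj; rewrite raddfD /= expo_varE; last first.
        by case: Gi => h; [left|right].
      exact: addrC.
    have -> : sU m 1 (Expo hg) = vR 1 i * sU m 1 (Expo hg').
      apply: (etrans _ (esym (R_mulU 1 1 _ _ (orbit0 m)))).
      exact: (congr2 (skewU _) (esym (mulr1 1)) uE).
    have Jr' := IH hg' r Jr; rewrite -mulrA; case: Gi => [/xi_is_total[xt|xf]|Ii].
    + by have := Jp i _ Jr'; rewrite /VpR (asboolT xt).
    + by have := Jm i _ Jr'; rewrite /VmR (asboolT xf).
    have := Jp i _ Jr'; rewrite /VpR (asboolT Ii).
    by rewrite (asboolF (P := xi_is xi true i)) // => /xi_isG/GI.
  have /asboolP ha := hg.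
  have Ii : ~ Ib i.
    move=> Ii; have := ha i; rewrite coD eqxx => -[h1 h2].
    by have [Gi|Gi] := pselect (Gamma i); [have := h1 Gi|have := h2 Ii Gi]; lia.
  have hg' : admissible Ib Gamma g.
    apply/asboolP => j; have := ha j; rewrite coD.
    by case: eqVneq => [<-|_]; rewrite ?addr0 //; split=> // /GI.
  have uE : Expo hg = expo_var Ib Gamma (-1) i + Expo hg'.
    apply: val_inj; rewrite raddfD /= expo_varE; last by right.
    exact: addrC.
  (* The generator is [c_i^-1 t_i]. Outside [Ib] the class of [t_i] is a unit of the residue field,
     and multiplying by its inverse [f] isolates [c_i^-1]. *)
  have [f hf] := max_inv (tv_notin H (k := 0) (fun h => Ii h.1)).
  rewrite addr0 in hf.
  have cf : cR f * cR (tv K i) = 1.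
    by rewrite -rmorphM -(rmorph1 cR); apply/eqP; rewrite -subr_eq0 -rmorphB (cR0 hf).
  have -> : sU m 1 (Expo hg) = cR f * (vR (-1) i * cR (tv K i) * sU m 1 (Expo hg')).
    rewrite [vR _ _ * _](R_comm (orbit0 m)) !mulrA cf mul1r.
    apply: (etrans _ (esym (R_mulU 1 1 _ _ (orbit0 m)))).
    exact: (congr2 (skewU _) (esym (mulr1 1)) uE).
  have nxf : ~ xi_is xi false i by move/xi_isG/GI.
  have VE : VmR i = vR (-1) i * cR (tv K i) by rewrite /VmR (asboolF nxf) (asboolT Ii).
  have mulA4 (A : nzRingType) (a b c d : A) : a * (b * c) * d = a * (b * (c * d)).
    by rewrite !mulrA.
  rewrite -VE mulA4; exact: (Jc f _ (Jm i _ (IH hg' r Jr))).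
by case: u => g hg; apply: main.
Qed.

Lemma R_s_axioms : s_axioms m cR VpR VmR.
Proof.
split; [exact: R_comm (orbit0 m)|exact: cR0|exact: VmR_VpR|exact: R_gen].
Qed.
End ConcreteR.

(** * Identification with the modules S(O, Gamma, xi, N) *)

Section IsS.
Variables (K : fieldType) (I : choiceType) (q : nat) (m : maxD K I) (Ib : set I).
Hypothesis H : charp_axioms q m Ib.
Hypothesis swd : sigma_well_defined m.
Local Notation O := (G_orbit m).
Local Notation up i n := (act (sg 1 i) n).
Local Notation dn i n := (act (sg (-1) i) n).
Implicit Types (n : maxD K I).
Let W : weyl_sys K I := weyl_system K I.

Lemma hatG_hc i n : O n -> hatG_orbit i m n <-> (hc q m n)@_i = 0.
Proof.
move=> On; split=> [[g gi <-]|h].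
  by rewrite (hcE H) gi /red oppr0 mod0z.
by exists (- hc q m n); [rewrite /= mcoeffN h oppr0|exact: (hcK H On)].
Qed.

Lemma hatG_up_hc i n : O n ->
  [set act (sg 1 i) n0 | n0 in hatG_orbit i m] n <-> (hc q m n)@_i = q%:Z - 1.
Proof.
move=> On; have Od := G_orbit_act (sg (-1) i) On.
have -> : [set act (sg 1 i) n0 | n0 in hatG_orbit i m] n <-> hatG_orbit i m (dn i n).
  split=> [[n0 h <-]|h]; first by rewrite dn_up.
  by exists (dn i n) => //; rewrite up_dn.
rewrite (hatG_hc i Od) (hc_dn H i i On) eqxx; have := hc_bound H n i.
by case: eqVneq => [->//|]; lia.
Qed.

Section OneParam.
Variable P : S_param m Ib.
Local Notation GI := (@pGamma_sub _ _ _ _ P).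
Local Notation xi := (@pxi _ _ _ _ P).
Local Notation R n := (R_ring Ib xi n).
Local Notation TR n := (@TR K I q m Ib (pGamma P) xi n).
Local Notation c := (cR H xi).
Local Notation Vp := (@VpR K I m Ib (pGamma P) xi).
Local Notation Vm := (@VmR K I q m Ib H (pGamma P) xi).

Lemma TR_const n f : O n ->
  R_const Ib xi (rs n f) = TR n (c (sh (hc q m n) f)).
Proof.
move=> On; apply: (etrans _ (esym (congr1 (TR n) (cRE H xi _)))).
apply: (etrans _ (esym (TR_U H xi _ 0 On))).
apply: (congr1 (skewU _ ^~ 0)); apply: (etrans _ (esym (tl_rs H _ On))).
by rewrite -shD addNr sh0.
Qed.

Lemma TR_1 n : O n -> TR n 1 = 1.
Proof. by move=> On; exact: (TR_M H xi On).1. Qed.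

Lemma TR_mul n f g : O n -> TR n (f * g) = TR n f * TR n g.
Proof. by move=> On; exact: (TR_M H xi On).2. Qed.

Lemma TR_var n k i : O n -> TR n (vR m Ib xi k i) = R_var Ib xi n k i.
Proof.
move=> On; apply: (etrans (TR_U H xi _ _ On)); apply: (congr1 (skewU _ ^~ _)).
exact: (tl_morph H On).2.1.
Qed.

Lemma x_coefE n i : O n -> x_coef P n (up i n) i = TR (up i n) (xc q m Vp n i).
Proof.
move=> On; have On' := G_orbit_act (sg 1 i) On; rewrite /x_coef /xc.
case: eqVneq => [h|h].
  rewrite (asboolF (P := ~ hatG_orbit i m n)); last by apply; apply/(hatG_hc i On).
  rewrite /VpR; case: asboolP => _; first by rewrite (TR_var _ _ On').
  by case: asboolP => _; [rewrite (TR_var _ _ On')|rewrite (TR_0 H xi On')].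
rewrite (asboolT (P := ~ hatG_orbit i m n)); last by move/(hatG_hc i On)/eqP; apply/negP.
exact: (esym (TR_1 On')).
Qed.

Lemma d_coefE n i : O n -> d_coef P n (dn i n) i = TR (dn i n) (dc q m c Vm n i).
Proof.
move=> On; have On' := G_orbit_act (sg (-1) i) On.
have tE : R_const Ib xi (res (dn i n) (tvar K i)) = TR (dn i n) (c (sh (hc q m (dn i n)) (tv K i))).
  apply: (etrans _ (TR_const _ On')).
  by rewrite -[res _ (tvar K i)](congr1 (res (dn i n)) (tvE K i)).
rewrite /d_coef tE (sh_tv K (hc q m (dn i n)) i) /dc (hc_dn H i i On) eqxx.
case: eqVneq => [h|h].
  rewrite (asboolF (P := ~ _)); last by apply; apply/(hatG_up_hc i On).
  rewrite /VmR; case: asboolP => _; first by rewrite (TR_var _ _ On').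
  case: asboolP => _; last by rewrite (TR_0 H xi On').
  rewrite (TR_mul _ _ On') (TR_var _ _ On'); apply: (congr1 ( *%R _)).
  exact: (congr1 (fun z => TR (dn i n) (c z)) (subr0 (tv K i))).
have hn : ~ [set act (sg 1 i) n0 | n0 in hatG_orbit i m] n.
  by move/(hatG_up_hc i On)/eqP; apply/negP.
rewrite (asboolT hn); exact: erefl.
Qed.

Lemma sigma_N_TR (n : O) r : @sigma_N K I m Ib P n (TR (val n) r) <-> pN r.
Proof.
have On := set_mem (valP n); have e := sigma_repP n.
split=> [/asboolP[r0 Nr]|Nr].
  by rewrite (TR_rep H swd r0 e) => /(TR_inj H swd On) ->.
apply/asboolP; exists r; first exact: Nr.
exact: (esym (TR_rep H swd r e)).
Qed.

Lemma S_class_eq (n : O) r r' :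
  S_class (n := n) (TR (val n) r) = S_class (n := n) (TR (val n) r') <-> pN (r - r').
Proof.
have On := set_mem (valP n); rewrite -(sigma_N_TR n) (TR_B H On).
split; first by move/eqP; rewrite /S_class -Quotient.idealrBE.
by move=> h; apply/eqP; rewrite /S_class -Quotient.idealrBE.
Qed.

Lemma S_class_surj (n : O) (s : S_summand P n) : exists r, s = S_class (n := n) (TR (val n) r).
Proof.
have [r hr] := TR_surj H (repr s) (set_mem (valP n)).
by exists r; rewrite -hr /S_class reprK.
Qed.

Lemma S_classB (n : O) r r' : S_class (n := n) (TR (val n) r) - S_class (n := n) (TR (val n) r') =
  S_class (n := n) (TR (val n) (r - r')).
Proof. by rewrite (TR_B H (set_mem (valP n))) /S_class raddfB. Qed.

Variables (V : lmodType (weyl_algebra K I)) (e : maxD K I -> R m -> V).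
Hypothesis He : @s_family K I q m (R m) c Vp Vm W V e.
Hypothesis hE : @s_spanned K I m (R m) W V e.
Hypothesis eN : [set r | e m r = 0] = @pN _ _ _ _ P.
Let HR := R_s_axioms H xi (@pGamma_sub _ _ _ _ P).

Lemma sf_eq0 n r : O n -> e n r = 0 <-> pN r.
Proof.
move=> On; rewrite -[pN r]/(@pN _ _ _ _ P r) -eN.
exact: (@sf_move K I q m Ib H (R m) c Vp Vm HR W V e He _ (@wsub0 K I W V) n r On).
Qed.

Lemma sf_eq n r r' : O n -> e n r = e n r' <-> pN (r - r').
Proof.
move=> On; rewrite -(sf_eq0 _ On) (sf_B He).
by split=> [->|/eqP]; [rewrite subrr|rewrite subr_eq0 => /eqP].
Qed.

Lemma s_summand_map : exists E : forall n : O, {additive S_summand P n -> V},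
  forall (n : O) r, E n (S_class (n := n) (TR (val n) r)) = e (val n) r.
Proof.
have ex (n : O) : {E : {additive S_summand P n -> V} |
    forall r, E (S_class (n := n) (TR (val n) r)) = e (val n) r}.
  pose ch (s : S_summand P n) := sval (cid (S_class_surj s)).
  have chE s : s = S_class (n := n) (TR (val n) (ch s)) := svalP (cid (S_class_surj s)).
  pose E0 s := e (val n) (ch s).
  have E0E r : E0 (S_class (n := n) (TR (val n) r)) = e (val n) r.
    apply/(sf_eq _ _ (set_mem (valP n)))/(S_class_eq n).
    exact: esym (chE _).
  have EB : zmod_morphism E0.
    move=> s s'; rewrite {1}(chE s) {1}(chE s') S_classB E0E.
    exact: (sf_B He).
  pose E : {additive S_summand P n -> V} := HB.pack E0 (GRing.isZmodMorphism.Build _ _ _ EB).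
  by exists E.
by exists (fun n : O => sval (ex n)) => n r; apply: (svalP (ex n)).
Qed.

(** Under [TR] the ideal sigma_n(N) corresponds to N. The kernel of [e n] is N at every weight by
    [sf_move], so [e] induces injections of the summands with the prescribed action. *)
Lemma is_S_intro : is_S P V.
Proof.
have [E EE] := s_summand_map; exists E; split.
  apply: (@direct_sum_crit K I W V _ (fun n : O => val n) _ E val_inj).
  - move=> n s; have [r ->] := S_class_surj s; rewrite EE.
    exact: (sf_wspace H HR He r (set_mem (valP n))).
  - move=> n s; have [r ->] := S_class_surj s; have On := set_mem (valP n).
    rewrite EE => /(sf_eq0 _ On) Nr.
    suff -> : S_class (n := n) (TR (val n) r) = S_class (n := n) (TR (val n) 0).
      by rewrite (TR_0 H xi On) /S_class raddf0.
    by apply/(S_class_eq n); rewrite subr0.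
  move=> Q Q0 QD QE; apply: hE => // _ [n [r [On ->]]]; apply: QE.
  pose n' : O := SigSub (mem_set On).
  by exists n', (S_class (n := n') (TR n r)); rewrite (EE n').
move=> n f; have On := set_mem (valP n); have [r ->] := TR_surj H f On.
split=> [a|n' i]; last split=> n'E.
- apply: (etrans (congr1 ( *:%R (weyl_const I a)) (EE n r))).
  apply: (etrans (wconstE _ _)); apply: (etrans (sf_c He a r On)).
  apply: (etrans (esym (EE n _))); apply: (congr1 (fun z => E n (S_class z))).
  apply: (etrans (TR_mul _ _ On)); apply: (congr1 ( *%R^~ _)).
  apply: (etrans _ (esym (TR_const (cD I a) On))).
  by rewrite shC.
- have On' := set_mem (valP n').
  apply: (etrans (congr1 ( *:%R (weyl_x K i)) (EE n r))).
  apply: (etrans (sf_x He i r On)); rewrite -n'E.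
  apply: (etrans (esym (EE n' _))); apply: (congr1 (fun z => E n' (S_class z))).
  apply: (etrans (TR_mul _ _ On')).
  apply: (congr2 *%R _ (esym (TR_shift H swd r On (esym n'E)))).
  by rewrite n'E; apply: (esym (x_coefE i On)).
have On' := set_mem (valP n').
apply: (etrans (congr1 ( *:%R (weyl_d K i)) (EE n r))).
apply: (etrans (sf_d He i r On)); rewrite -n'E.
apply: (etrans (esym (EE n' _))); apply: (congr1 (fun z => E n' (S_class z))).
apply: (etrans (TR_mul _ _ On')).
apply: (congr2 *%R _ (esym (TR_shift H swd r On (esym n'E)))).
by rewrite n'E; apply: (esym (d_coefE i On)).
Qed.
End OneParam.

Lemma is_S_iso (P : S_param m Ib) V V' : is_S P V -> is_S P V' -> isomorphic V V'.
Proof.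
move=> [E [hE EE]] [E' [hE' EE']].
have [|phi [phi_bij _]] := @direct_sum_iso K I W _ _ V V' E E' hE hE'; last by exists phi.
have hT n : O n -> exists n' : O, val n' = n by move=> h; exists (SigSub (mem_set h)).
move=> a n s; have On := set_mem (valP n).
have [f ->] : exists f, s = S_class (n := n) f.
  by exists (repr s); exact: (esym (reprK s)).
have [h1 h2] := EE n f; have [h1' h2'] := EE' n f.
case=> [[b ->]|[[i ->]|[i ->]]].
- eexists; eexists; split; [exact: (etrans (esym (wconstE _ _)) (h1 b))|].
  exact: (etrans (esym (wconstE _ _)) (h1' b)).
- have [n' nn'] := hT _ (G_orbit_act (sg 1 i) On).
  by eexists; eexists; split; [exact: ((h2 n' i).1 nn')|exact: ((h2' n' i).1 nn')].
have [n' nn'] := hT _ (G_orbit_act (sg (-1) i) On).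
by eexists; eexists; split; [exact: ((h2 n' i).2 nn')|exact: ((h2' n' i).2 nn')].
Qed.
End IsS.

(** * Presenting a given simple module over R(m) *)

Section SimpleToFamily.
Variables (K : fieldType) (I : choiceType) (q : nat) (m : maxD K I) (Ib : set I).
Hypothesis H : charp_axioms q m Ib.
Variables (W : weyl_sys K I) (V : lmodType W) (v : V).
Hypotheses (Vs : wsimple V) (mv : wspace m v).
Local Notation x := (wx W).
Local Notation d := (wd W).
Local Notation D := (wD W).
Local Notation O := (G_orbit m).
Local Notation up i n := (act (sg 1 i) n).
Local Notation dn i n := (act (sg (-1) i) n).
Implicit Types (n : maxD K I) (i j : I).

(** In characteristic q the power [d_i^q] is central, its commutator with [x_i] being
    [q d_i^(q-1) = 0]. *)
Lemma dq_sub i : wsub [set u : V | d i ^+ q *: u = 0].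
Proof.
have qE : q = q.-1.+1 by rewrite (prednK (cp_gt0 H)).
apply: weyl_gen_sub => /= [|u u' hu hu'|a u ga hu]; first by rewrite scaler0.
  by rewrite scalerDr hu hu' addr0.
case: ga => [[b ->]|[[j ->]|[j ->]]].
- by rewrite scalerA wdn_D -scalerA hu scaler0.
- have [ij|ij] := eqVneq i j; last by rewrite scalerA (wdn_comm_x W q ij) -scalerA hu scaler0.
  rewrite ij in hu *; rewrite scalerA; suff -> : d j ^+ q * x j = x j * d j ^+ q.
    by rewrite -scalerA hu scaler0.
  rewrite qE wdn_x wx_dn; congr (D _ * _); congr (_ + _).
  have := PD_int I (cp_q H) (dvdzz q); rewrite {1}qE -pmulrn -natr1 => /eqP.
  by rewrite addr_eq0 => /eqP.
by rewrite scalerA (wdn_comm_d W i j q) -scalerA hu scaler0.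
Qed.

(** [d_i^q x_i v = (t_i + q - 1) d_i^(q-1) v] is 0, because [t_i + q - 1] lies in the ideal of the
    weight of [d_i^(q-1) v]. So [x_i v] is a nonzero element of the kernel of [d_i^q], a submodule,
    which must be all of [V]. *)
Lemma x_or_d i : Ib i -> x i *: v <> 0 -> d i ^+ q *: v = 0.
Proof.
move=> Ii xv; have hS := dq_sub i.
have qE : q = q.-1.+1 by rewrite (prednK (cp_gt0 H)).
suff h : [set u : V | d i ^+ q *: u = 0] (x i *: v).
  have [h0|h1] := Vs.2 _ hS; last exact: h1.
  by case: xv; apply: h0.
have dw : wspace (act (sg (- q.-1%:Z) i) m) (d i ^+ q.-1 *: v).
  by apply: wspace_act mv _ => f; exact: wdn_D.
rewrite /= scalerA qE wdn_x -scalerA; apply: dw.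
rewrite (pmulrn 1 q.-1); apply/act_tv; rewrite mcoeff_sg eqxx addNr addr0.
exact: (cp_Ib H).
Qed.

(** The directions in which translation by q does not kill [v]: upwards through [x_i], then xi is 1,
    or downwards through [d_i^q], then xi is 0. *)
Definition Gamma_of : set I := [set i | Ib i /\ (x i *: v <> 0 \/ d i ^+ q *: v <> 0)].
Definition xi_of (j : Gamma_of) : bool := `[< x (val j) *: v <> 0 >].
Local Notation Gamma := Gamma_of.
Local Notation xi := xi_of.
Local Notation E := (expo Ib Gamma).

Lemma Gamma_of_sub : Gamma `<=` Ib. Proof. by move=> i []. Qed.

Lemma xi_trueP i : xi_is xi true i <-> Ib i /\ x i *: v <> 0.
Proof.
split=> [[j <- /asboolP xj]|[Ii xv]].
  by split=> //; have [] := set_mem (valP j).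
have Gi : Gamma i by split=> //; left.
by exists (SigSub (mem_set Gi)) => //; apply/asboolP.
Qed.

Lemma xi_falseP i : xi_is xi false i <-> [/\ Ib i, x i *: v = 0 & d i ^+ q *: v <> 0].
Proof.
split=> [[j <- /asboolP xj]|[Ii xv dv]].
  by have [Ij [//|dj]] := set_mem (valP j); split=> //; apply: contrapT.
have Gi : Gamma i by split=> //; right.
by exists (SigSub (mem_set Gi)) => //; apply/asboolP.
Qed.

(* a_i moves down along the lattice, b_i and c_i up. *)
Definition dir i : int := if `[< xi_is xi false i >] then -1 else 1.

(** The lattice point representing the monomial [u] at weight [n]: a unit of exponent in direction
    [i] is a translation by q, and all these points lie over [n] because such translations fix
    [m]. *)
Fact pos_subproof : {p : maxD K I -> E -> {malg int[I]} |
  forall n u i, (p n u)@_i = - (hc q m n)@_i + q%:Z * (dir i * (\val u)@_i)}.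
Proof.
exists (fun n (u : E) => - hc q m n +
  \sum_(i <- msupp (\val u)) sg (q%:Z * (dir i * (\val u)@_i)) i) => n u i.
rewrite mcoeffD mcoeffN; congr (_ + _).
by apply: mcoeff_sum_sg => j /mcoeff_outdom ->; rewrite !mulr0.
Qed.
Definition pos : maxD K I -> E -> {malg int[I]} := sval pos_subproof.
Lemma posE n u i : (pos n u)@_i = - (hc q m n)@_i + q%:Z * (dir i * (\val u)@_i).
Proof. exact: (svalP pos_subproof). Qed.

Lemma pos_orbit n u : O n -> act (pos n u) m = n.
Proof.
move=> On; rewrite -[RHS](hcK H On); apply/(cp_stab H) => i.
rewrite posE mcoeffN opprK addrAC addNr add0r; exact: dvdz_mulr (dvdzz q).
Qed.

Lemma pos_up n u i : O n -> (hc q m n)@_i <> 0 -> pos (up i n) u = pos n u + sg 1 i.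
Proof.
move=> On h; apply/malgP => j; rewrite coD !posE (hc_up H i j On).
by have [<-|_] := eqVneq i j; [case: eqVneq => // _; lia|lia].
Qed.

Lemma pos_up0 n u i : O n -> (hc q m n)@_i = 0 -> dir i = 1 ->
  \val (expo_var Ib Gamma 1 i) = sg 1 i ->
  pos (up i n) (expo_var Ib Gamma 1 i + u) = pos n u + sg 1 i.
Proof.
move=> On h di ei; apply/malgP => j; rewrite coD !posE (hc_up H i j On).
rewrite raddfD /= ei mcoeff_sg.
have [<-|_] := eqVneq i j; last by rewrite add0r addr0.
by rewrite h eqxx di; lia.
Qed.

Lemma pos_dn n u i : O n -> (hc q m n)@_i <> q%:Z - 1 -> pos (dn i n) u = pos n u + sg (-1) i.
Proof.
move=> On h; apply/malgP => j; rewrite coD !posE (hc_dn H i j On).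
by have [<-|_] := eqVneq i j; [case: eqVneq => // _; lia|lia].
Qed.

Lemma pos_dn0 n u i (k : int) : O n -> (hc q m n)@_i = q%:Z - 1 -> dir i * k = -1 ->
  \val (expo_var Ib Gamma k i) = sg k i ->
  pos (dn i n) (expo_var Ib Gamma k i + u) = pos n u + sg (-1) i.
Proof.
move=> On h di ei; apply/malgP => j; rewrite coD !posE (hc_dn H i j On).
rewrite raddfD /= ei mcoeff_sg.
have [<-|_] := eqVneq i j; last by rewrite add0r addr0.
by rewrite h eqxx mulrDr di; lia.
Qed.

Lemma dir_true i : ~ xi_is xi false i -> dir i = 1.
Proof. by rewrite /dir => h; rewrite asboolF. Qed.

Lemma dir_false i : xi_is xi false i -> dir i = -1.
Proof. by rewrite /dir => h; rewrite asboolT. Qed.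

Lemma expo_nonneg (u : E) i : Ib i -> 0 <= (\val u)@_i.
Proof.
have /asboolP/(_ i)[h1 h2] := valP u.
by move=> Ii; have [/h1//|/(h2 Ii) ->] := pselect (Gamma i).
Qed.

Lemma expo_out (u : E) i : Ib i -> ~ Gamma i -> (\val u)@_i = 0.
Proof. by have /asboolP/(_ i)[_ h2] := valP u. Qed.

Lemma not_dvd_pos (h s : int) : 0 < h < q%:Z -> ~ (q %| - h + q%:Z * s)%Z.
Proof.
move=> hh dv; apply: (@not_dvd_range q (- h)); first lia.
by apply: (dvd_eq _ (rpredB dv (dvdz_mulr s (dvdzz q)))); lia.
Qed.

Variable w : {malg int[I]} -> V.
Hypotheses (ww : forall g, wspace (act g m) (w g))
  (wX : forall (g : {malg int[I]}) i, 0 <= g@_i \/ ~ inm m (tv K i + (g@_i)%:~R) -> x i *: w g = w (g + sg 1 i))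
  (wX0 : forall (g : {malg int[I]}) i, g@_i < 0 -> inm m (tv K i + (g@_i)%:~R) -> x i *: w g = 0)
  (wY : forall (g : {malg int[I]}) i, 0 < g@_i \/ ~ inm m (tv K i + (g@_i)%:~R - 1) ->
    d i *: w g = D (tv K i) *: w (g + sg (-1) i))
  (wY0 : forall (g : {malg int[I]}) i, g@_i <= 0 -> inm m (tv K i + (g@_i)%:~R - 1) ->
    d i *: w g = w (g + sg (-1) i))
  (wx0 : forall (g : {malg int[I]}) i (k : nat), g@_i = k -> x i ^+ k.+1 *: v = 0 -> x i *: w g = 0)
  (wd0 : forall (g : {malg int[I]}) i (k : nat), g@_i = - k%:Z -> d i ^+ k.+1 *: v = 0 -> d i *: w g = 0).

Lemma inm_tv i (k : int) : Ib i -> (q %| k)%Z -> inm m (tv K i + k%:~R).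
Proof. by move=> Ii qk; rewrite (PD_int I (cp_q H) qk) addr0; apply: (cp_Ib H). Qed.

Lemma inm_tv1 i (k : int) : inm m (tv K i + k%:~R - 1) -> Ib i /\ (q %| k - 1)%Z.
Proof. by move=> h; apply: (cp_break H); rewrite intrB addrA. Qed.

Lemma inm_tv1' i (k : int) : Ib i -> (q %| k - 1)%Z -> inm m (tv K i + k%:~R - 1).
Proof. by move=> Ii qk; rewrite -addrA -[_ - 1](intrB _ k 1); apply: inm_tv. Qed.

Lemma w_up n u i : (hc q m n)@_i <> 0 -> x i *: w (pos n u) = w (pos n u + sg 1 i).
Proof.
move=> h; apply: wX; right=> /(cp_break H)[_]; rewrite posE.
by apply: not_dvd_pos; have := hc_bound H n i; lia.
Qed.

Lemma w_up0 n u i : (hc q m n)@_i = 0 -> xi_is xi true i \/ ~ Ib i ->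
  x i *: w (pos n u) = w (pos n u + sg 1 i).
Proof.
move=> h [xt|Ii]; apply: wX; last by right=> /(cp_break H)[].
left; rewrite posE h dir_true; last by move=> xf; exact: xi_is_excl xt xf.
by have := expo_nonneg u ((xi_trueP i).1 xt).1; nia.
Qed.

(** If [u_i = 0], the vanishing of [x_i v] propagates. If [u_i > 0], the variable is [a_i] and the
    lattice point sits on a wall strictly below 0, which [x_i] cannot cross upwards. *)
Lemma w_up00 n u i : (hc q m n)@_i = 0 -> Ib i -> ~ xi_is xi true i -> x i *: w (pos n u) = 0.
Proof.
move=> h Ii nt; have xv : x i *: v = 0.
  by apply: contrapT => xv; apply: nt; apply/xi_trueP.
have pE : (pos n u)@_i = q%:Z * (dir i * (\val u)@_i) by rewrite posE h oppr0 add0r.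
have [u0|u0] := eqVneq (\val u)@_i 0.
  by apply: (@wx0 _ _ 0%N); [rewrite pE u0 !mulr0|rewrite expr1].
have Gi : Gamma i by apply: contrapT => Gi; case/eqP: u0; apply: expo_out.
have xf : xi_is xi false i.
  by apply/xi_falseP; split=> //; case: Gi.2.
have un := expo_nonneg u Ii; apply: wX0.
  by rewrite pE (dir_false xf); have := cp_gt0 H; move/eqP: u0; nia.
by apply: inm_tv => //; rewrite pE; exact: dvdz_mulr (dvdzz q).
Qed.

Lemma w_dn n u i : (hc q m n)@_i <> q%:Z - 1 ->
  d i *: w (pos n u) = D (tv K i) *: w (pos n u + sg (-1) i).
Proof.
move=> h; apply: wY; right=> /inm_tv1[_]; rewrite posE => dv.
apply: (@not_dvd_pos ((hc q m n)@_i + 1) (dir i * (\val u)@_i)).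
  by have := hc_bound H n i; lia.
by apply: (dvd_eq _ dv); lia.
Qed.

Lemma w_dn0c n u i : ~ Ib i -> d i *: w (pos n u) = D (tv K i) *: w (pos n u + sg (-1) i).
Proof. by move=> Ii; apply: wY; right=> /inm_tv1[]. Qed.

Lemma dvd_pos1 n u i : (hc q m n)@_i = q%:Z - 1 -> (q %| (pos n u)@_i - 1)%Z.
Proof.
move=> h; rewrite posE h.
apply: (dvd_eq _ (dvdz_mulr (dir i * (\val u)@_i - 1) (dvdzz q))); lia.
Qed.

Lemma w_dn0a n u i : (hc q m n)@_i = q%:Z - 1 -> xi_is xi false i ->
  d i *: w (pos n u) = w (pos n u + sg (-1) i).
Proof.
move=> h xf; have Ii : Ib i by case/xi_falseP: xf.
apply: wY0; last by apply: inm_tv1' => //; apply: dvd_pos1.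
rewrite posE h (dir_false xf); have := expo_nonneg u Ii; have := cp_gt0 H; nia.
Qed.

(** If [u_i = 0], the coordinate is [-(q-1)] and the vanishing of [d_i^q v] propagates. If
    [u_i > 0], the coordinate is positive, so [d_i] produces the factor [t_i], which annihilates the
    target weight. *)
Lemma w_dn00 n u i : (hc q m n)@_i = q%:Z - 1 -> Ib i -> ~ xi_is xi false i ->
  d i *: w (pos n u) = 0.
Proof.
move=> h Ii nf; have qE : q = q.-1.+1 by rewrite (prednK (cp_gt0 H)).
have dv : d i ^+ q *: v = 0.
  have [xv|xv] := pselect (x i *: v = 0); last exact: x_or_d.
  by apply: contrapT => dv; apply: nf; apply/xi_falseP.
have pE : (pos n u)@_i = - q%:Z + 1 + q%:Z * (\val u)@_i.
  by rewrite posE h (dir_true nf) mul1r; lia.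
have un := expo_nonneg u Ii.
have [u0|u0] := eqVneq (\val u)@_i 0.
  by apply: (@wd0 _ _ q.-1); [rewrite pE u0 mulr0; have := cp_gt0 H; lia|rewrite -qE].
have pp : 0 < (pos n u)@_i by rewrite pE; have := cp_gt0 H; move/eqP: u0; nia.
rewrite wY; last by left.
apply: ww; apply/act_tv0; rewrite coD eqxx; apply: inm_tv => //.
exact: (dvd_pos1 u h).
Qed.

Local Notation sU l u := (skewU (tau_twist Ib xi m) l u).
Local Notation R := (R_ring Ib xi m).
Local Notation c := (cR H xi).
Local Notation Vp := (@VpR K I m Ib Gamma xi).
Local Notation Vm := (@VmR K I q m Ib H Gamma xi).

Lemma lift_eq n f f' u : O n -> inm m (f - f') ->
  D (sh (- hc q m n) f) *: w (pos n u) = D (sh (- hc q m n) f') *: w (pos n u).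
Proof.
move=> On mf; have wn : wspace n (w (pos n u)) by rewrite -[X in wspace X](pos_orbit u On).
apply: (wspace_eqm wn); rewrite -rmorphB -{1}(hcK H On).
exact: (proj2 (act_mem' _ _ _) mf).
Qed.

(** The candidate presentation: a monomial goes to the translate at its lattice point, and
    coefficients act after transport from [m] to [n]. It is set to 0 off the orbit. *)
Lemma evaluation : exists e : maxD K I -> R -> V,
  [/\ forall n, zmod_morphism (e n), forall n r, ~ O n -> e n r = 0 &
      forall n f u, O n -> e n (sU (rs m f) u) = D (sh (- hc q m n) f) *: w (pos n u)].
Proof.
pose F n (u : E) (a : residue m) : V := D (sh (- hc q m n) (repr a)) *: w (pos n u).
have FB n u : O n -> zmod_morphism (F n u).
  move=> On a b; rewrite /F -scalerBl -rmorphB -rmorphB; apply: lift_eq => //.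
  by apply/rsP; rewrite rsB !rs_repr.
exists (fun n r => if pselect (O n) is left _ then malg_ext (F n) r else 0).
split=> [n|n r On|n f u On]; case: pselect => //.
- by move=> On; apply: malg_extB => u; apply: FB.
- by move=> _ r s; rewrite subrr.
move=> _; apply: (etrans (malg_extU (F := F n) (fun u => FB n u On) u (rs m f))).
apply: lift_eq => //; apply/rsP; exact: rs_repr.
Qed.

Lemma sh_move g n n' (f : PD K I) : O n -> act g n = n' ->
  sh g (sh (- hc q m n) f) = sh (- hc q m n') f.
Proof.
move=> On gn; have On' : O n' by rewrite -gn; apply: G_orbit_act.
rewrite -shD; apply: (sh_dvd (cp_q H)); apply/(cp_stab H).
by rewrite actD (hcK H On) gn (hcK H On').
Qed.

Lemma vR_mulU k i a (u : E) : vR m Ib xi k i * sU a u = sU a (expo_var Ib Gamma k i + u).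
Proof.
apply: (etrans (R_mulU H xi 1 a _ u (orbit0 m))).
exact: (congr1 (skewU _ ^~ _) (mul1r a)).
Qed.

Lemma c_mulU f' f (u : E) : c f' * sU (rs m f) u = sU (rs m (f' * f)) u.
Proof.
apply: (etrans (cR_mulU H xi f' (rs m f) u)).
exact: (congr1 (skewU _ ^~ _) (esym (rsM m f' f))).
Qed.

Variable e : maxD K I -> R -> V.
Hypotheses (eB : forall n, zmod_morphism (e n)) (e_out : forall n r, ~ O n -> e n r = 0)
  (eU : forall n f u, O n -> e n (sU (rs m f) u) = D (sh (- hc q m n) f) *: w (pos n u)).

Let e0 n : e n 0 = 0 := zmod_morphism0 (eB n).

Lemma e_up n i f u : O n -> x i *: e n (sU (rs m f) u) = e (up i n) (xc q m Vp n i * sU (rs m f) u).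
Proof.
move=> On; have On' := G_orbit_act (sg 1 i) On.
apply: (etrans (congr1 ( *:%R (x i)) (eU f u On))).
rewrite scalerA wxD -scalerA (sh_move f On (erefl _)) /xc.
case: eqVneq => [h|/eqP h]; last first.
  rewrite (w_up u h) -(pos_up u On h).
  apply: (etrans (esym (eU f u On'))); exact: (congr1 (e (up i n)) (esym (mul1r _))).
have [ht|ht] := pselect (xi_is xi true i \/ ~ Ib i).
  have -> : Vp i = vR m Ib xi 1 i.
    rewrite /VpR; case: asboolP => // nt; case: asboolP => // Ii.
    by case: ht.
  have di : dir i = 1.
    apply: dir_true => xf; case: ht => [xt|Ii]; first exact: xi_is_excl xt xf.
    by case/xi_falseP: xf.
  have ei : \val (expo_var Ib Gamma 1 i) = sg 1 i.
    apply: (expo_varE Gamma_of_sub); case: ht => [xt|Ii]; [left|by right].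
    by split=> //; exact: xi_isG xt.
  rewrite (w_up0 u h ht) -(pos_up0 u On h di ei).
  apply: (etrans (esym (eU f _ On'))).
  exact: (congr1 (e (up i n)) (esym (vR_mulU 1 i _ u))).
have nt : ~ xi_is xi true i by move=> xt; apply: ht; left.
have Ii : Ib i by apply: contrapT => Ii; apply: ht; right.
rewrite (w_up00 u h Ii nt) scaler0.
have -> : Vp i = 0.
  by rewrite /VpR (asboolF nt); case: asboolP.
exact: (etrans (esym (e0 _)) (congr1 (e (up i n)) (esym (mul0r _)))).
Qed.

Lemma e_dn n i f u : O n -> d i *: e n (sU (rs m f) u) = e (dn i n) (dc q m c Vm n i * sU (rs m f) u).
Proof.
move=> On; have On' := G_orbit_act (sg (-1) i) On.
have hi := hc_dn H i i On; rewrite eqxx in hi.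
apply: (etrans (congr1 ( *:%R (d i)) (eU f u On))).
rewrite scalerA wdD -scalerA (sh_move f On (erefl _)) /dc.
have tE : sh (- hc q m (dn i n)) (tv K i - ((hc q m (dn i n))@_i)%:~R) = tv K i.
  by rewrite rmorphB rmorph_int sh_tv mcoeffN intrN opprK addrK.
case: eqVneq hi => [h hi|/eqP h hi]; last first.
  rewrite (w_dn u h) -(pos_dn u On h) scalerA -rmorphM -hi.
  apply: (etrans _ (congr1 (e (dn i n)) (esym (c_mulU _ f u)))).
  apply: (etrans _ (esym (eU _ u On'))).
  by rewrite [in RHS](rmorphM (sh _)) tE mulrC.
have [xf|nf] := pselect (xi_is xi false i).
  have -> : Vm i = vR m Ib xi 1 i by rewrite /VmR asboolT.
  have di : dir i * 1 = -1 by rewrite (dir_false xf).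
  have ei : \val (expo_var Ib Gamma 1 i) = sg 1 i.
    by apply: (expo_varE Gamma_of_sub); left; split=> //; exact: xi_isG xf.
  rewrite (w_dn0a u h xf) -(pos_dn0 u On h di ei).
  apply: (etrans (esym (eU f _ On'))).
  exact: (congr1 (e (dn i n)) (esym (vR_mulU 1 i _ u))).
have [Ii|Ii] := pselect (Ib i).
  rewrite (w_dn00 u h Ii nf) scaler0.
  have -> : Vm i = 0 by rewrite /VmR (asboolF nf); case: asboolP.
  exact: (etrans (esym (e0 _)) (congr1 (e (dn i n)) (esym (mul0r _)))).
have -> : Vm i = vR m Ib xi (-1) i * c (tv K i) by rewrite /VmR (asboolF nf) (asboolT Ii).
have di : dir i * (-1) = -1 by rewrite (dir_true nf).
have ei : \val (expo_var Ib Gamma (-1) i) = sg (-1) i.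
  by apply: (expo_varE Gamma_of_sub); right.
rewrite (w_dn0c _ u Ii) -(pos_dn0 u On h di ei) scalerA -rmorphM.
rewrite hi subr0 in tE.
apply: (etrans _ (congr1 (e (dn i n)) (mulrA _ _ _))).
apply: (etrans _ (congr1 (fun z => e (dn i n) (_ * z)) (esym (c_mulU _ f u)))).
apply: (etrans _ (congr1 (e (dn i n)) (esym (vR_mulU _ i _ u)))).
apply: (etrans _ (esym (eU _ _ On'))).
by rewrite [in RHS](rmorphM (sh _)) tE mulrC.
Qed.

Lemma e_const n a f u : O n ->
  D (cD I a) *: e n (sU (rs m f) u) = e n (c (cD I a) * sU (rs m f) u).
Proof.
move=> On; apply: (etrans (congr1 ( *:%R (D (cD I a))) (eU f u On))).
apply: (etrans _ (congr1 (e n) (esym (c_mulU _ f u)))).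
apply: (etrans _ (esym (eU _ u On))).
by rewrite scalerA -rmorphM [in RHS](rmorphM (sh _)) shC.
Qed.

Lemma e_ext n n' (a : W) (s : R) :
  (forall f u, a *: e n (sU (rs m f) u) = e n' (s * sU (rs m f) u)) ->
  forall r, a *: e n r = e n' (s * r).
Proof.
move=> h; have eD k := zmod_morphismD (eB k).
apply: R_ind => [|r r' IH IH'|l u].
- exact: (etrans (congr1 ( *:%R a) (e0 n)) (etrans (scaler0 _ _) (etrans (esym (e0 n')) (congr1 (e n') (esym (mulr0 _)))))).
- by rewrite eD scalerDr IH IH' mulrDr eD.
by elim/rs_ind: l => f; apply: h.
Qed.

Lemma e_family : @s_family K I q m R c Vp Vm W V e.
Proof.
split=> [n|n a r On|n i r On|n i r On]; first exact: eB.
- by apply: e_ext => f u; exact: e_const.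
- by apply: e_ext => f u; exact: e_up.
by apply: e_ext => f u; exact: e_dn.
Qed.
End SimpleToFamily.

Section SimpleParam.
Variables (K : fieldType) (I : choiceType) (q : nat) (m : maxD K I) (Ib : set I).
Hypothesis H : charp_axioms q m Ib.
Variables (W : weyl_sys K I) (V : lmodType W) (v : V).
Hypotheses (Vs : wsimple V) (mv : wspace m v) (v0 : v != 0).
Local Notation d := (wd W).
Local Notation D := (wD W).
Local Notation O := (G_orbit m).
Local Notation Gamma := (Gamma_of q Ib v).
Local Notation xi := (@xi_of K I q Ib W V v).
Local Notation R := (R_ring Ib xi m).

Lemma simple_family : exists e : maxD K I -> R -> V,
  [/\ s_family q m (cR H xi) (@VpR K I m Ib Gamma xi) (@VmR K I q m Ib H Gamma xi) e,
      s_spanned m e & e m 1 = v].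
Proof.
have [w [[w0 ww wX wX0 wY] [wY0 wx0 wd0]]] := lattice_family mv.
have [e [eB e_out eU]] := evaluation H v ww.
have He := e_family H Vs mv ww wX wX0 wY wY0 wx0 wd0 eB eU.
have e1 : e m 1 = v.
  have p0 : @pos K I q m Ib W V v m 0 = 0.
    by apply/malgP => i; rewrite posE (hc0 H) !raddf0 !mulr0 addr0.
  apply: (etrans (congr1 (fun z => e m (skewU _ z 0)) (esym (rs1 m)))).
  apply: (etrans (eU m 1 0 (orbit0 m))).
  by rewrite p0 w0 (rmorph1 (sh _)) (rmorph1 D) scale1r.
exists e; split=> //.
have hT : wsub (span_of e).
  apply: span_of_sub => a n r ga; have [On|On] := pselect (O n); last first.
    by rewrite (e_out n r On) scaler0 => P.
  case: ga => [[b ->]|[[i ->]|[i ->]]].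
  - by rewrite (sf_c He _ _ On); apply: span_of_mem.
  - by rewrite (sf_x He _ _ On); apply: span_of_mem.
  by rewrite (sf_d He _ _ On); apply: span_of_mem.
have Sv : span_of e (e m 1) by apply: span_of_mem.
have [h|h] := Vs.2 _ hT; first by case/eqP: (v0); apply: (etrans (esym e1)); apply: h.
move=> P P0 PD PE u; apply: (h u P) => // n r.
have [On|On] := pselect (O n); last by rewrite (e_out n r On).
by apply: PE; exists n, r.
Qed.

(** Properness: if the variable at [i] lay in N, then [x_i] would vanish at weight [m], or [d_i] at
    weight sigma_i(m), contradicting [x_i v <> 0] or [d_i^q v <> 0] respectively. *)
Lemma simple_param : exists (P : S_param m Ib) (e : maxD K I -> R_ring Ib (@pxi _ _ _ _ P) m -> V),
  [/\ proper_param P,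
      s_family q m (cR H _) (@VpR K I m Ib _ (@pxi _ _ _ _ P)) (@VmR K I q m Ib H _ (@pxi _ _ _ _ P)) e,
      s_spanned m e & [set r | e m r = 0] = @pN _ _ _ _ P].
Proof.
have [e [He hE e1]] := simple_family.
have HR := R_s_axioms H xi (@Gamma_of_sub K I q Ib W V v).
have e1' : e m 1 != 0 by rewrite e1.
pose P := SParam (@Gamma_of_sub K I q Ib W V v) (sf_maximal H HR He hE Vs e1').
exists P, e; split=> // i Gi Ni.
have [Ii _] := Gi.
have [xt|xf] := xi_is_total xi Gi.
  have [_ xv] := (xi_trueP q Ib v i).1 xt; apply: xv.
  apply: (proj2 (sf_x_vanish H HR He i hE) _ _ mv).
  by rewrite /VpR (asboolT xt).
have [_ _ dv] := (xi_falseP q Ib v i).1 xf; apply: dv.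
(* [d_i^(q-1) v] has weight sigma_i(m), since sigma_i^q fixes [m]; so [d_i^q v] is [d_i] applied to
   a vector of that weight. *)
have dw : wspace (act (sg (- q.-1%:Z) i) m) (d i ^+ q.-1 *: v).
  by apply: wspace_act mv _ => f; exact: wdn_D.
have qE : q = q.-1.+1 by rewrite (prednK (cp_gt0 H)).
rewrite qE exprS -scalerA; apply: (proj2 (sf_d_vanish H HR He i hE)).
  by rewrite /VmR (asboolT xf).
suff -> : act (sg 1 i) m = act (sg (- q.-1%:Z) i) m by exact: dw.
apply/(cp_stab H) => j; rewrite !mcoeff_sg; case: eqP => _; last by rewrite subrr dvdz0.
by apply: (dvd_eq _ (dvdzz q)); have := cp_gt0 H; lia.
Qed.
End SimpleParam.

(** * The list of simple modules in characteristic q *)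

Section CharPList.
Variables (K : fieldType) (I : choiceType) (q : nat) (m : maxD K I) (Ib : set I).
Hypothesis H : charp_axioms q m Ib.
Hypothesis swd : sigma_well_defined m.
Let W : weyl_sys K I := weyl_system K I.

Definition vanishes (V : lmodType W) (a : W) (n : maxD K I) : Prop :=
  forall u : V, wspace n u -> a *: u = 0.

Lemma vanishes_iso (V V' : lmodType W) (phi : {linear V -> V'}) a n :
  bijective phi -> vanishes V a n <-> vanishes V' a n.
Proof.
move=> phi_bij; have phi_inj := bij_inj phi_bij; have [psi phiK psiK] := phi_bij.
have nP u : wspace n u <-> wspace n (phi u).
  split=> nu f nf; first by rewrite -linearZ (nu f nf) linear0.
  by apply: phi_inj; rewrite linear0 linearZ_LR; exact: nu.
split=> h u nu; last by apply: phi_inj; rewrite linear0 linearZ_LR; apply: h; apply/nP.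
by rewrite -(psiK u) -linearZ h ?linear0 //; apply/nP; rewrite psiK.
Qed.

Local Notation xi P := (@pxi K I m Ib P).
Local Notation R P := (R_ring Ib (xi P) m).
Local Notation family P V e := (@s_family K I q m (R P) (cR H (xi P))
  (@VpR K I m Ib (pGamma P) (xi P)) (@VmR K I q m Ib H (pGamma P) (xi P)) W V e).

Definition realizes (P : S_param m Ib) (V : lmodType W) (e : maxD K I -> R P -> V) : Prop :=
  [/\ family P V e, @s_spanned K I m (R P) W V e & [set r | e m r = 0] = @pN _ _ _ _ P].

Let HR (P : S_param m Ib) := R_s_axioms H (xi P) (@pGamma_sub _ _ _ _ P).

Lemma realizes_exists P : exists (V : lmodType W) e, @realizes P V e.
Proof.
have [hN _ _] := pN_max P.
exact: (s_family_exists H (HR P) hN).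
Qed.

Section OneRealization.
Variables (P : S_param m Ib) (V : lmodType W) (e : maxD K I -> R P -> V).
Hypothesis He : realizes e.

Lemma realizes_one : e m 1 != 0.
Proof.
have [_ _ eN] := He; have [_ N1 _] := pN_max P.
by apply/eqP => h; apply: N1; rewrite -eN.
Qed.

Lemma realizes_class :
  [/\ simple_module V, weight_module V & weight_support V = G_orbit m].
Proof.
have [hf hE eN] := He; split.
- by apply/wsimpleE; apply: (sf_simple H (HR P) hf hE); rewrite eN; exact: pN_max.
- by apply/wweightE; exact: (sf_hom H (HR P) hf hE).
apply/seteqP; split=> n; rewrite /weight_support /= wspaceE.
  exact: (sf_support H (HR P) hf n hE realizes_one).1.
exact: (sf_support H (HR P) hf n hE realizes_one).2.
Qed.

Lemma realizes_is_S : is_S P V.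
Proof. by have [hf hE eN] := He; exact: (is_S_intro swd hf hE eN). Qed.

Lemma realizes_true i : proper_param P ->
  xi_is (xi P) true i <-> Ib i /\ ~ vanishes V (wx W i) m.
Proof.
have [hf hE eN] := He; have [hN _ _] := pN_max P.
move=> hP; have van := sf_x_vanish H (HR P) hf i hE.
have eP r : e m r = 0 <-> @pN _ _ _ _ P r by rewrite -eN.
split=> [xt|[Ii nv]].
  have Gi := xi_isG xt; split; first exact: (pGamma_sub Gi).
  by move=> /van /eP; rewrite /VpR (asboolT xt); exact: hP.
apply: contrapT => nt; apply: nv; apply/van/eP.
by rewrite /VpR (asboolF nt); case: asboolP => // _; exact: (ideal0 hN).
Qed.

Lemma realizes_false i : proper_param P ->
  xi_is (xi P) false i <-> Ib i /\ ~ vanishes V (wd W i) (act (sg 1 i) m).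
Proof.
have [hf hE eN] := He; have [hN _ _] := pN_max P.
move=> hP; have van := sf_d_vanish H (HR P) hf i hE.
have eP r : e m r = 0 <-> @pN _ _ _ _ P r by rewrite -eN.
split=> [xf|[Ii nv]].
  have Gi := xi_isG xf; split; first exact: (pGamma_sub Gi).
  by move=> /van /eP; rewrite /VmR (asboolT xf); exact: hP.
apply: contrapT => nf; apply: nv; apply/van/eP.
by rewrite /VmR (asboolF nf); case: asboolP => // _; exact: (ideal0 hN).
Qed.
End OneRealization.

(** For proper parameters no variable of Gamma lies in N, so vanishing of [x_i] and [d_i] at the
    wrapping steps determines Gamma and xi. The ring is then the same on both sides and the maximal
    ideals agree by [sf_ker_eq]. *)
Lemma realizes_inj (P P' : S_param m Ib) (V V' : lmodType W) e e' :
  @realizes P V e -> @realizes P' V' e' -> proper_param P -> proper_param P' ->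
  isomorphic V V' -> P = P'.
Proof.
move=> He He' hP hP' [phi phi_bij].
have xt i : xi_is (xi P) true i <-> xi_is (xi P') true i.
  rewrite (realizes_true He i hP) (realizes_true He' i hP').
  by rewrite (vanishes_iso _ _ phi_bij).
have xf i : xi_is (xi P) false i <-> xi_is (xi P') false i.
  rewrite (realizes_false He i hP) (realizes_false He' i hP').
  by rewrite (vanishes_iso _ _ phi_bij).
have GG : pGamma P = pGamma P'.
  apply/seteqP; split=> i /[dup] Gi; first by case/(xi_is_total (xi P)) => [/xt|/xf]; exact: xi_isG.
  by case/(xi_is_total (xi P')) => [/xt|/xf]; exact: xi_isG.
(* The type of xi depends on Gamma, and that of N on both, so each component is substituted before
   the next is compared. *)
case: P P' e e' He He' hP hP' xt xf GG => [G GI x N Nm] [G' GI' x' N' Nm'] /= e e' He He' hP hP' xt xf GG.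
subst G'.
have xx : x = x'.
  apply: functional_extensionality_dep => j; have jj : xi_is x (x j) (val j) by exists j.
  have {}jj : xi_is x' (x j) (val j) by case: (x j) jj => [/xt|/xf].
  by case: jj => k /val_inj -> .
subst x'.
have [hf hE eN] := He; have [hf' hE' eN'] := He'.
have NN : N = N'.
  rewrite -[N]eN -[N']eN'.
  apply: (sf_ker_eq H (HR (SParam GI Nm)) hf hf' hE' (bij_inj phi_bij)).
    by rewrite eN'; exact: Nm'.
  exact: (realizes_one He).
by subst N'; rewrite (Prop_irrelevance GI GI') (Prop_irrelevance Nm Nm').
Qed.

Lemma realizes_exhaustive (V : lmodType W) :
  [/\ simple_module V, weight_module V & weight_support V = G_orbit m] ->
  exists P e, proper_param P /\ @realizes P V e.
Proof.
move=> [/wsimpleE Vs _ sV].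
have [v mv v0] : weight_support V m by rewrite sV; exact: orbit0.
rewrite wspaceE in mv.
have [P [e [hP hf hE eN]]] := simple_param H Vs mv v0.
by exists P, e; split.
Qed.

Lemma charp_list : exists S : S_param m Ib -> lmodType (weyl_algebra K I),
  let C := fun V : lmodType (weyl_algebra K I) =>
    [/\ simple_module V, weight_module V & weight_support V = G_orbit m] in
  [/\ forall P, is_S P (S P), forall P, C (S P) &
    exhaustive_list (fun P : {P : S_param m Ib | proper_param P} => S (sval P)) C].
Proof.
pose S P := sval (cid (realizes_exists P)).
have SP P : exists e, @realizes P (S P) e := svalP (cid (realizes_exists P)).
exists S; split=> [P|P|]; first by have [e /realizes_is_S] := SP P.
  by have [e /realizes_class] := SP P.
split=> [[P hP]|[P hP] [P' hP'] /= iso|V CV] /=.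
- by have [e /realizes_class] := SP P.
- have [[e He] [e' He']] := (SP P, SP P').
  have PP := realizes_inj He He' hP hP' iso; subst P'.
  by congr (exist _ _ _); exact: Prop_irrelevance.
have [P [e [hP He]]] := realizes_exhaustive CV.
exists (exist _ P hP) => /=; have [e' He'] := SP P.
exact: (is_S_iso (realizes_is_S He) (realizes_is_S He')).
Qed.
End CharPList.

Theorem theorem4p7 (K : fieldType) (n : option nat) (hn : n <> Some 0%N)
    (m : maxD K (weyl_index n)) (Ib : set (weyl_index n)) (hm : fixed_ideal m Ib) :
  ([pchar K] =i pred0 ->
     let C := fun V : lmodType (weyl_algebra K (weyl_index n)) =>
       [/\ simple_module V, weight_module V & weight_support V `<=` G_orbit m] in
     (~ degenerate m ->
        exists S : lmodType (weyl_algebra K (weyl_index n)),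
          is_S0 (G_orbit m) S /\ exhaustive_list (fun _ : unit => S) C) /\
     (degenerate m ->
        exists S : B_O m Ib -> lmodType (weyl_algebra K (weyl_index n)),
          (forall p : B_O m Ib, is_S0 (O_p m Ib (val p)) (S p)) /\
          exhaustive_list S C)) /\
  (forall q : nat, q \in [pchar K] -> sigma_well_defined m ->
     let C := fun V : lmodType (weyl_algebra K (weyl_index n)) =>
       [/\ simple_module V, weight_module V & weight_support V = G_orbit m] in
     exists S : S_param m Ib -> lmodType (weyl_algebra K (weyl_index n)),
       [/\ forall P, is_S P (S P),
           forall P, C (S P) &
           exhaustive_list (fun P : {P : S_param m Ib | proper_param P} => S (sval P)) C]).
Proof.
have hb := fixed_break hm; split=> [K0 C|q Kq swd].
  split=> dm; last exact: char0_degenerate.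
  by apply: char0_nondegenerate => //; rewrite -(hm.2 dm).
exact: (charp_list (charp_axiomsP Kq hm swd) swd).
Qed.
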